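(* For any $\kappa\in(0,1/2)$, any $\varepsilon>0$ and any $C>0$, the following holds. Uniformly in $z_1,z_2\in\mathbb{C}$ such that $|z_1|<1-N^{-\frac12+\kappa}$ and $\omega=\sqrt N\,|z_1-z_2|\in[N^{-C},N^{\kappa-\varepsilon}]$, we have, as $N\to\infty$, $$\mathbb{E}\left(\mathscr{O}_{12}\mid\lambda_1=z_1,\lambda_2=z_2\right)=-N\,\frac{1-z_1\overline{z_2}}{|\omega|^4}\,\frac{1-(1+|\omega|^2)e^{-|\omega|^2}}{1-e^{-|\omega|^2}}\left(1+O(N^{-2\kappa+\varepsilon})\right).$$
   Context: Let $G=G_N$ be an $N\times N$ complex Ginibre matrix: its entries are i.i.d. centered complex Gaussians with density $\frac{N}{\pi}e^{-N|w|^2}$ with respect to Lebesgue measure $m$ on $\mathbb{C}$ (so $\mathbb{E}|G_{ij}|^2=1/N$). Its eigenvalues are a.s. distinct and are labelled exchangeably, so that $(\lambda_1,\dots,\lambda_N)$ has joint density proportional to $\prod_{j<k}|\lambda_j-\lambda_k|^2\prod_k \frac{N}{\pi} e^{-N|\lambda_k|^2}$. Let $R_i$, $L_i$ be column vectors with $GR_i=\lambda_iR_i$, $L_i^{t}G=\lambda_iL_i^{t}$, normalized by $L_i^{t}R_j=\delta_{ij}$. The overlaps are $\mathscr{O}_{ij}=(R_j^*R_i)(L_j^*L_i)$; they do not depend on the remaining choice of scaling. Conditioning on $\lambda_1=z_1,\lambda_2=z_2$ means: $\lambda_3,\dots,\lambda_N$ have joint density (with respect to Lebesgue measure on $\mathbb{C}^{N-2}$)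 proportional to $\prod_{3\le j<k\le N}|\lambda_j-\lambda_k|^2\prod_{k=3}^N|z_1-\lambda_k|^2|z_2-\lambda_k|^2e^{-N|\lambda_k|^2}$; and, given all eigenvalues, the overlaps are distributed as those of the upper triangular matrix $T$ (Schur form of $G$) with diagonal $\lambda_1,\dots,\lambda_N$ and with independent centered complex Gaussian entries of variance $1/N$ (same law as $G_{ij}$) strictly above the diagonal. The implied constant in $O(\cdot)$ does not depend on $N,z_1,z_2$ (it may depend on $\kappa,\varepsilon,C$). *)

(* Defs.v *)
From HB Require Import structures.
From mathcomp Require Import all_boot all_order all_algebra.
From mathcomp Require Import complex.
From mathcomp Require Import all_classical all_reals all_analysis.

Set Implicit Arguments.
Unset Strict Implicit.
Unset Printing Implicit Defensive.

Import Order.TTheory GRing.Theory Num.Theory.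
Import numFieldNormedType.Exports.
Import ComplexField.Normc.

Local Open Scope classical_set_scope.
Local Open Scope ring_scope.
Local Open Scope complex_scope.

(* The library's own instance is shadowed by the one for subprobabilities. *)
Lemma sigma_finite_product d1 d2 (T1 : measurableType d1)
    (T2 : measurableType d2) (R : realType)
    (m1 : {sigma_finite_measure set T1 -> \bar R})
    (m2 : {sigma_finite_measure set T2 -> \bar R}) :
  sigma_finite setT (m1 \x m2)%E.
Proof.
have /sigma_finiteP[F [TF ndF Foo]] := sigma_finiteT m1.
have /sigma_finiteP[G [TG ndG Goo]] := sigma_finiteT m2.
exists (fun n => F n `*` G n).
  rewrite -setXTT TF TG predeqE => -[x y]; split.
    move=> [/= [n _ Fnx] [k _ Gky]]; exists (maxn n k) => //; split.
    - by move: x Fnx; exact/subsetPset/ndF/leq_maxl.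
    - by move: y Gky; exact/subsetPset/ndG/leq_maxr.
  by move=> [n _ []/= ? ?]; split; exists n.
move=> k; have [? ?] := Foo k; have [? ?] := Goo k.
split; first exact: measurableX.
by rewrite product_measure1E// lte_mul_pinfty// ge0_fin_numE.
Qed.

(* Product measures on tuples.  The library provides the product sigma-algebra
   on [n.-tuple T] but only binary product measures, so the [n]-th power of a
   sigma-finite measure is built by recursion on [n]. *)
Section tuple_measure.
Context d (T : measurableType d) (R : realType).
Variable mu : {sigma_finite_measure set T -> \bar R}.

Section step.
Variables (n : nat) (m : {sigma_finite_measure set (n.-tuple T) -> \bar R}).

Definition tuple_cons (p : T * n.-tuple T) : n.+1.-tuple T :=
  [the n.+1.-tuple T of p.1 :: p.2].

Lemma measurable_tuple_cons : measurable_fun [set: T * n.-tuple T] tuple_cons.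
Proof. by apply: measurable_cons. Qed.

Definition tuple_measure_step := pushforward (mu \x m)%E tuple_cons.

Let step_sigma_additive : semi_sigma_additive tuple_measure_step.
Proof.
move=> F mF tF mUF.
rewrite /tuple_measure_step /pushforward preimage_bigcup.
apply: measure_semi_sigma_additive.
- move=> k; rewrite -[X in measurable X]setTI.
  by apply: measurable_tuple_cons.
- apply/trivIsetP => /= i j _ _ ij; rewrite -preimage_setI.
  by move/trivIsetP : tF => /(_ _ _ _ _ ij) ->//; rewrite preimage_set0.
- rewrite -preimage_bigcup -[X in measurable X]setTI.
  by apply: measurable_tuple_cons.
Qed.

HB.instance Definition _ := isMeasure.Build _ _ _ tuple_measure_step
  (measure0 (mu \x m)%E) (fun A => measure_ge0 (mu \x m)%E (tuple_cons @^-1` A))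
  step_sigma_additive.

Let step_sigma_finite : sigma_finite setT tuple_measure_step.
Proof.
have [F FT Foo] := sigma_finite_product mu m.
pose g (t : n.+1.-tuple T) := (thead t, [tuple of behead t]).
have mg : measurable_fun setT g.
  apply/measurable_fun_pairP; split => /=.
    exact: (measurable_tnth (ord0 : 'I_n.+1)).
  exact: measurable_behead.
have gK p : g (tuple_cons p) = p.
  case: p => x t; rewrite /g /tuple_cons; congr pair.
  exact: val_inj.
exists (fun k => g @^-1` F k); first by rewrite -preimage_bigcup -FT.
move=> k; have [mFk Fkoo] := Foo k; split.
  by rewrite -[X in measurable X]setTI; apply: mg.
rewrite /tuple_measure_step /pushforward.
rewrite (_ : tuple_cons @^-1` _ = F k)//.
by apply/seteqP; split => p /=; rewrite gK.
Qed.

HB.instance Definition _ := Measure_isSigmaFinite.Build _ _ _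
  tuple_measure_step step_sigma_finite.

End step.

Fixpoint tuple_measure n : {sigma_finite_measure set (n.-tuple T) -> \bar R} :=
  if n is k.+1 then tuple_measure_step (tuple_measure k)
  else \d_([tuple] : 0.-tuple T).

End tuple_measure.

Section overlaps.
Context (R : realType) (N : nat).
Implicit Types (A : 'M[R[i]]_N) (r l : 'I_N -> 'cV[R[i]]_N).

Definition adjoint m p (A : 'M[R[i]]_(m, p)) : 'M[R[i]]_(p, m) :=
  (map_mx conjc A)^T.

Definition is_eigensystem A (lam : 'I_N -> R[i]) r l : Prop :=
  [/\ forall i, A *m r i = lam i *: r i,
      forall i, (l i)^T *m A = lam i *: (l i)^T &
      forall i j, ((l i)^T *m r j) 0 0 = (i == j)%:R].

(* [O_ij = (R_j^* R_i) (L_j^* L_i)].  If the [lam i] are the distinct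
   eigenvalues of [A], this does not depend on the eigensystem chosen by
   [xget]; without any eigensystem the value is 0. *)
Definition overlap A (lam : 'I_N -> R[i]) (i j : 'I_N) : R[i] :=
  xget 0 [set o | exists r l, is_eigensystem A lam r l /\
    o = (adjoint (r j) *m r i) 0 0 * (adjoint (l j) *m l i) 0 0].

End overlaps.

Section conditional_expectation.
Context (R : realType).

(* The measurable space underlying the complex plane. *)
Definition plane : Type := (measurableTypeR R * measurableTypeR R)%type.
HB.instance Definition _ := Measurable.on plane.

Definition cplx (w : plane) : R[i] := w.1 +i* w.2.

Definition plane_measure : set plane -> \bar R :=
  (@lebesgue_measure R \x @lebesgue_measure R)%E.

HB.instance Definition _ := Measure.on plane_measure.
HB.instance Definition _ := Measure_isSigmaFinite.Build _ _ _ plane_measure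
  (sigma_finite_product (@lebesgue_measure R) (@lebesgue_measure R)).

(* The matrix size is [n.+2]: there are [n] eigenvalues besides [z1], [z2]. *)
Section fixed_size.
Variables (n : nat) (z1 z2 : R[i]).
Local Notation N := n.+2.

Definition spectrum (l : n.-tuple plane) : 'I_N -> R[i] :=
  tnth [tuple of z1 :: z2 :: map cplx l].

(* [g] has i.i.d. entries; only those strictly above the diagonal are used. *)
Definition schur (l : n.-tuple plane) (g : N.-tuple (N.-tuple plane)) :
    'M[R[i]]_N :=
  \matrix_(i, j) if i == j then spectrum l i
                 else if (i < j)%N then cplx (tnth (tnth g i) j) else 0.

Definition eigenvalue_density (l : n.-tuple plane) : R :=
  (\prod_(j < n) \prod_(k < n | (j < k)%N)
      normc (cplx (tnth l j) - cplx (tnth l k)) ^+ 2) *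
  \prod_(k < n) (normc (z1 - cplx (tnth l k)) ^+ 2 *
                 normc (z2 - cplx (tnth l k)) ^+ 2 *
                 expR (- (N%:R * normc (cplx (tnth l k)) ^+ 2))).

Definition entry_density (w : plane) : R :=
  N%:R / pi * expR (- (N%:R * normc (cplx w) ^+ 2)).

(* Unnormalized joint density of [lambda_3, ..., lambda_N] and of the Gaussian
   entries, given [lambda_1 = z1] and [lambda_2 = z2]. *)
Definition cond_density (x : n.-tuple plane * N.-tuple (N.-tuple plane)) : R :=
  eigenvalue_density x.1 *
  \prod_(i < N) \prod_(j < N) entry_density (tnth (tnth x.2 i) j).

Definition cond_measure :=
  (tuple_measure plane_measure n \x
   tuple_measure (tuple_measure plane_measure N) N)%E.

Definition overlap12 (x : n.-tuple plane * N.-tuple (N.-tuple plane)) : R[i] :=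
  overlap (schur x.1 x.2) (spectrum x.1) 0 1.

Definition overlap12_integrable : Prop :=
  cond_measure.-integrable setT
    (fun x => (complex.Re (overlap12 x) * cond_density x)%:E) /\
  cond_measure.-integrable setT
    (fun x => (complex.Im (overlap12 x) * cond_density x)%:E).

Definition cond_expectation_overlap12 : R[i] :=
  ((\int[cond_measure]_x (complex.Re (overlap12 x) * cond_density x)) +i*
   (\int[cond_measure]_x (complex.Im (overlap12 x) * cond_density x))) /
  (\int[cond_measure]_x cond_density x)%:C.

End fixed_size.
End conditional_expectation.

(* Main.v *)
From HB Require Import structures.
Require Import Defs.
From mathcomp Require Import all_boot all_order all_algebra.
From mathcomp Require Import perm fingroup.
From mathcomp Require Import complex ring lra zify.
From mathcomp Require Import all_classical all_reals all_analysis.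
From mathcomp Require Import measurable_realfun.
Set Implicit Arguments.
Unset Strict Implicit.
Unset Printing Implicit Defensive.
Import Order.TTheory GRing.Theory Num.Theory.
Import numFieldNormedType.Exports.
Import ComplexField.Normc.
Local Open Scope classical_set_scope.
Local Open Scope ring_scope.
Local Open Scope complex_scope.

(** Given the eigenvalues, the matrix is triangular, and its left eigenvectors, normalized to have a
    1 at their own position, come from forward substitution with the weights [1 / (lam s - lam a)].
    Biorthogonality expresses the overlap through the two left vectors alone ([overlap_triangular],
    [overlap_leftvec]). The Gaussian rows are independent and each of them enters one step of the
    substitution, so they can be averaged one after the other ([cint_cpair], [cint_ov]). The mean of
    the overlap given the spectrum is - 1 / (N |z1 - z2|^2) * prod_k (1 + 1 / (N (z1 - lam_k)
    conj(z2 - lam_k))).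

    The eigenvalue density contains |z1 - w|^2 |z2 - w|^2 for every remaining eigenvalue w, which
    clears the poles of this product. Andreief's identity ([andreief]) then turns the integral of
    the product and the normalization into n by n determinants of Gaussian moments
    ([cond_expectation_det]). Put x_i = sqrt N z_i, t = x1 conj(x2) and om = |x1 - x2|.

    Christoffel's formula ([christoffel]) evaluates both determinants: extra linear factors in the
    weight cost one value of a reproducing kernel. For the normalization the kernels are exponential
    series e cut off after N terms, and two applications give [e(|x1|^2) e(|x2|^2) - e(t) e(conj t)]
    / om^2 times factorials ([det_gform_lin2]). For the numerator the moments of the weight 1 + (x1
    - w)(conj(x2) - conj(w)) form a tridiagonal matrix with explicit determinant, close to (N - t)
    e^t times factorials ([det_bformXX], [ff_near]). Its kernel k solves a first order differential
    equation ([bformE], [overlap_kernel]). Integrating it along the segment from x1 to x2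
    ([flow_deriv]) yields k(x2), up to an explicit exponential factor, as the integral of x e^(-x
    om^2) over [0, 1], which is (1 - (1 + om^2) e^(-om^2)) / om^4 ([kernel_near]). In the quotient
    all exponentials cancel except 1 - e^(-om^2) ([cond_expectation_near]).

    Replacing cut-off exponentials by exponentials costs Poisson tails. Both |x_i| stay below sqrt N
    - N^kappa / 2, so the tails are at most N exp(- N^(2 kappa) / 16) ([poisson_tails]). The losses
    e^(2 om^2) and om^(-2) are affordable for N^(-C) <= om <= N^(kappa - eps) ([error_decay]). The
    relative error decays faster than any power of N; the recorded bound, a constant over N, lies
    below N^(-2 kappa + eps) because kappa < 1/2. *)

(** * Real and imaginary parts and the modulus of complex numbers *)

Section complex_facts.
Context {R : realType}.
Implicit Types (z w : R[i]) (x : R).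

Lemma cReD z w : complex.Re (z + w) = complex.Re z + complex.Re w.
Proof. by case: z; case: w. Qed.
Lemma cImD z w : complex.Im (z + w) = complex.Im z + complex.Im w.
Proof. by case: z; case: w. Qed.
Lemma cReN z : complex.Re (- z) = - complex.Re z.
Proof. by case: z. Qed.
Lemma cImN z : complex.Im (- z) = - complex.Im z.
Proof. by case: z. Qed.
Lemma cReM z w :
  complex.Re (z * w) = complex.Re z * complex.Re w - complex.Im z * complex.Im w.
Proof. by case: z; case: w. Qed.
Lemma cImM z w :
  complex.Im (z * w) = complex.Re z * complex.Im w + complex.Im z * complex.Re w.
Proof. by case: z; case: w. Qed.
Lemma cRe_conj z : complex.Re (conjc z) = complex.Re z.
Proof. by case: z. Qed.
Lemma cIm_conj z : complex.Im (conjc z) = - complex.Im z.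
Proof. by case: z. Qed.
Lemma complex_eqP z w :
  complex.Re z = complex.Re w -> complex.Im z = complex.Im w -> z = w.
Proof. by case: z; case: w => /= ? ? ? ? -> ->. Qed.

Lemma normcE2 z : normc z ^+ 2 = complex.Re z ^+ 2 + complex.Im z ^+ 2.
Proof. by case: z => a b /=; rewrite sqr_sqrtr// addr_ge0// sqr_ge0. Qed.
Lemma normc_ge0 z : 0 <= normc z.
Proof. by case: z => a b /=; rewrite sqrtr_ge0. Qed.
Lemma normc_conj z : normc (conjc z) = normc z.
Proof. by case: z => a b /=; rewrite sqrrN. Qed.
Lemma normc_real x : normc x%:C = `|x|.
Proof. by rewrite /= expr0n addr0 sqrtr_sqr. Qed.
Lemma normcX z n : normc (z ^+ n) = normc z ^+ n.
Proof.
elim: n => [|n IH]; first by rewrite !expr0 normc1.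
by rewrite !exprS normcM IH.
Qed.
Lemma normc_nat n : normc (n%:R : R[i]) = n%:R.
Proof.
by rewrite -(rmorph_nat (real_complex R)) normc_real normr_nat.
Qed.
Lemma normc_eq0 z : (normc z == 0) = (z == 0).
Proof.
apply/eqP/eqP => [|->]; last by rewrite normc0.
exact: eq0_normc.
Qed.
Lemma normc_gt0 z : (0 < normc z) = (z != 0).
Proof. by rewrite lt_def normc_ge0 andbT normc_eq0. Qed.
Lemma le_normc_sum (I : Type) (s : seq I) (P : pred I) (F : I -> R[i]) :
  normc (\sum_(i <- s | P i) F i) <= \sum_(i <- s | P i) normc (F i).
Proof.
elim/big_ind2 : _ => //; first by rewrite normc0.
by move=> z a w b za wb; rewrite (le_trans (le_normcD _ _))// lerD.
Qed.
Lemma normc_prod (I : Type) (s : seq I) (P : pred I) (F : I -> R[i]) :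
  normc (\prod_(i <- s | P i) F i) = \prod_(i <- s | P i) normc (F i).
Proof. by elim/big_ind2 : _ => // [|z a w b <- <-]; rewrite ?normc1 ?normcM. Qed.
Lemma mul_conjc z : z * conjc z = (normc z ^+ 2)%:C.
Proof.
rewrite normcE2; case: z => a b; apply: complex_eqP => /=; ring.
Qed.
Lemma normcB z w : normc (z - w) = normc (w - z).
Proof. by rewrite -normcN opprB. Qed.
Lemma normRe z : `|complex.Re z| <= normc z.
Proof.
rewrite -(ler_pXn2r (n := 2))// ?nnegrE ?normc_ge0// normcE2 real_normK ?num_real//.
by rewrite lerDl sqr_ge0.
Qed.
Lemma normIm z : `|complex.Im z| <= normc z.
Proof.
rewrite -(ler_pXn2r (n := 2))// ?nnegrE ?normc_ge0// normcE2 real_normK ?num_real//.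
by rewrite lerDr sqr_ge0.
Qed.
Lemma cRe_sum (I : Type) (s : seq I) (P : pred I) (F : I -> R[i]) :
  complex.Re (\sum_(i <- s | P i) F i) = \sum_(i <- s | P i) complex.Re (F i).
Proof. by elim/big_ind2 : _ => // z a w b <- <-; rewrite cReD. Qed.
Lemma cIm_sum (I : Type) (s : seq I) (P : pred I) (F : I -> R[i]) :
  complex.Im (\sum_(i <- s | P i) F i) = \sum_(i <- s | P i) complex.Im (F i).
Proof. by elim/big_ind2 : _ => // z a w b <- <-; rewrite cImD. Qed.
Lemma cReV z : complex.Re z^-1 = complex.Re z / (complex.Re z ^+ 2 + complex.Im z ^+ 2).
Proof. by case: z. Qed.
Lemma cImV z : complex.Im z^-1 = - (complex.Im z / (complex.Re z ^+ 2 + complex.Im z ^+ 2)).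
Proof. by case: z => a b /=. Qed.

End complex_facts.

(** * Integration of complex-valued functions and Fubini's theorem *)

Section complex_integral.
Context d (T : measurableType d) (R : realType).
Implicit Types (f g : T -> R[i]) (c : R[i]).

Definition cmeas f :=
  measurable_fun setT (fun x => complex.Re (f x)) /\
  measurable_fun setT (fun x => complex.Im (f x)).

Lemma cmeas_cst c : cmeas (fun _ => c).
Proof. by split; exact: measurable_cst. Qed.
Lemma cmeasD f g : cmeas f -> cmeas g -> cmeas (fun x => f x + g x).
Proof.
move=> [f1 f2] [g1 g2]; split.
  by under eq_fun do rewrite cReD; exact: measurable_funD.
by under eq_fun do rewrite cImD; exact: measurable_funD.
Qed.
Lemma cmeasN f : cmeas f -> cmeas (fun x => - f x).
Proof.
move=> [f1 f2]; split.
  by under eq_fun do rewrite cReN; exact: measurableT_comp.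
by under eq_fun do rewrite cImN; exact: measurableT_comp.
Qed.
Lemma cmeasB f g : cmeas f -> cmeas g -> cmeas (fun x => f x - g x).
Proof. by move=> mf mg; apply: cmeasD => //; exact: cmeasN. Qed.
Lemma cmeasM f g : cmeas f -> cmeas g -> cmeas (fun x => f x * g x).
Proof.
move=> [f1 f2] [g1 g2]; split.
  by under eq_fun do rewrite cReM; apply: measurable_funB; exact: measurable_funM.
by under eq_fun do rewrite cImM; apply: measurable_funD; exact: measurable_funM.
Qed.
Lemma cmeas_conj f : cmeas f -> cmeas (fun x => conjc (f x)).
Proof.
move=> [f1 f2]; split; first by under eq_fun do rewrite cRe_conj.
by under eq_fun do rewrite cIm_conj; exact: measurableT_comp.
Qed.
Lemma cmeas_sum (I : Type) (s : seq I) (P : pred I) (F : I -> T -> R[i]) :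
  (forall i, P i -> cmeas (F i)) -> cmeas (fun x => \sum_(i <- s | P i) F i x).
Proof.
move=> mF; elim: s => [|i s IH].
  by under eq_fun do rewrite big_nil; exact: cmeas_cst.
case Pi : (P i); under eq_fun do rewrite big_cons Pi//; last exact: IH.
by apply: cmeasD => //; exact: mF.
Qed.
Lemma cmeas_prod (I : Type) (s : seq I) (P : pred I) (F : I -> T -> R[i]) :
  (forall i, P i -> cmeas (F i)) -> cmeas (fun x => \prod_(i <- s | P i) F i x).
Proof.
move=> mF; elim: s => [|i s IH].
  by under eq_fun do rewrite big_nil; exact: cmeas_cst.
case Pi : (P i); under eq_fun do rewrite big_cons Pi//; last exact: IH.
by apply: cmeasM => //; exact: mF.
Qed.
Lemma cmeasX f n : cmeas f -> cmeas (fun x => f x ^+ n).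
Proof.
move=> mf; elim: n => [|n IH].
  by under eq_fun do rewrite expr0; exact: cmeas_cst.
by under eq_fun do rewrite exprS; exact: cmeasM.
Qed.
Lemma cmeas_real (h : T -> R) : measurable_fun setT h -> cmeas (fun x => (h x)%:C).
Proof. by move=> mh; split => //=; exact: measurable_cst. Qed.

Lemma cmeasV f : cmeas f -> cmeas (fun x => (f x)^-1).
Proof.
move=> [f1 f2].
have mi : measurable_fun setT
    (fun x => (complex.Re (f x) ^+ 2 + complex.Im (f x) ^+ 2)^-1).
  under eq_fun do rewrite -powR_inv1 ?addr_ge0 ?sqr_ge0//.
  apply: (@measurableT_comp _ _ _ _ _ _ (fun y : R => y `^ (-1))).
    exact: measurable_powR.
  by apply: measurable_funD; exact: measurable_funX.
split; first by under eq_fun do rewrite cReV; exact: measurable_funM.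
under eq_fun do rewrite cImV.
by apply: measurableT_comp => //; exact: measurable_funM.
Qed.
Lemma measurable_normc f : cmeas f -> measurable_fun setT (fun x => normc (f x)).
Proof.
move=> [f1 f2].
rewrite (_ : (fun x => _) = (fun x =>
   (complex.Re (f x) ^+ 2 + complex.Im (f x) ^+ 2) `^ 2^-1)); last first.
  by apply/funext => x; rewrite powR12_sqrt ?addr_ge0 ?sqr_ge0//; case: (f x).
apply: (@measurableT_comp _ _ _ _ _ _ (fun y : R => y `^ 2^-1)).
  exact: measurable_powR.
by apply: measurable_funD; exact: measurable_funX.
Qed.

Section integral.
Variable mu : {measure set T -> \bar R}.

Definition cintegrable f :=
  mu.-integrable setT (fun x => (complex.Re (f x))%:E) /\
  mu.-integrable setT (fun x => (complex.Im (f x))%:E).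

Definition cint f : R[i] :=
  (\int[mu]_x complex.Re (f x)) +i* (\int[mu]_x complex.Im (f x)).

Lemma cintegrable_meas f : cintegrable f -> cmeas f.
Proof. by move=> [/measurable_int/measurable_EFinP ? /measurable_int/measurable_EFinP]. Qed.

Lemma cintegrable_le f (h : T -> R) : cmeas f ->
  mu.-integrable setT (fun x => (h x)%:E) -> (forall x, normc (f x) <= h x) ->
  cintegrable f.
Proof.
move=> [f1 f2] ih fh; split.
  apply: le_integrable ih => //; first exact/measurable_EFinP.
  move=> x _ /=; rewrite lee_fin (le_trans (normRe _))// (le_trans (fh x))//.
  exact: ler_norm.
apply: le_integrable ih => //; first exact/measurable_EFinP.
move=> x _ /=; rewrite lee_fin (le_trans (normIm _))// (le_trans (fh x))//.
exact: ler_norm.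
Qed.

Lemma integrable_normc f : cintegrable f ->
  mu.-integrable setT (fun x => (normc (f x))%:E).
Proof.
move=> fi; have [f1 f2] := fi.
apply: (@le_integrable _ _ _ mu _ measurableT _
  (fun x => (`|complex.Re (f x)| + `|complex.Im (f x)|)%:E)).
- exact/measurable_EFinP/measurable_normc/cintegrable_meas.
- move=> x _ /=; rewrite lee_fin ger0_norm ?normc_ge0//.
  rewrite [leRHS]ger0_norm ?addr_ge0//.
  rewrite -(ler_pXn2r (n := 2))// ?nnegrE ?normc_ge0 ?addr_ge0// normcE2.
  rewrite sqrrD !real_normK ?num_real// lerD2r lerDl.
  by rewrite mulrn_wge0// mulr_ge0.
- under eq_fun do rewrite EFinD.
  by apply: integrableD => //; [exact: (integrable_abse f1)|exact: (integrable_abse f2)].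
Qed.

Lemma cintegrableD f g : cintegrable f -> cintegrable g ->
  cintegrable (fun x => f x + g x).
Proof.
move=> [f1 f2] [g1 g2]; split.
  by under eq_fun do rewrite cReD EFinD; exact: integrableD.
by under eq_fun do rewrite cImD EFinD; exact: integrableD.
Qed.

Lemma cintegrableZ c f : cintegrable f -> cintegrable (fun x => c * f x).
Proof.
move=> fi.
apply: (@cintegrable_le _ (fun x => normc c * normc (f x))).
- by apply: cmeasM; [exact: cmeas_cst|exact: cintegrable_meas].
- by under eq_fun do rewrite EFinM; apply: integrableZl => //; exact: integrable_normc.
- by move=> x; rewrite normcM.
Qed.

Lemma cintegrable0 : cintegrable (fun _ => 0).
Proof. by split => /=; exact: integrable0. Qed.

Lemma cintegrable_sum (I : Type) (s : seq I) (P : pred I) (F : I -> T -> R[i]) :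
  (forall i, P i -> cintegrable (F i)) ->
  cintegrable (fun x => \sum_(i <- s | P i) F i x).
Proof.
move=> mF; elim: s => [|i s IH].
  by under eq_fun do rewrite big_nil; exact: cintegrable0.
case Pi : (P i); under eq_fun do rewrite big_cons Pi//; last exact: IH.
by apply: cintegrableD => //; exact: mF.
Qed.

Lemma eq_cint f g : f =1 g -> cint f = cint g.
Proof. by move=> /funext ->. Qed.

Lemma cintD f g : cintegrable f -> cintegrable g ->
  cint (fun x => f x + g x) = cint f + cint g.
Proof.
move=> [f1 f2] [g1 g2]; rewrite /cint.
under eq_Rintegral do rewrite cReD.
rewrite RintegralD//; under [X in _ +i* X]eq_Rintegral do rewrite cImD.
by rewrite RintegralD.
Qed.

Let intZ (k : R) (h : T -> R) : mu.-integrable setT (fun x => (h x)%:E) ->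
  mu.-integrable setT (EFin \o (fun x => k * h x)).
Proof.
by move=> hi; rewrite [X in _.-integrable _ X](_ : _ = (fun x => k%:E * (h x)%:E)%E);
  [exact: integrableZl|].
Qed.

Lemma cintZ c f : cintegrable f -> cint (fun x => c * f x) = c * cint f.
Proof.
move=> [f1 f2]; apply: complex_eqP => /=.
  under eq_Rintegral do rewrite cReM.
  rewrite RintegralB//=; [|exact: intZ|exact: intZ].
  by rewrite cReM !RintegralZl.
under eq_Rintegral do rewrite cImM.
rewrite RintegralD//=; [|exact: intZ|exact: intZ].
by rewrite cImM !RintegralZl.
Qed.

Lemma cint0 : cint (fun _ => 0) = 0.
Proof. by apply: complex_eqP => /=; rewrite /Rintegral integral0. Qed.

Lemma cint_sum (I : Type) (s : seq I) (P : pred I) (F : I -> T -> R[i]) :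
  (forall i, P i -> cintegrable (F i)) ->
  cint (fun x => \sum_(i <- s | P i) F i x) = \sum_(i <- s | P i) cint (F i).
Proof.
move=> mF; elim: s => [|i s IH].
  by under eq_fun do rewrite big_nil; rewrite big_nil cint0.
rewrite big_cons; case Pi : (P i); under eq_fun do rewrite big_cons Pi//; last exact: IH.
by rewrite cintD ?IH//; [exact: mF|exact: cintegrable_sum].
Qed.

Lemma cint_conj f : cintegrable f ->
  cint (fun x => conjc (f x)) = conjc (cint f).
Proof.
move=> [f1 f2]; apply: complex_eqP => /=.
  by under eq_Rintegral do rewrite cRe_conj.
under eq_Rintegral do rewrite cIm_conj -mulN1r.
by rewrite RintegralZl// mulN1r.
Qed.

Lemma cint_real (h : T -> R) : cint (fun x => (h x)%:C) = (\int[mu]_x h x)%:C.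
Proof. by apply: complex_eqP => //=; rewrite /Rintegral integral0. Qed.

End integral.
End complex_integral.

Section complex_product.
Context d1 d2 (T1 : measurableType d1) (T2 : measurableType d2) (R : realType).
Variables (m1 : {sigma_finite_measure set T1 -> \bar R})
          (m2 : {sigma_finite_measure set T2 -> \bar R}).

(** Asking for every section to be integrable, not almost every one, makes all inner integrals
    finite, so [fine] can be removed pointwise. *)
Lemma cint_fubini (f : T1 * T2 -> R[i]) :
  cintegrable (m1 \x m2)%E f ->
  (forall x, cintegrable m2 (fun y => f (x, y))) ->
  cint (m1 \x m2)%E f = cint m1 (fun x => cint m2 (fun y => f (x, y))).
Proof.
move=> [f1 f2] fx; apply: complex_eqP => /=; rewrite /Rintegral.
  rewrite -integral12_prod_meas1//; congr fine; apply: eq_integral => x _.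
  rewrite /fubini_F fineK//; apply: integrable_fin_num => //.
  by have [] := fx x.
rewrite -integral12_prod_meas1//; congr fine; apply: eq_integral => x _.
rewrite /fubini_F fineK//; apply: integrable_fin_num => //.
by have [] := fx x.
Qed.

Lemma cint_fubini21 (f : T1 * T2 -> R[i]) :
  cintegrable (m1 \x m2)%E f ->
  (forall y, cintegrable m1 (fun x => f (x, y))) ->
  cint (m1 \x m2)%E f = cint m2 (fun y => cint m1 (fun x => f (x, y))).
Proof.
move=> [f1 f2] fx; apply: complex_eqP => /=; rewrite /Rintegral.
  rewrite -integral21_prod_meas1//; congr fine; apply: eq_integral => y _.
  rewrite /fubini_G fineK//; apply: integrable_fin_num => //.
  by have [] := fx y.
rewrite -integral21_prod_meas1//; congr fine; apply: eq_integral => y _.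
rewrite /fubini_G fineK//; apply: integrable_fin_num => //.
by have [] := fx y.
Qed.

Lemma cmeas_fst (f : T1 -> R[i]) : cmeas f -> cmeas (fun x : T1 * T2 => f x.1).
Proof.
move=> [f1 f2]; split.
  exact: (measurableT_comp f1 measurable_fst).
exact: (measurableT_comp f2 measurable_fst).
Qed.
Lemma cmeas_snd (f : T2 -> R[i]) : cmeas f -> cmeas (fun x : T1 * T2 => f x.2).
Proof.
move=> [f1 f2]; split.
  exact: (measurableT_comp f1 measurable_snd).
exact: (measurableT_comp f2 measurable_snd).
Qed.

Lemma integrable_prod_fun (f : T1 -> R) (g : T2 -> R) :
  m1.-integrable setT (fun x => (f x)%:E) ->
  m2.-integrable setT (fun x => (g x)%:E) ->
  (m1 \x m2)%E.-integrable setT (fun x => (f x.1 * g x.2)%:E).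
Proof.
move=> fi gi.
have mf : measurable_fun setT f by exact/measurable_EFinP/(measurable_int m1).
have mg : measurable_fun setT g by exact/measurable_EFinP/(measurable_int m2).
have mfg : measurable_fun setT (fun x : T1 * T2 => (f x.1 * g x.2)%:E).
  apply/measurable_EFinP/measurable_funM.
    exact: (measurableT_comp mf measurable_fst).
  exact: (measurableT_comp mg measurable_snd).
apply/(integrable12ltyP m1 m2 mfg).
under eq_integral => x _ do under eq_integral => y _ do
  rewrite /= normrM EFinM.
under eq_integral => x _.
  rewrite ge0_integralZl//; last first.
    by apply/measurable_EFinP; exact: measurableT_comp.
  over.
rewrite ge0_integralZr//.
- apply: lte_mul_pinfty; first exact: integral_ge0.
    exact: (integrable_fin_num measurableT (integrable_abse fi)).
  exact: (integrable_lty measurableT (integrable_abse gi)).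
- by apply/measurable_EFinP; exact: measurableT_comp.
- exact: integral_ge0.
Qed.

Lemma cintegrable_prod (f : T1 -> R[i]) (g : T2 -> R[i]) :
  cintegrable m1 f -> cintegrable m2 g ->
  cintegrable (m1 \x m2)%E (fun x => f x.1 * g x.2).
Proof.
move=> fi gi.
apply: (@cintegrable_le _ _ _ _ _ (fun x => normc (f x.1) * normc (g x.2))).
- apply: cmeasM; first exact/cmeas_fst/cintegrable_meas/fi.
  exact/cmeas_snd/cintegrable_meas/gi.
- exact: (integrable_prod_fun (integrable_normc fi) (integrable_normc gi)).
- by move=> x; rewrite normcM.
Qed.

Lemma cint_prod (f : T1 -> R[i]) (g : T2 -> R[i]) :
  cintegrable m1 f -> cintegrable m2 g ->
  cint (m1 \x m2)%E (fun x => f x.1 * g x.2) = cint m1 f * cint m2 g.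
Proof.
move=> fi gi; rewrite cint_fubini; last 2 first.
- exact: cintegrable_prod.
- by move=> x /=; exact: cintegrableZ.
rewrite mulrC -cintZ//; apply: eq_cint => x /=.
by rewrite cintZ// mulrC.
Qed.
End complex_product.

(** * Integrals over finite powers of a measure *)

Section tuple_integral.
Context d (T : measurableType d) (R : realType).
Variable mu : {sigma_finite_measure set T -> \bar R}.

Lemma tuple_measureS_int n (g : n.+1.-tuple T -> R) :
  measurable_fun setT g ->
  (mu \x tuple_measure mu n)%E.-integrable setT
    (fun p => (g (tuple_cons p))%:E) ->
  (tuple_measure mu n.+1).-integrable setT (fun t => (g t)%:E) /\
  \int[tuple_measure mu n.+1]_t g t =
  \int[(mu \x tuple_measure mu n)%E]_p g (tuple_cons p).
Proof.
move=> /measurable_EFinP mg ig; split.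
  by apply: (integrable_pushforward (@measurable_tuple_cons _ T n)).
congr fine.
by apply: (integral_pushforward (@measurable_tuple_cons _ T n)).
Qed.

Lemma cint_tupleS n (g : n.+1.-tuple T -> R[i]) :
  cmeas g ->
  cintegrable (mu \x tuple_measure mu n)%E (fun p => g (tuple_cons p)) ->
  cintegrable (tuple_measure mu n.+1) g /\
  cint (tuple_measure mu n.+1) g =
  cint (mu \x tuple_measure mu n)%E (fun p => g (tuple_cons p)).
Proof.
move=> [g1 g2] [i1 i2].
have [j1 e1] := tuple_measureS_int g1 i1.
have [j2 e2] := tuple_measureS_int g2 i2.
by split; [split|rewrite /cint e1 e2].
Qed.

Lemma cmeas_tnth n (f : T -> R[i]) (i : 'I_n) :
  cmeas f -> cmeas (fun t : n.-tuple T => f (tnth t i)).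
Proof.
move=> [f1 f2]; split.
  exact: (measurableT_comp f1 (measurable_tnth i)).
exact: (measurableT_comp f2 (measurable_tnth i)).
Qed.

Lemma tnth_tuple_cons0 n (p : T * n.-tuple T) : tnth (tuple_cons p) ord0 = p.1.
Proof. by []. Qed.

Lemma tnth_tuple_consS n (p : T * n.-tuple T) (i : 'I_n) :
  tnth (tuple_cons p) (lift ord0 i) = tnth p.2 i.
Proof. by rewrite (tnth_nth p.1) (tnth_nth p.1). Qed.

Lemma cint_tuple_prod n (f : 'I_n -> T -> R[i]) :
  (forall i, cintegrable mu (f i)) ->
  cintegrable (tuple_measure mu n) (fun t => \prod_i f i (tnth t i)) /\
  cint (tuple_measure mu n) (fun t => \prod_i f i (tnth t i)) =
  \prod_i cint mu (f i).
Proof.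
(* The power 0 of [mu] is a Dirac mass, so the empty product integrates to 1. *)
elim: n f => [f _|n IH f fi].
  under eq_fun do rewrite big_ord0.
  rewrite big_ord0; split.
    split => /=.
      by apply: (finite_measure_integrable_cst (dirac _)).
    by apply: (finite_measure_integrable_cst (dirac _)).
  rewrite /cint /Rintegral /=.
  by apply: complex_eqP => /=; rewrite integral_dirac//= /dirac indicT /= ?mul1r ?mulr0.
have [ii ie] := IH _ (fun i => fi (lift ord0 i)).
have E p : \prod_i f i (tnth (tuple_cons p) i) =
    f ord0 p.1 * \prod_i f (lift ord0 i) (tnth p.2 i).
  rewrite big_ord_recl tnth_tuple_cons0; congr *%R.
  by apply: eq_bigr => i _; rewrite tnth_tuple_consS.
have mf : cmeas (fun t : n.+1.-tuple T => \prod_i f i (tnth t i)).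
  by apply: cmeas_prod => i _; exact: (cmeas_tnth i (cintegrable_meas (fi i))).
have pi : cintegrable (mu \x tuple_measure mu n)%E
    (fun p => \prod_i f i (tnth (tuple_cons p) i)).
  by under eq_fun do rewrite E; exact: (cintegrable_prod (fi ord0) ii).
have [h1 h2] := cint_tupleS mf pi.
split => //; rewrite h2; under eq_fun do rewrite E.
by rewrite (cint_prod (fi ord0) ii) ie big_ord_recl.
Qed.

Lemma integrable_tuple_prod n (f : 'I_n -> T -> R) :
  (forall i, mu.-integrable setT (fun x => (f i x)%:E)) ->
  (tuple_measure mu n).-integrable setT (fun t => (\prod_i f i (tnth t i))%:E).
Proof.
move=> fi.
have [//|[h _] _] := @cint_tuple_prod n (fun i x => (f i x)%:C).
  by move=> i; split => //=; exact: integrable0.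
rewrite [X in _.-integrable _ X](_ : _ =
  (fun t => (complex.Re (\prod_i (f i (tnth t i))%:C))%:E)) //.
by apply/funext => t; rewrite -rmorph_prod.
Qed.

End tuple_integral.

(** * Gaussian moments on the line and in the plane *)

Section gauss1.
Context {R : realType}.
Variable s : R.
Hypothesis s0 : 0 < s.
Local Notation leb := (@lebesgue_measure R).

Definition gw (x : R) : R := expR (- (s * x ^+ 2)).

(** The weight is a multiple of the normal density of variance [1 / (2 s)]; integrability and
    positivity of its mass are inherited from there. *)
Lemma gw_normal (x : R) : gw x = 
  (normal_peak (Num.sqrt (2 * s)^-1))^-1 * normal_pdf 0 (Num.sqrt (2 * s)^-1) x.
Proof.
have sn : Num.sqrt (2 * s)^-1 != 0 by rewrite gt_eqF// sqrtr_gt0 invr_gt0 mulr_gt0.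
rewrite normal_pdfE// /normal_fun /gw mulKf ?gt_eqF ?normal_peak_gt0//.
congr expR; rewrite subr0 sqr_sqrtr; last by rewrite invr_ge0 mulr_ge0// ltW.
by rewrite -mulr_natr; field; rewrite gt_eqF.
Qed.

Lemma integrable_gw : leb.-integrable setT (fun x => (gw x)%:E).
Proof.
under eq_fun do rewrite gw_normal EFinM.
by apply: integrableZl => //; exact: integrable_normal_pdf.
Qed.

Lemma gauss_mass_gt0 : 0 < \int[leb]_x gw x.
Proof.
under eq_Rintegral do rewrite gw_normal.
rewrite RintegralZl//; last exact: integrable_normal_pdf.
rewrite /Rintegral integral_normal_pdf mulr1 invr_gt0 normal_peak_gt0//.
by rewrite gt_eqF// sqrtr_gt0 invr_gt0 mulr_gt0.
Qed.

Lemma is_derive_horner_expR (p q : {poly R}) (x : R) :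
  is_derive x 1 (fun x => p.[x] * expR q.[x])
    ((p^`() + p * q^`()).[x] * expR q.[x]).
Proof.
have h : is_derive x 1 (horner p * (expR \o horner q))
    (p.[x] *: (expR q.[x] * q^`().[x]) + (expR q.[x]) *: p^`().[x]).
  by apply: is_deriveM; apply: is_derive1_comp.
apply: is_derive_eq h _; rewrite /GRing.scale/= hornerD hornerM; ring.
Qed.

Lemma continuous_horner_expR (p q : {poly R}) :
  continuous (fun x => p.[x] * expR q.[x]).
Proof.
move=> x; apply/differentiable_continuous/derivable1_diffP.
by have [] := is_derive_horner_expR p q x.
Qed.

Definition gexp : {poly R} := - (s *: 'X^2).

Lemma gwE (x : R) : gw x = expR gexp.[x].
Proof. by rewrite /gw /gexp !hornerE. Qed.

Definition gcoef p : R := 1 + (p`!)%:R * (2 / s) ^+ p.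

Lemma gcoef_ge0 p : 0 <= gcoef p.
Proof. by rewrite addr_ge0// mulr_ge0// exprn_ge0// divr_ge0// ltW. Qed.

(** Half of the exponent absorbs the monomial, by [y ^+ p / p! <= expR y] at [y = s / 2 * x ^+ 2];
    the other half remains as an integrable majorant. *)
Lemma gw_half_bound p (x : R) :
  `|x| ^+ p * gw x <= gcoef p * expR (- (s / 2 * x ^+ 2)).
Proof.
have -> : gw x = expR (- (s / 2 * x ^+ 2)) * expR (- (s / 2 * x ^+ 2)).
  by rewrite -expRD /gw; congr expR; field.
rewrite mulrA ler_wpM2r ?expR_ge0// expRN ler_pdivrMr ?expR_gt0//.
set y := s / 2 * x ^+ 2.
have y0 : 0 <= y by rewrite mulr_ge0 ?sqr_ge0// divr_ge0// ltW.
have e1 : 1 <= expR y by rewrite -expR0 ler_expR.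
have xp : `|x| ^+ p <= 1 + (x ^+ 2) ^+ p.
  have -> : (x ^+ 2) ^+ p = (`|x| ^+ p) ^+ 2.
    by rewrite -[x ^+ 2]real_normK ?num_real// exprAC.
  set u := `|x| ^+ p.
  have u0 : 0 <= u by exact: exprn_ge0.
  by have := sqr_ge0 (u - 1); nra.
apply: (le_trans xp); rewrite mulrDl mul1r lerD//.
have -> : (x ^+ 2) ^+ p = y ^+ p * (2 / s) ^+ p.
  by rewrite -exprMn /y; congr (_ ^+ p); field; rewrite gt_eqF.
rewrite [leRHS]mulrAC ler_wpM2r ?exprn_ge0 ?divr_ge0 ?(ltW s0)//.
rewrite [leRHS]mulrC -ler_pdivrMr ?ltr0n ?fact_gt0//.
case: p {xp} => [|p]; first by rewrite expr0 fact0 divr1.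
by rewrite (le_trans _ (expR_ge1Dxn p y0))// lerDr.
Qed.
End gauss1.

Section gauss1_integrals.
Context {R : realType}.
Variable s : R.
Hypothesis s0 : 0 < s.
Local Notation leb := (@lebesgue_measure R).

Lemma measurable_gw : measurable_fun setT (@gw R s).
Proof.
by apply/measurable_EFinP; exact: (measurable_int leb (integrable_gw s0)).
Qed.

Lemma integrable_monom_gw p : leb.-integrable setT (fun x => (x ^+ p * gw s x)%:E).
Proof.
have s20 : 0 < s / 2 by rewrite divr_gt0.
apply: (@le_integrable _ _ _ leb _ measurableT _
  (fun x => (gcoef s p * gw (s / 2) x)%:E)).
- by apply/measurable_EFinP/measurable_funM => //; exact: measurable_gw.
- move=> x _ /=; rewrite lee_fin normrM normrX [`|gw s x|]ger0_norm ?expR_ge0//.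
  apply: (le_trans (gw_half_bound s0 p x)).
  exact: ler_norm.
- by under eq_fun do rewrite EFinM; apply: integrableZl => //; exact: integrable_gw.
Qed.

Lemma cvg_monom_gw p : (k%:R ^+ p * gw s k%:R) @[k --> \oo] --> (0 : R).
Proof.
have s20 : 0 < s / 2 by rewrite divr_gt0.
apply/cvgrPdist_le => e e0; near=> k.
rewrite sub0r normrN ger0_norm ?mulr_ge0 ?expR_ge0 ?exprn_ge0//.
have := gw_half_bound s0 p (k%:R); rewrite normr_nat => /le_trans; apply.
have k0 : (0 < k)%N by near: k; exact: nbhs_infty_gt.
rewrite expRN ler_pdivrMr ?expR_gt0// -ler_pdivrMl//.
apply: (@le_trans _ _ (s / 2 * k%:R ^+ 2)); last first.
  by rewrite (le_trans _ (expR_ge1Dx _))// lerDr.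
rewrite -ler_pdivrMl//.
apply: (@le_trans _ _ k%:R).
  by near: k; exact: nbhs_infty_ger.
by rewrite expr2 ler_peMl// ler1n.
Unshelve. all: end_near. Qed.

(** Integration by parts: the integrand [p x^(p-1) - 2 s x^(p+1)] times the Gaussian is the
    derivative of [x ^+ p * gw s x], which vanishes at infinity. For [p = 0] the coefficient [p%:R]
    hides the truncated [p.-1]. *)
Lemma gauss_stein_real p :
  2 * s * (\int[leb]_x (x ^+ p.+1 * gw s x)) =
  p%:R * \int[leb]_x (x ^+ p.-1 * gw s x).
Proof.
pose P : {poly R} := 'X^p.
pose Q : {poly R} := P^`() + P * (gexp s)^`().
have QE x : Q.[x] * gw s x =
    p%:R * (x ^+ p.-1 * gw s x) - 2 * s * (x ^+ p.+1 * gw s x).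
  rewrite /Q /P /gexp derivXn derivN derivZ derivXn.
  rewrite !(hornerD,hornerN,hornerM,hornerZ,hornerMn,hornerXn) /= -mulr_natl [x ^+ p.+1]exprS; ring.
have iQ : leb.-integrable setT (fun x => (Q.[x] * gw s x)%:E).
  under eq_fun do rewrite QE EFinB EFinM [in X in (_ - X)%E]EFinM.
  by apply: integrableB => //; apply: integrableZl => //; exact: integrable_monom_gw.
suff : \int[leb]_x (Q.[x] * gw s x) = 0.
  under eq_Rintegral do rewrite QE.
  rewrite RintegralB//; last 2 first.
  - by apply: (integrableZl measurableT p%:R (integrable_monom_gw p.-1)).
  - by apply: (integrableZl measurableT (2 * s) (integrable_monom_gw p.+1)).
  rewrite !RintegralZl//; try exact: integrable_monom_gw.
  by move/eqP; rewrite subr_eq0 => /eqP.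
(* The integral over the line is the limit over symmetric intervals; [k.+1] keeps them
   nondegenerate, as the fundamental theorem of calculus demands. *)
pose D k : set R := `[(- k.+1%:R : R), k.+1%:R]%classic.
have Fk k : (\int[leb]_(x in D k) (Q.[x] * gw s x)%:E)%E =
    (k.+1%:R ^+ p * gw s k.+1%:R - (- k.+1%:R) ^+ p * gw s (- k.+1%:R))%:E.
  rewrite (@continuous_FTC2 _ _ (fun x => P.[x] * expR (gexp s).[x])).
  - by rewrite /P !hornerXn -!gwE EFinB.
  - by rewrite gtrN// ltr0n.
  - apply: continuous_subspaceT => x; under eq_fun do rewrite gwE.
    exact: continuous_horner_expR.
  - split.
    + by move=> x _; have [] := is_derive_horner_expR P (gexp s) x.
    + apply: cvg_at_right_filter; exact: continuous_horner_expR.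
    + apply: cvg_at_left_filter; exact: continuous_horner_expR.
  - move=> x _; rewrite derive1E gwE.
    by have [_ ->] := is_derive_horner_expR P (gexp s) x.
have lim0 : (\int[leb]_(x in D k) (Q.[x] * gw s x)%:E)%E @[k --> \oo] --> 0%E.
  under eq_fun do rewrite Fk.
  apply: cvg_EFin; first exact: nearW.
  rewrite [X in X @ _ --> _](_ : _ =
     (fun k => (1 - (-1) ^+ p) * (k.+1%:R ^+ p * gw s k.+1%:R))); last first.
    by apply/funext => k /=; rewrite [in LHS]exprNn /gw sqrrN; ring.
  rewrite -(mulr0 (1 - (-1) ^+ p)); apply: cvgMr.
  by have := cvg_monom_gw p; rewrite -(cvg_shiftS (fun k => k%:R ^+ p * gw s k%:R)).
(* Dominated convergence, with the absolute value of the full integrand as majorant. *)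
have limI : (\int[leb]_(x in D k) (Q.[x] * gw s x)%:E)%E @[k --> \oo] -->
   (\int[leb]_x (Q.[x] * gw s x)%:E)%E.
  under eq_fun do rewrite integral_mkcond.
  have mQ := measurable_int _ iQ.
  apply: (@dominated_cvg _ _ _ leb _ measurableT _ _ (fun x => `|(Q.[x] * gw s x)%:E|)%E).
  - move=> k.
    have mD : measurable (D k) by exact: measurable_itv.
    have mQD : measurable_fun (D k) (fun x => (Q.[x] * gw s x)%:E).
      exact: measurable_funTS.
    exact: (measurable_restrictT _ mD).1 mQD.
  - move=> x _; apply: cvg_near_cst; near=> k.
    rewrite patchE mem_set// /D /= in_itv /= -ler_norml.
    apply: (@le_trans _ _ k%:R); last by rewrite ler_nat.
    by near: k; exact: nbhs_infty_ger.
  - by [].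
  - exact: integrable_abse.
  - move=> k x _; rewrite patchE; case: ifPn => //= _; rewrite normr0 lee_fin //.
have := cvg_lim (@ereal_hausdorff R) lim0.
rewrite (cvg_lim (@ereal_hausdorff R) limI) => e0.
by rewrite /Rintegral e0.
Unshelve. all: end_near. Qed.

End gauss1_integrals.

Section gauss_complex.
Context {R : realType}.
Variable s : R.
Hypothesis s0 : 0 < s.
Local Notation leb := (@lebesgue_measure R).

Lemma integrable_pow1_gw m :
  leb.-integrable setT (fun x => ((1 + `|x|) ^+ m * gw s x)%:E).
Proof.
apply: (@le_integrable _ _ _ leb _ measurableT _
  (fun x => (2 ^+ m)%:E * ((gw s x)%:E + `|(x ^+ m * gw s x)%:E|))%E).
- apply/measurable_EFinP/measurable_funM; last exact: measurable_gw.
  by apply/measurable_funX/measurable_funD => //; exact: normr_measurable.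
- move=> x _ /=; rewrite lee_fin.
  have g0 : 0 <= gw s x by exact: expR_ge0.
  rewrite [X in gw s x + X](_ : _ = `|x| ^+ m * gw s x); last first.
    by rewrite normrM normrX (ger0_norm g0).
  rewrite (@ger0_norm _ (_ * gw s x)) ?mulr_ge0 ?exprn_ge0 ?addr_ge0//.
  rewrite (@ger0_norm _ (2 ^+ m * _)) ?mulr_ge0 ?exprn_ge0 ?addr_ge0 ?mulr_ge0 ?exprn_ge0//.
  have -> : 2 ^+ m * (gw s x + `|x| ^+ m * gw s x) = 2 ^+ m * (1 + `|x| ^+ m) * gw s x by ring.
  rewrite ler_wpM2r//.
  have [x1|x1] := leP `|x| 1.
    apply: (@le_trans _ _ (2 ^+ m)).
      by rewrite lerXn2r ?nnegrE ?addr_ge0// -[leRHS]/(1 + 1) lerD2l.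
    by rewrite ler_peMr ?exprn_ge0// lerDl exprn_ge0.
  apply: (@le_trans _ _ ((2 * `|x|) ^+ m)).
    by rewrite lerXn2r ?nnegrE ?addr_ge0 ?mulr_ge0// mulr_natl mulr2n lerD2r ltW.
  by rewrite exprMn ler_wpM2l ?exprn_ge0// lerDr.
- apply: integrableZl => //; apply: integrableD => //; first exact: integrable_gw.
  by apply: (integrable_abse (integrable_monom_gw s0 m)).
Qed.

Lemma normc_cplx_le (w : plane R) : 1 + normc (cplx w) <= (1 + `|w.1|) * (1 + `|w.2|).
Proof.
rewrite /cplx mulrDl mul1r mulrDr mulr1 -!addrA lerD2l.
have : normc (w.1 +i* w.2) <= `|w.1| + `|w.2|.
  rewrite -(ler_pXn2r (n := 2))// ?nnegrE ?normc_ge0 ?addr_ge0// normcE2 /=.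
  rewrite sqrrD !real_normK ?num_real// lerD2r lerDl.
  by rewrite mulrn_wge0// mulr_ge0.
by move=> /le_trans; apply; rewrite addrA [X in _ <= X + _]addrC lerDl mulr_ge0.
Qed.

Definition gplane (w : plane R) : R := expR (- (s * normc (cplx w) ^+ 2)).

Lemma gplaneE w : gplane w = gw s w.1 * gw s w.2.
Proof. by rewrite /gplane /gw normcE2 /= mulrDr opprD expRD. Qed.

Lemma gplane_gt0 w : 0 < gplane w. Proof. exact: expR_gt0. Qed.

Lemma measurable_gplane : measurable_fun setT gplane.
Proof.
rewrite (_ : gplane = (fun w => gw s w.1 * gw s w.2)); last first.
  by apply/funext => w; rewrite gplaneE.
apply: measurable_funM.
  exact: (measurableT_comp (measurable_gw s0) measurable_fst).
exact: (measurableT_comp (measurable_gw s0) measurable_snd).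
Qed.

Lemma cmeas_cplx : cmeas (@cplx R).
Proof. by split; [exact: measurable_fst|exact: measurable_snd]. Qed.

Lemma integrable_pow1_gplane m :
  (@plane_measure R).-integrable setT (fun w => ((1 + normc (cplx w)) ^+ m * gplane w)%:E).
Proof.
have ip := integrable_prod_fun (integrable_pow1_gw m) (integrable_pow1_gw m).
apply: le_integrable ip => //.
  apply/measurable_EFinP/measurable_funM; last exact: measurable_gplane.
  apply/measurable_funX/measurable_funD => //.
  exact/measurable_normc/cmeas_cplx.
move=> w _ /=; rewrite lee_fin ger0_norm ?mulr_ge0 ?exprn_ge0 ?addr_ge0 ?normc_ge0 ?expR_ge0//.
rewrite ger0_norm ?mulr_ge0 ?exprn_ge0 ?addr_ge0 ?normc_ge0 ?expR_ge0//.
rewrite gplaneE mulrACA ler_wpM2r ?mulr_ge0 ?expR_ge0// -exprMn.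
by rewrite lerXn2r ?nnegrE ?mulr_ge0 ?addr_ge0 ?normc_ge0// normc_cplx_le.
Qed.

Lemma cintegrable_gplane_bound (f : plane R -> R[i]) (c : R) m :
  cmeas f -> (forall w, normc (f w) <= c * (1 + normc (cplx w)) ^+ m) ->
  cintegrable (@plane_measure R) (fun w => f w * (gplane w)%:C).
Proof.
move=> mf fb.
apply: (@cintegrable_le _ _ _ _ _ (fun w => c * ((1 + normc (cplx w)) ^+ m * gplane w))).
- by apply: cmeasM => //; apply: cmeas_real; exact: measurable_gplane.
- by under eq_fun do rewrite EFinM; apply: integrableZl => //; exact: integrable_pow1_gplane.
- move=> w; rewrite normcM normc_real ger0_norm ?expR_ge0// mulrA.
  by rewrite ler_wpM2r ?expR_ge0.
Qed.

Lemma cintegrable_horner_gw (P : {poly R[i]}) :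
  cintegrable leb (fun x => P.[x%:C] * (gw s x)%:C).
Proof.
under eq_fun do rewrite horner_coef big_distrl.
apply: cintegrable_sum => i _.
under eq_fun do rewrite /= -mulrA -rmorphXn -rmorphM.
apply: cintegrableZ; split => /=; last exact: integrable0.
exact: integrable_monom_gw.
Qed.

Lemma stein_horner (P : {poly R[i]}) :
  (2 * s)%:C * cint leb (fun x => x%:C * P.[x%:C] * (gw s x)%:C) =
  cint leb (fun x => P^`().[x%:C] * (gw s x)%:C).
Proof.
have mono p : cintegrable leb (fun x => (x ^+ p * gw s x)%:C).
  by split => /=; [exact: integrable_monom_gw|exact: integrable0].
transitivity (\sum_(i < size P) (2 * s)%:C *
    cint leb (fun x => P`_i * (x ^+ i.+1 * gw s x)%:C)).
  rewrite -mulr_sumr -cint_sum; last by move=> i _; exact: cintegrableZ.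
  congr (_ * _); apply: eq_cint => x.
  rewrite horner_coef mulr_sumr mulr_suml; apply: eq_bigr => i _.
  by rewrite exprS !rmorphM rmorphXn; ring.
transitivity (\sum_(i < size P)
    cint leb (fun x => (P`_i * i%:R) * (x ^+ i.-1 * gw s x)%:C)); last first.
  rewrite -cint_sum; last by move=> i _; exact: cintegrableZ.
  apply: eq_cint => x; rewrite -[in RHS](coefK P) poly_def raddf_sum.
  rewrite horner_sum mulr_suml; apply: eq_bigr => i _.
  by rewrite /= derivZ derivXn hornerZ hornerMn hornerXn !rmorphM rmorphXn /= -mulr_natr; ring.
apply: eq_bigr => i _; rewrite !cintZ// mulrCA -mulrA; congr (_ * _).
rewrite !cint_real -rmorphM gauss_stein_real// rmorphM.
by rewrite rmorph_nat.
Qed.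

Definition moment i j : R[i] := cint (@plane_measure R)
  (fun w => cplx w ^+ i * conjc (cplx w) ^+ j * (gplane w)%:C).

Lemma cintegrable_monom (f : plane R -> R[i]) i j :
  cmeas f -> (forall w, normc (f w) <= 1 + normc (cplx w)) ->
  cintegrable (@plane_measure R)
    (fun w => f w * (cplx w ^+ i * conjc (cplx w) ^+ j) * (gplane w)%:C).
Proof.
move=> mf f1; apply: (@cintegrable_gplane_bound _ 1 (i + j).+1).
  apply: cmeasM => //; apply: cmeasM; apply: cmeasX; first exact: cmeas_cplx.
  by apply: cmeas_conj; exact: cmeas_cplx.
move=> w; rewrite mul1r !normcM !normcX normc_conj -exprD exprS.
apply: ler_pM; rewrite ?normc_ge0 ?exprn_ge0 ?normc_ge0//.
by rewrite lerXn2r ?nnegrE ?addr_ge0 ?normc_ge0// lerDr.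
Qed.

Lemma cintegrable_moment i j : cintegrable (@plane_measure R)
  (fun w => cplx w ^+ i * conjc (cplx w) ^+ j * (gplane w)%:C).
Proof.
rewrite (_ : (fun w => _) = (fun w =>
  1 * (cplx w ^+ i * conjc (cplx w) ^+ j) * (gplane w)%:C)); last first.
  by apply/funext => w; rewrite mul1r.
apply: cintegrable_monom; first exact: cmeas_cst.
by move=> w; rewrite normc1 lerDl normc_ge0.
Qed.

Lemma plane_fubini (f : plane R -> R[i]) :
  cintegrable (@plane_measure R) f -> (forall x, cintegrable leb (fun y => f (x, y))) ->
  cint (@plane_measure R) f = cint leb (fun x => cint leb (fun y => f (x, y))).
Proof. exact: (@cint_fubini _ _ _ _ R leb leb). Qed.

Lemma plane_fubini21 (f : plane R -> R[i]) :
  cintegrable (@plane_measure R) f -> (forall y, cintegrable leb (fun x => f (x, y))) ->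
  cint (@plane_measure R) f = cint leb (fun y => cint leb (fun x => f (x, y))).
Proof. exact: (@cint_fubini21 _ _ _ _ R leb leb). Qed.

(** For fixed imaginary part [y] the monomial in [w] and its conjugate is a polynomial [P y] in the
    real part, to which the one-dimensional identity applies; both [w] and its conjugate have
    derivative 1 in that direction. *)
Lemma stein_x i j : (2 * s)%:C * cint (@plane_measure R)
    (fun w => w.1%:C * (cplx w ^+ i * conjc (cplx w) ^+ j) * (gplane w)%:C) =
  i%:R * moment i.-1 j + j%:R * moment i j.-1.
Proof.
pose P (y : R) : {poly R[i]} :=
  ('X + ('i * y%:C)%:P) ^+ i * ('X - ('i * y%:C)%:P) ^+ j.
have PE (x y : R) : (P y).[x%:C] = cplx (x, y) ^+ i * conjc (cplx (x, y)) ^+ j.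
  rewrite /P hornerM !horner_exp !(hornerD,hornerN,hornerX,hornerC) /cplx /=.
  by congr (_ ^+ _ * _ ^+ _); apply: complex_eqP => /=; ring.
pose f (w : plane R) :=
  w.1%:C * (cplx w ^+ i * conjc (cplx w) ^+ j) * (gplane w)%:C.
have fE (x y : R) : f (x, y) =
    (gw s y)%:C * (x%:C * (P y).[x%:C] * (gw s x)%:C).
  by rewrite /f PE gplaneE /= rmorphM; ring.
pose g (w : plane R) := i%:R * (cplx w ^+ i.-1 * conjc (cplx w) ^+ j * (gplane w)%:C)
  + j%:R * (cplx w ^+ i * conjc (cplx w) ^+ j.-1 * (gplane w)%:C).
have gE (x y : R) : g (x, y) = (gw s y)%:C * ((P y)^`().[x%:C] * (gw s x)%:C).
  have -> : (P y)^`().[x%:C] = i%:R * (cplx (x, y) ^+ i.-1 * conjc (cplx (x, y)) ^+ j)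
      + j%:R * (cplx (x, y) ^+ i * conjc (cplx (x, y)) ^+ j.-1).
    rewrite /P derivM !deriv_exp derivD derivB !derivC derivX addr0 subr0 !mul1r.
    rewrite hornerD !hornerM !hornerMn !horner_exp.
    rewrite !(hornerD,hornerN,hornerX,hornerC).
    have -> : x%:C + 'i * y%:C = cplx (x, y) by apply: complex_eqP => /=; ring.
    have -> : x%:C - 'i * y%:C = conjc (cplx (x, y)) by apply: complex_eqP => /=; ring.
    ring.
  by rewrite /g gplaneE /= rmorphM; ring.
have fi : cintegrable (@plane_measure R) f.
  apply: (@cintegrable_monom (fun w => w.1%:C) i j).
    by apply: cmeas_real; exact: measurable_fst.
  by move=> w; rewrite normc_real (le_trans (normRe (cplx w)))// lerDr.
have gi1 : cintegrable (@plane_measure R)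
    (fun w => i%:R * (cplx w ^+ i.-1 * conjc (cplx w) ^+ j * (gplane w)%:C)).
  by apply: cintegrableZ; exact: cintegrable_moment.
have gi2 : cintegrable (@plane_measure R)
    (fun w => j%:R * (cplx w ^+ i * conjc (cplx w) ^+ j.-1 * (gplane w)%:C)).
  by apply: cintegrableZ; exact: cintegrable_moment.
have gi : cintegrable (@plane_measure R) g by exact: cintegrableD.
have hf y : cintegrable leb (fun x => x%:C * (P y).[x%:C] * (gw s x)%:C).
  have := cintegrable_horner_gw ('X * P y).
  by under eq_fun do rewrite hornerM hornerX.
transitivity (cint (@plane_measure R) g); last first.
  by rewrite cintD// !cintZ//; exact: cintegrable_moment.
have gy y : cintegrable leb (fun x => g (x, y)).
  rewrite (funext (fun x => gE x y)).
  by apply: cintegrableZ; exact: cintegrable_horner_gw.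
have fy y : cintegrable leb (fun x => (2 * s)%:C * f (x, y)).
  apply: cintegrableZ; rewrite (funext (fun x => fE x y)).
  by apply: cintegrableZ; exact: hf.
rewrite (plane_fubini21 gi gy) -cintZ//.
rewrite (plane_fubini21 (cintegrableZ _ fi) fy).
apply: eq_cint => y; rewrite (funext (fun x => gE x y)).
rewrite [RHS]cintZ; last exact: cintegrable_horner_gw.
rewrite -stein_horner.
rewrite -(cintZ _ (hf y)) -cintZ; last by apply: cintegrableZ; exact: hf.
apply: eq_cint => x; rewrite fE; ring.
Qed.

(** Same argument on vertical lines, where [w] has derivative ['i] and its conjugate [- 'i]. *)
Lemma stein_y i j : (2 * s)%:C * cint (@plane_measure R)
    (fun w => w.2%:C * (cplx w ^+ i * conjc (cplx w) ^+ j) * (gplane w)%:C) =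
  'i * (i%:R * moment i.-1 j - j%:R * moment i j.-1).
Proof.
pose P (x : R) : {poly R[i]} :=
  (x%:C%:P + 'i *: 'X) ^+ i * (x%:C%:P - 'i *: 'X) ^+ j.
have PE (x y : R) : (P x).[y%:C] = cplx (x, y) ^+ i * conjc (cplx (x, y)) ^+ j.
  rewrite /P hornerM !horner_exp !(hornerD,hornerN,hornerZ,hornerX,hornerC) /cplx /=.
  by congr (_ ^+ _ * _ ^+ _); apply: complex_eqP => /=; ring.
pose f (w : plane R) :=
  w.2%:C * (cplx w ^+ i * conjc (cplx w) ^+ j) * (gplane w)%:C.
have fE (x y : R) : f (x, y) =
    (gw s x)%:C * (y%:C * (P x).[y%:C] * (gw s y)%:C).
  by rewrite /f PE gplaneE /= rmorphM; ring.
pose g (w : plane R) := 'i * i%:R * (cplx w ^+ i.-1 * conjc (cplx w) ^+ j * (gplane w)%:C)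
  + - 'i * j%:R * (cplx w ^+ i * conjc (cplx w) ^+ j.-1 * (gplane w)%:C).
have gE (x y : R) : g (x, y) = (gw s x)%:C * ((P x)^`().[y%:C] * (gw s y)%:C).
  have -> : (P x)^`().[y%:C] = 'i * i%:R * (cplx (x, y) ^+ i.-1 * conjc (cplx (x, y)) ^+ j)
      - 'i * j%:R * (cplx (x, y) ^+ i * conjc (cplx (x, y)) ^+ j.-1).
    rewrite /P derivM !deriv_exp derivD derivB !derivZ !derivC derivX add0r sub0r.
    rewrite hornerD !hornerM !hornerMn !hornerM !horner_exp.
    rewrite !(hornerD,hornerN,hornerZ,hornerX,hornerC).
    have -> : x%:C + 'i * y%:C = cplx (x, y) by apply: complex_eqP => /=; ring.
    have -> : x%:C - 'i * y%:C = conjc (cplx (x, y)) by apply: complex_eqP => /=; ring.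
    ring.
  by rewrite /g gplaneE /= rmorphM; ring.
have fi : cintegrable (@plane_measure R) f.
  apply: (@cintegrable_monom (fun w => w.2%:C) i j).
    by apply: cmeas_real; exact: measurable_snd.
  by move=> w; rewrite normc_real (le_trans (normIm (cplx w)))// lerDr.
have gi1 : cintegrable (@plane_measure R)
    (fun w => 'i * i%:R * (cplx w ^+ i.-1 * conjc (cplx w) ^+ j * (gplane w)%:C)).
  by apply: cintegrableZ; exact: cintegrable_moment.
have gi2 : cintegrable (@plane_measure R)
    (fun w => - 'i * j%:R * (cplx w ^+ i * conjc (cplx w) ^+ j.-1 * (gplane w)%:C)).
  by apply: cintegrableZ; exact: cintegrable_moment.
have gi : cintegrable (@plane_measure R) g by exact: cintegrableD.
have hf x : cintegrable leb (fun y => y%:C * (P x).[y%:C] * (gw s y)%:C).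
  have := cintegrable_horner_gw ('X * P x).
  by under eq_fun do rewrite hornerM hornerX.
transitivity (cint (@plane_measure R) g); last first.
  by rewrite cintD// !cintZ; [rewrite /moment; ring|exact: cintegrable_moment..].
have gx x : cintegrable leb (fun y => g (x, y)).
  rewrite (funext (fun y => gE x y)).
  by apply: cintegrableZ; exact: cintegrable_horner_gw.
have fx x : cintegrable leb (fun y => (2 * s)%:C * f (x, y)).
  apply: cintegrableZ; rewrite (funext (fun y => fE x y)).
  by apply: cintegrableZ; exact: hf.
rewrite (plane_fubini gi gx) -cintZ//.
rewrite (plane_fubini (cintegrableZ _ fi) fx).
apply: eq_cint => x; rewrite (funext (fun y => gE x y)).
rewrite [RHS]cintZ; last exact: cintegrable_horner_gw.
rewrite -stein_horner.
rewrite -(cintZ _ (hf x)) -cintZ; last by apply: cintegrableZ; exact: hf.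
apply: eq_cint => y; rewrite fE; ring.
Qed.

Lemma moment_conj i j : moment j i = conjc (moment i j).
Proof.
rewrite /moment -cint_conj; last exact: cintegrable_moment.
apply: eq_cint => w; rewrite !rmorphM !rmorphXn /= opprK oppr0.
by rewrite [X in _ = X * _]mulrC.
Qed.

(** The combination x - i y of the two Stein identities is the Wirtinger derivative in [w]: it does
    not see the powers of the conjugate, whose contributions cancel. *)
Lemma moment_rec i j : s%:C * moment i j.+1 = i%:R * moment i.-1 j.
Proof.
have E : moment i j.+1 =
    cint (@plane_measure R)
      (fun w => w.1%:C * (cplx w ^+ i * conjc (cplx w) ^+ j) * (gplane w)%:C) +
    - 'i * cint (@plane_measure R)
      (fun w => w.2%:C * (cplx w ^+ i * conjc (cplx w) ^+ j) * (gplane w)%:C).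
  have f1 : cintegrable (@plane_measure R)
      (fun w => w.1%:C * (cplx w ^+ i * conjc (cplx w) ^+ j) * (gplane w)%:C).
    apply: (@cintegrable_monom (fun w => w.1%:C) i j).
      by apply: cmeas_real; exact: measurable_fst.
    by move=> w; rewrite normc_real (le_trans (normRe (cplx w)))// lerDr.
  have f2 : cintegrable (@plane_measure R)
      (fun w => w.2%:C * (cplx w ^+ i * conjc (cplx w) ^+ j) * (gplane w)%:C).
    apply: (@cintegrable_monom (fun w => w.2%:C) i j).
      by apply: cmeas_real; exact: measurable_snd.
    by move=> w; rewrite normc_real (le_trans (normIm (cplx w)))// lerDr.
  rewrite -cintZ// -cintD//; last exact: cintegrableZ.
  apply: eq_cint => w; rewrite exprS.
  have {1}-> : conjc (cplx w) = w.1%:C - 'i * w.2%:C.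
    by apply: complex_eqP => /=; ring.
  ring.
have i2 : 'i * 'i = -1 :> R[i] by apply: complex_eqP => /=; ring.
have e1 := stein_x i j; have e2 := stein_y i j.
have : (2 * s)%:C * moment i j.+1 = 2 * (i%:R * moment i.-1 j).
  rewrite E mulrDr e1 mulrCA e2.
  set a := i%:R * _; set b := j%:R * _.
  have -> : - 'i * ('i * (a - b)) = a - b by rewrite mulrA mulNr i2 opprK mul1r.
  by rewrite addrA addrAC addrK mulr2n mulrDl mul1r.
rewrite rmorphM /= rmorph_nat -mulrA; apply: mulfI.
by rewrite pnatr_eq0.
Qed.

(** Orthogonality of monomials: the recursion lowers both exponents together, and when one of them
    reaches 0 first the moment vanishes. *)
Lemma momentE i j :
  moment i j = (i == j)%:R * ((i`!)%:R / s%:C ^+ i) * moment 0 0.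
Proof.
have sn0 : s%:C != 0 by apply/eqP => -[] /eqP; rewrite gt_eqF.
have m0S k : moment 0 k.+1 = 0.
  have := moment_rec 0 k; rewrite mul0r => /eqP; rewrite mulf_eq0 (negPf sn0).
  by move=> /eqP.
elim: j i => [|j IH] [|i].
- by rewrite eqxx fact0 expr0 divr1 !mul1r.
- by rewrite moment_conj m0S conjc0 !mul0r.
- by rewrite m0S !mul0r.
apply: (mulfI sn0); rewrite moment_rec IH eqSS factS natrM exprS.
rewrite invfM; have [_|_] := eqVneq i j; last by rewrite !mul0r !mulr0.
by field; rewrite expf_neq0.
Qed.

Lemma moment00 : moment 0 0 = (complex.Re (moment 0 0))%:C /\ 0 < complex.Re (moment 0 0).
Proof.
pose m := \int[leb]_x gw s x.
have gi : cintegrable leb (fun x => (gw s x)%:C).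
  by split => /=; [exact: integrable_gw|exact: integrable0].
have -> : moment 0 0 = (m * m)%:C.
  rewrite /moment rmorphM /= -cint_real -(cint_prod gi gi).
  by apply: eq_cint => w; rewrite gplaneE !expr0 !mul1r rmorphM.
by split => //=; rewrite mulr_gt0// gauss_mass_gt0.
Qed.

End gauss_complex.

(** * The overlap of a triangular matrix with distinct diagonal entries *)

Section triangular.
Context {R : realType} (n : nat).
Local Notation N := n.+2.
Local Notation C := R[i].
Variables (T : 'M[C]_N) (lam : 'I_N -> C).
Hypothesis Tdiag : forall i, T i i = lam i.
Hypothesis Tlow : forall i j : 'I_N, (j < i)%N -> T i j = 0.
Hypothesis lam_inj : injective lam.

(** The difference [d] has coordinate 0 at [s]. Going through the columns in increasing order,
    triangularity leaves [(lam a - lam s) * d a = 0], and the eigenvalues are distinct. *)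
Lemma left_eigen_unique s (u v : 'rV[C]_N) :
  u *m T = lam s *: u -> v *m T = lam s *: v -> v 0 s = 1 -> u = u 0 s *: v.
Proof.
move=> hu hv vs.
pose d := u - u 0 s *: v.
suff d0 : d = 0 by apply/eqP; rewrite -subr_eq0 -/d d0.
have hd : d *m T = lam s *: d.
  by rewrite mulmxBl -scalemxAl hu hv scalerBr !scalerA mulrC.
have ds : d 0 s = 0 by rewrite !mxE vs mulr1 subrr.
apply/rowP => a; rewrite [RHS]mxE.
elim/ltn_ind : {a}(a : nat) {1 3}a (erefl (a : nat)) => m IH a am.
have /rowP/(_ a) := hd; rewrite [in LHS]mxE [in RHS]mxE (bigD1 a)//= Tdiag.
rewrite big1 ?addr0; last first.
  move=> j ja; have [lja|] := ltnP j a; first by rewrite (IH j _ j) ?mul0r// -am.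
  by rewrite leq_eqVlt eq_sym (negPf (ja : val j != val a)) /= => /Tlow ->; rewrite mulr0.
have [->//|sa] := eqVneq a s.
move/eqP; rewrite mulrC -subr_eq0 -mulrBl mulf_eq0 subr_eq0 => /orP[/eqP/lam_inj/eqP|/eqP//].
by rewrite (negPf sa).
Qed.

(** Back substitution from the last row; the induction runs on the distance [N - a] to the end. *)
Lemma right_eigen_support s (r : 'cV[C]_N) :
  T *m r = lam s *: r -> forall a : 'I_N, (s < a)%N -> r a 0 = 0.
Proof.
move=> hr a; move: {2}(N - a)%N (leqnn (N - a)) => m.
elim: m a => [|m IH] a am sa.
  by move: am; rewrite leqn0 subn_eq0 leqNgt ltn_ord.
have /colP/(_ a) := hr; rewrite [in LHS]mxE [in RHS]mxE (bigD1 a)//= Tdiag.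
rewrite big1 ?addr0; last first.
  move=> j ja; have [lja|] := ltnP j a; first by rewrite Tlow ?mul0r.
  rewrite leq_eqVlt eq_sym (negPf (ja : val j != val a)) /= => aj.
  rewrite (IH j) ?mulr0//; last exact: ltn_trans aj.
  by rewrite -ltnS; apply: leq_trans am; rewrite ltn_sub2l.
move/eqP; rewrite -subr_eq0 -mulrBl mulf_eq0 subr_eq0 => /orP[/eqP/lam_inj e|/eqP//].
by move: sa; rewrite e ltnn.
Qed.

Variable L : 'I_N -> 'rV[C]_N.
Hypothesis Leig : forall s, L s *m T = lam s *: L s.
Hypothesis L1 : forall s, L s 0 s = 1.
Hypothesis Llow : forall s a : 'I_N, (a < s)%N -> L s 0 a = 0.

(** The rows [L s] form a unitriangular, hence invertible, matrix [U] that diagonalizes [T]; the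
    columns of its inverse are the right eigenvectors, and biorthogonality is [U *m invmx U = 1]. *)
Lemma eigensystem_exists : exists r l, is_eigensystem T lam r l.
Proof.
pose U : 'M[C]_N := \matrix_(s, a) L s 0 a.
have rowU s : row s U = L s by apply/rowP => a; rewrite !mxE.
have UT : U *m T = diag_mx (\row_i lam i) *m U.
  apply/row_matrixP => s; rewrite row_mul rowU Leig row_mul.
  apply/rowP => a; rewrite !mxE (bigD1 s)//= !mxE eqxx mulr1n big1 ?addr0// => j js.
  by rewrite !mxE eq_sym (negPf js) mulr0n mul0r.
have Uu : U \in unitmx.
  rewrite unitmxE -det_tr det_trig; last first.
    by apply/is_trig_mxP => i j ij; rewrite !mxE Llow.
  by rewrite big1 ?unitr1// => i _; rewrite !mxE L1.
clearbody U.
exists (fun i => col i (invmx U)), (fun i => (L i)^T); split.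
- move=> i.
  have : T *m invmx U = invmx U *m diag_mx (\row_i lam i).
    have h : T = invmx U *m (diag_mx (\row_i lam i) *m U).
      by rewrite -UT mulmxA mulVmx// mul1mx.
    by rewrite [in LHS]h -mulmxA -mulmxA (mulmxV Uu) mulmx1.
  move/(congr1 (fun A => A *m delta_mx i (0 : 'I_1))); rewrite -mulmxA -!colE => ->.
  apply/colP => a; rewrite !mxE (bigD1 i)//= !mxE eqxx mulr1n big1 ?addr0 1?mulrC// => j ji.
  by rewrite !mxE (negPf ji) mulr0n mulr0.
- by move=> i; rewrite trmxK.
- move=> i j; rewrite trmxK -rowU colE mulmxA -row_mul mulmxV// -colE.
  by rewrite !mxE.
Qed.

(** Only the right vectors 0 and 1 occur, and they live on the first two coordinates, so
    biorthogonality determines them: the first coordinate of [r 1] is [- L 0 0 1] times its second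
    one. The free scalings of left and right vectors cancel in pairs ([e00], [c11]). *)
Lemma overlap_triangular :
  overlap T lam 0 1 = - conjc (L 0 0 1) * \sum_a L 0 0 a * conjc (L 1 0 a).
Proof.
(* The default value of [xget] is excluded, since an eigensystem exists. *)
rewrite /overlap; case: xgetP => [y _ /=|noex]; last first.
  have [r [l h]] := eigensystem_exists.
  by have := noex _ (ex_intro _ r (ex_intro _ l (conj h erefl))).
move=> [r [l [[hr hl hlr] ->]]].
have scal s : (l s)^T = l s s 0 *: L s.
  by have := left_eigen_unique (hl s) (Leig s) (L1 s); rewrite mxE.
have l0 : l 0 0 0 *: L 0 = (l 0)^T by rewrite scal.
have l1 : l 1 1 0 *: L 1 = (l 1)^T by rewrite scal.
have r0 a : a != 0 -> r 0 a 0 = 0.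
  by move=> a0; apply: (right_eigen_support (hr 0)); rewrite lt0n.
have r1 (a : 'I_N) : a != 0 -> a != 1 -> r 1 a 0 = 0.
  move=> a0 a1; apply: (right_eigen_support (hr 1)).
  have : (a : nat) != 1%N by apply: contra a1 => /eqP a1; apply/eqP/val_inj.
  have : (a : nat) != 0%N by apply: contra a0 => /eqP a0; apply/eqP/val_inj.
  by move: (val a) => [|[|]].
have e00 : l 0 0 0 * r 0 0 0 = 1.
  have := hlr 0 0; rewrite -l0 -scalemxAl [in LHS]mxE [in X in _ * X]mxE (bigD1 0)//= big1 ?addr0.
    by rewrite L1 mul1r.
  by move=> a a0; rewrite r0// mulr0.
have e11 : l 1 1 0 * r 1 1 0 = 1.
  have := hlr 1 1; rewrite -l1 -scalemxAl [in LHS]mxE [in X in _ * X]mxE (bigD1 1)//= big1 ?addr0.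
    by rewrite L1 mul1r.
  move=> a a1; have [->|a0] := eqVneq a 0; first by rewrite Llow ?mul0r.
  by rewrite r1// mulr0.
have e01 : r 1 0 0 = - (L 0 0 1 * r 1 1 0).
  have := hlr 0 1; rewrite -l0 -scalemxAl [in LHS]mxE [in X in _ * X]mxE (bigD1 0)//= (bigD1 1)//=.
  rewrite big1 ?addr0; last by move=> a /andP[a0 a1]; rewrite r1// mulr0.
  rewrite L1 mul1r => /eqP; rewrite mulf_eq0 => /orP[/eqP l00|].
    by move: e00; rewrite l00 mul0r => /esym/eqP; rewrite oner_eq0.
  by rewrite addr_eq0 => /eqP.
have -> : (adjoint (r 1) *m r 0) 0 0 = conjc (r 1 0 0) * r 0 0 0.
  rewrite mxE (bigD1 0)//= !mxE big1 ?addr0// => a a0.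
  by rewrite r0// mulr0.
have -> : (adjoint (l 1) *m l 0) 0 0 =
    conjc (l 1 1 0) * l 0 0 0 * \sum_a L 0 0 a * conjc (L 1 0 a).
  rewrite mxE mulr_sumr; apply: eq_bigr => a _; rewrite !mxE.
  have -> : l 1 a 0 = l 1 1 0 * L 1 0 a by have /rowP/(_ a) := l1; rewrite !mxE.
  have -> : l 0 a 0 = l 0 0 0 * L 0 0 a by have /rowP/(_ a) := l0; rewrite !mxE.
  by rewrite rmorphM /=; ring.
rewrite e01.
have c11 : conjc (l 1 1 0) * conjc (r 1 1 0) = 1 by rewrite -rmorphM e11 rmorph1.
rewrite rmorphN rmorphM /=.
transitivity (- conjc (L 0 0 1) * (l 0 0 0 * r 0 0 0) *
  (conjc (l 1 1 0) * conjc (r 1 1 0)) * (\sum_a L 0 0 a * conjc (L 1 0 a))).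
  by ring.
by rewrite e00 c11 !mulr1.
Qed.

End triangular.

(** * Left eigenvectors by forward substitution, one row at a time *)

Section proc.
Context {R : realType} (n : nat).
Local Notation N := n.+1.
Local Notation C := R[i].
Implicit Types (w c r : 'I_N -> C) (rows : seq ('I_N -> C)).

Definition row_step w (k : 'I_N) r c : 'I_N -> C :=
  fun a => c a + (if (k < a)%N then c k * r a * w a else 0).

(** [c] accumulates partial sums; at step [k] its entry [k] is final and is spread to the later
    entries through row [k]. Consuming the matrix row by row, rather than computing entry by entry,
    is what later allows independent Gaussian rows to be integrated out successively. *)
Fixpoint proc w k rows c : 'I_N -> C :=
  if rows is r :: rs then proc w k.+1 rs (row_step w (inord k) r c) else c.

(** An entry is frozen once its row is used ([pk]), so the partial sums met along the way may be
    replaced by final values: this recovers the usual recursion for eigenvector coordinates. *)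
Lemma procE w k rows c a : (k + size rows <= N)%N ->
  proc w k rows c a = c a +
    \sum_(j < N | [&& k <= j, j < k + size rows & j < a]%N)
      proc w k rows c j * nth (fun _ => 0) rows (j - k) a * w a.
Proof.
elim: rows k c a => [|r rs IH] k c a /= krs.
  rewrite big_pred0 ?addr0// => j; rewrite addn0.
  by case: leqP => //= kj; rewrite ltnNge kj.
move: krs; rewrite addnS -addSn => krs.
have kN : (k < N)%N by apply: leq_trans krs; rewrite ltnS leq_addr.
have ik : (inord k : 'I_N) = k :> nat by rewrite inordK.
have pk : proc w k.+1 rs (row_step w (inord k) r c) (inord k) = c (inord k).
  rewrite IH// big_pred0; first by rewrite /row_step ltnn !addr0.
  by move=> j; rewrite ik; case: ltnP => //= kj; rewrite [X in _ && X]ltnNge (ltnW kj) andbF.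
rewrite IH// {1}/row_step ik -addrA; congr (_ + _).
have [ka|ak] := ltnP k a.
  rewrite [RHS](bigD1 (inord k)) ?ik ?leqnn ?ka ?leq_addr//=.
  rewrite subnn /= pk; congr (_ + _); apply: eq_big => [j|j /andP[kj _]].
    rewrite -val_eqE/= ik ltn_neqAle eq_sym andbC.
    by case: (k <= j)%N; case: (j != k :> nat); rewrite ?andbF ?andbT.
  by rewrite -(subnSK kj).
rewrite add0r; apply: eq_big => [j|j /and3P[kj _ _]].
  rewrite ltn_neqAle; case: (leqP k j) => //= kj; rewrite ?andbF// andbT.
  by have [<-|//] := eqVneq k (j : nat); rewrite [X in _ = _ && X]ltnNge ak andbF.
by rewrite -(subnSK kj).
Qed.

End proc.

Section left_vectors.
Context {R : realType} (n : nat).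
Local Notation N := n.+2.
Local Notation C := R[i].
Variables (T : 'M[C]_N) (lam : 'I_N -> C) (rows : seq ('I_N -> C)).
Hypothesis Tdiag : forall i, T i i = lam i.
Hypothesis Tlow : forall i j : 'I_N, (j < i)%N -> T i j = 0.
Hypothesis lam_inj : injective lam.
Hypothesis rowsN : size rows = N.
Hypothesis Trows : forall i j : 'I_N, (i < j)%N -> nth (fun _ => 0) rows i j = T i j.

Definition leftvec (s : 'I_N) : 'I_N -> C :=
  proc (fun a => (lam s - lam a)^-1) 0 rows (fun a => (a == s)%:R).

(** The eigenvalue equation in column [a], solved for coordinate [a]. At [a = s] the weight is
    [0^-1 = 0], which agrees with the sum being empty of nonzero terms by [leftvec_low]. *)
Lemma leftvecE s a : leftvec s a = (a == s)%:R +
  \sum_(j < N | (j < a)%N) leftvec s j * nth (fun _ => 0) rows j a * (lam s - lam a)^-1.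
Proof.
rewrite /leftvec procE ?rowsN ?add0n//; congr (_ + _).
by apply: eq_big => [j|j _]; rewrite ?ltn_ord ?subn0.
Qed.

Lemma leftvec_low (s a : 'I_N) : (a < s)%N -> leftvec s a = 0.
Proof.
have [m] := ubnP (a : nat); elim: m a => // m IH a; rewrite ltnS => am ms.
rewrite leftvecE -val_eqE/= ltn_eqF// add0r big1// => j ja.
by rewrite IH ?mul0r//; [exact: leq_trans am|exact: ltn_trans ms].
Qed.

Lemma leftvec1 s : leftvec s s = 1.
Proof.
by rewrite leftvecE eqxx big1 ?addr0// => j js; rewrite leftvec_low ?mul0r.
Qed.

Lemma overlap_leftvec : overlap T lam 0 1 =
  - conjc (leftvec 0 1) * \sum_a leftvec 0 a * conjc (leftvec 1 a).
Proof.
rewrite (@overlap_triangular _ _ _ _ Tdiag Tlow lam_inj (fun s => \row_a leftvec s a)).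
- by rewrite mxE; congr (_ * _); apply: eq_bigr => a _; rewrite !mxE.
- move=> s; apply/rowP => a; rewrite mxE [RHS]mxE [X in _ = _ * X]mxE.
  under eq_bigr do rewrite mxE.
  rewrite (bigID (fun j : 'I_N => (j < a)%N))/= [X in _ + X](bigD1 a) ?ltnn//=.
  rewrite [X in _ + (_ + X)]big1 ?addr0; last first.
    move=> j /andP[ja jna]; rewrite Tlow ?mulr0//.
    by rewrite ltn_neqAle leqNgt ja andbT eq_sym.
  rewrite Tdiag.
  have -> : \sum_(j < N | (j < a)%N) leftvec s j * T j a =
      (lam s - lam a) * leftvec s a.
    rewrite leftvecE -mulr_suml.
    under [X in _ = _ * (_ + X * _)]eq_bigr => j ja do rewrite Trows//.
    have [->|as0] := eqVneq a s.
      rewrite subrr mul0r big1// => j js.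
      by rewrite leftvec_low// mul0r.
    have ln0 : lam s - lam a != 0.
      by rewrite subr_eq0; apply: contra as0 => /eqP/lam_inj ->.
    by rewrite add0r mulrCA mulfV// mulr1.
  by ring.
- by move=> s; rewrite mxE leftvec1.
- by move=> s a sa; rewrite mxE leftvec_low.
Qed.

End left_vectors.

Section tuple_meas.
Context d (T : measurableType d) (R : realType).
Lemma cmeas_tuple_cons n (g : n.+1.-tuple T -> R[i]) :
  cmeas (fun p => g (@tuple_cons _ T n p)) -> cmeas g.
Proof.
move=> [g1 g2].
pose h (t : n.+1.-tuple T) := (thead t, [tuple of behead t]).
have mh : measurable_fun setT h.
  apply/measurable_fun_pairP; split => /=.
    exact: (measurable_tnth (ord0 : 'I_n.+1)).
  exact: measurable_behead.
have hK t : tuple_cons (h t) = t by rewrite [RHS]tuple_eta; exact: val_inj.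
split.
  rewrite (_ : (fun x => _) = (fun p => complex.Re (g (tuple_cons p))) \o h).
    exact: measurableT_comp.
  by apply/funext => t /=; rewrite hK.
rewrite (_ : (fun x => _) = (fun p => complex.Im (g (tuple_cons p))) \o h).
  exact: measurableT_comp.
by apply/funext => t /=; rewrite hK.
Qed.

Lemma cint_tupleS' (mu : {sigma_finite_measure set T -> \bar R}) n
    (g : n.+1.-tuple T -> R[i]) :
  cintegrable (mu \x tuple_measure mu n)%E (fun p => g (tuple_cons p)) ->
  cintegrable (tuple_measure mu n.+1) g /\
  cint (tuple_measure mu n.+1) g =
  cint (mu \x tuple_measure mu n)%E (fun p => g (tuple_cons p)).
Proof.
by move=> gi; apply: cint_tupleS => //; apply: cmeas_tuple_cons; exact: cintegrable_meas gi.
Qed.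
End tuple_meas.

Section proc_linear.
Context {R : realType} (n : nat).
Local Notation N := n.+1.
Local Notation C := R[i].
Implicit Types (w c r : 'I_N -> C) (rows : seq ('I_N -> C)).

Lemma proc_linear w k rows c a :
  proc w k rows c a = \sum_b c b * proc w k rows (fun a => (a == b)%:R) a.
Proof.
elim: rows k c => [|r rs IH] k c /=.
  rewrite (bigD1 a)//= eqxx mulr1 big1 ?addr0// => b ba.
  by rewrite eq_sym (negPf ba) mulr0.
rewrite IH.
under [RHS]eq_bigr => b _ do rewrite IH mulr_sumr.
rewrite exchange_big/=; apply: eq_bigr => b' _.
under eq_bigr => b _ do rewrite mulrA.
rewrite -mulr_suml; congr (_ * _); rewrite /row_step.
under eq_bigr => b _ do rewrite mulrDr.
rewrite big_split/=; congr (_ + _).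
  rewrite (bigD1 b')//= eqxx mulr1 big1 ?addr0// => b ba.
  by rewrite eq_sym (negPf ba) mulr0.
case: ifP => _; last by rewrite big1// => b _; rewrite mulr0.
rewrite (bigD1 (inord k))//= eqxx mul1r big1 ?addr0 ?mulrA// => b ba.
by rewrite eq_sym (negPf ba) !mul0r mulr0.
Qed.

Definition cpair w1 w2 k rows c d : C :=
  \sum_a proc w1 k rows c a * conjc (proc w2 k rows d a).

(** After one row has been processed, this separates its randomness (in [c] and [d]) from that of
    the remaining rows, as a finite sum of products. *)
Lemma cpair_bilinear w1 w2 k rows c d : cpair w1 w2 k rows c d =
  \sum_b \sum_b' (c b * conjc (d b')) *
    cpair w1 w2 k rows (fun a => (a == b)%:R) (fun a => (a == b')%:R).
Proof.
rewrite /cpair.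
under eq_bigr => a _ do rewrite (proc_linear w1) (proc_linear w2) rmorph_sum mulr_suml.
rewrite exchange_big/=; apply: eq_bigr => b _.
under eq_bigr => a _ do rewrite mulr_sumr.
rewrite exchange_big/=; apply: eq_bigr => b' _.
rewrite mulr_sumr; apply: eq_bigr => a _.
by rewrite rmorphM /=; ring.
Qed.

Variable x : 'I_N -> C.
(** The mean factor that a starting entry [a] acquires from the rows [k] onwards: none if its row
    has already been used, and otherwise one factor for every later coordinate. *)
Definition kap k (a : 'I_N) : C :=
  if (a < k)%N then 1 else \prod_(b < N | (a < b)%N) (1 + x b).

(** Telescoping: the sum over the smallest index chosen is the expansion of the product of the
    [1 + x b]. *)
Lemma kap_step (k : 'I_N) :
  \sum_(a < N | (k < a)%N) x a * kap k.+1 a + 1 = kap k k.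
Proof.
rewrite /kap ltnn.
have E m : (m <= N)%N ->
  \sum_(a < N | (N - m <= a)%N) x a * \prod_(b < N | (a < b)%N) (1 + x b) + 1 =
  \prod_(b < N | (N - m <= b)%N) (1 + x b).
  elim: m => [_|m IH mN].
    rewrite subn0 big_pred0 ?big_pred0 ?add0r// => j; exact: ltn_geF.
  have jN : (N - m.+1 < N)%N by rewrite ltn_subrL.
  have jm : (N - m = (N - m.+1).+1)%N by rewrite subnSK.
  pose j := Ordinal jN.
  rewrite (bigD1 j)//= [RHS](bigD1 j)//=.
  have pE (b : 'I_N) : (N - m.+1 <= b)%N && (b != j) = (N - m <= b)%N.
    by rewrite jm ltn_neqAle eq_sym andbC -val_eqE.
  rewrite !(eq_bigl _ _ pE) -addrA IH; last exact: ltnW.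
  rewrite (eq_bigl (fun b : 'I_N => N - m <= b)%N) ?mulrDl ?mul1r 1?addrC// => b.
  by rewrite jm.
have kN : (k.+1 = N - (N - k.+1))%N by rewrite subKn.
have := E (N - k.+1)%N (leq_subr _ _); rewrite -kN => <-.
congr (_ + _); apply: eq_bigr => a ka.
by rewrite ltnNge ka.
Qed.

End proc_linear.

(** * Averaging over the Gaussian entries *)

Section gaussian_rows.
Context {R : realType} (n : nat).
Local Notation N := n.+2.
Local Notation C := R[i].
Local Notation pm := (@plane_measure R).

Lemma Npos : 0 < (N%:R : R). Proof. by rewrite ltr0n. Qed.

Lemma entry_densityE (w : plane R) : entry_density n w = N%:R / pi * gplane N%:R w.
Proof. by []. Qed.

(** Total mass of one entry density; it is carried along as a nonzero constant and cancels in the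
    conditional expectation. *)
Definition emass : C := (N%:R / pi : R)%:C * moment N%:R 0 0.

Lemma emass_neq0 : emass != 0.
Proof.
rewrite /emass; have [-> m0] := moment00 Npos.
rewrite mulf_neq0//; apply/eqP => -[] /eqP; rewrite gt_eqF//.
by rewrite divr_gt0 ?pi_gt0 ?Npos.
Qed.

Lemma cint_entry i j :
  cintegrable pm (fun w => cplx w ^+ i * conjc (cplx w) ^+ j * (entry_density n w)%:C) /\
  cint pm (fun w => cplx w ^+ i * conjc (cplx w) ^+ j * (entry_density n w)%:C) =
  (i == j)%:R * (i`!%:R / N%:R ^+ i) * emass.
Proof.
have E : (fun w : plane R => cplx w ^+ i * conjc (cplx w) ^+ j * (entry_density n w)%:C) =
  (fun w => (N%:R / pi : R)%:C *
    (cplx w ^+ i * conjc (cplx w) ^+ j * (gplane N%:R w)%:C)).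
  by apply/funext => w; rewrite entry_densityE rmorphM mulrCA.
have mi := cintegrable_moment Npos i j.
rewrite E; split; first exact: cintegrableZ.
rewrite cintZ// -/(moment _ _ _) (momentE Npos) /emass rmorph_nat mulrCA.
by [].
Qed.

Definition row_density (r : N.-tuple (plane R)) : R :=
  \prod_(j < N) entry_density n (tnth r j).

Definition rowf (r : N.-tuple (plane R)) : 'I_N -> C := fun a => cplx (tnth r a).

Local Notation rm := (tuple_measure pm N).

Lemma cint_row_monom (p q : 'I_N -> nat) :
  cintegrable rm (fun r => (\prod_j (rowf r j ^+ p j * conjc (rowf r j) ^+ q j)) *
    (row_density r)%:C) /\
  cint rm (fun r => (\prod_j (rowf r j ^+ p j * conjc (rowf r j) ^+ q j)) *
    (row_density r)%:C) =
  \prod_j ((p j == q j)%:R * ((p j)`!%:R / N%:R ^+ (p j))) * emass ^+ N.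
Proof.
have := @cint_tuple_prod _ _ R pm N
  (fun j w => cplx w ^+ p j * conjc (cplx w) ^+ q j * (entry_density n w)%:C)
  (fun j => (cint_entry (p j) (q j)).1).
have -> : (fun r : N.-tuple (plane R) => (\prod_j (rowf r j ^+ p j * conjc (rowf r j) ^+ q j)) *
    (row_density r)%:C) = (fun t => \prod_j (cplx (tnth t j) ^+ p j *
    conjc (cplx (tnth t j)) ^+ q j * (entry_density n (tnth t j))%:C)).
  by apply/funext => t; rewrite /row_density rmorph_prod -big_split.
move=> [h1 ->]; split => //.
under eq_bigr do rewrite (cint_entry _ _).2.
by rewrite big_split/= prodr_const card_ord.
Qed.

Let delta (a : 'I_N) : 'I_N -> nat := fun j => nat_of_bool (j == a).

Lemma prod_delta (F : 'I_N -> C) (a : 'I_N) : \prod_j F j ^+ (j == a) = F a.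
Proof.
rewrite (bigD1 a)//= eqxx expr1 big1 ?mulr1// => j ja.
by rewrite (negPf ja) expr0.
Qed.

Lemma cint_row0 : cintegrable rm (fun r => (row_density r)%:C) /\
  cint rm (fun r => (row_density r)%:C) = emass ^+ N.
Proof.
have := cint_row_monom (fun=> 0%N) (fun=> 0%N).
under eq_fun => r do (rewrite big1 ?mul1r; last by move=> *; rewrite !expr0 mulr1).
move=> [h ->]; split => //.
by rewrite big1 ?mul1r// => j _; rewrite /= ?mul1r expr0 invr1.
Qed.

Lemma cint_row1 a : cintegrable rm (fun r => rowf r a * (row_density r)%:C) /\
  cint rm (fun r => rowf r a * (row_density r)%:C) = 0.
Proof.
have := cint_row_monom (delta a) (fun=> 0%N).
under eq_fun => r do (under eq_bigr do rewrite expr0 mulr1; rewrite prod_delta).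
move=> [h ->]; split => //.
by rewrite (bigD1 a)//= /delta eqxx !mul0r.
Qed.

Lemma cint_row1' a : cintegrable rm (fun r => conjc (rowf r a) * (row_density r)%:C) /\
  cint rm (fun r => conjc (rowf r a) * (row_density r)%:C) = 0.
Proof.
have := cint_row_monom (fun=> 0%N) (delta a).
under eq_fun => r do (under eq_bigr do rewrite expr0 mul1r; rewrite prod_delta).
move=> [h ->]; split => //.
by rewrite (bigD1 a)//= /delta eqxx !mul0r.
Qed.

Lemma cint_row2 a b :
  cintegrable rm (fun r => rowf r a * conjc (rowf r b) * (row_density r)%:C) /\
  cint rm (fun r => rowf r a * conjc (rowf r b) * (row_density r)%:C) =
  (a == b)%:R / N%:R * emass ^+ N.
Proof.
have := cint_row_monom (delta a) (delta b).
under eq_fun => r do rewrite big_split/= /delta !prod_delta.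
move=> [h ->]; split => //; congr (_ * _).
have [<-|ab] := eqVneq a b.
  rewrite (bigD1 a)//= /delta eqxx big1 ?mulr1 => [|j ja]; first by rewrite eqxx /= mul1r.
  by rewrite (negPf ja) /= ?mul1r expr0 invr1.
by rewrite (bigD1 a)//= /delta eqxx (negPf ab) !mul0r.
Qed.

(** Of the four terms of the product the two linear ones have mean zero, and the covariance of
    entries [a] and [b] is [(a == b)%:R / N%:R]. *)
Lemma cint_row_quad u v alpha beta a b :
  let f (r : N.-tuple (plane R)) :=
    (u + alpha * rowf r a) * (v + beta * conjc (rowf r b)) * (row_density r)%:C in
  cintegrable rm f /\
  cint rm f = (u * v + (a == b)%:R * (alpha * beta) / N%:R) * emass ^+ N.
Proof.
move=> f.
have [i0 e0] := cint_row0; have [i1 e1] := cint_row1 a.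
have [i1' e1'] := cint_row1' b; have [i2 e2] := cint_row2 a b.
have fE : f = (fun r => u * v * (row_density r)%:C +
    (alpha * v * (rowf r a * (row_density r)%:C) +
    (u * beta * (conjc (rowf r b) * (row_density r)%:C) +
    alpha * beta * (rowf r a * conjc (rowf r b) * (row_density r)%:C)))).
  by apply/funext => r; rewrite /f; ring.
have j0 := cintegrableZ (u * v) i0; have j1 := cintegrableZ (alpha * v) i1.
have j1' := cintegrableZ (u * beta) i1'; have j2 := cintegrableZ (alpha * beta) i2.
rewrite fE; split.
  by apply: cintegrableD => //; apply: cintegrableD => //; exact: cintegrableD.
rewrite cintD//; last by apply: cintegrableD => //; exact: cintegrableD.
rewrite cintD//; last exact: cintegrableD.
rewrite cintD// !cintZ// e0 e1 e1' e2.
by rewrite !mulr0 !add0r mulrDl [_%:R * (alpha * beta)]mulrC !mulrA.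
Qed.

Section weights.
Variables w1 w2 : 'I_N -> C.

Definition xw (a : 'I_N) : C := w1 a * conjc (w2 a) / N%:R.

Lemma cint_row_step (k : 'I_N) c d b b' :
  let f (r : N.-tuple (plane R)) :=
    row_step w1 k (rowf r) c b * conjc (row_step w2 k (rowf r) d b') *
      (row_density r)%:C in
  cintegrable rm f /\
  cint rm f = (c b * conjc (d b') +
    ((b == b') && (k < b)%N)%:R * (c k * conjc (d k) * xw b)) * emass ^+ N.
Proof.
move=> f.
have [] := cint_row_quad (c b) (conjc (d b'))
  (if (k < b)%N then c k * w1 b else 0)
  (if (k < b')%N then conjc (d k) * conjc (w2 b') else 0) b b'.
set g := (X in cintegrable _ X).
have gf : g = f.
  apply/funext => r; rewrite /g /f /row_step rmorphD/=.
  case: ifP => _; case: ifP => _; rewrite ?rmorphM ?rmorphM ?rmorph0 /=; ring.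
move=> fi fe; rewrite -gf; split => //; apply: etrans fe _; congr ((_ + _) * _).
have [<-|_] := eqVneq b b'; last by rewrite !mul0r.
case: ifP => _; last by rewrite !(mul0r, mulr0).
by rewrite /xw; ring.
Qed.

Definition rows_density m (g : m.-tuple (N.-tuple (plane R))) : R :=
  \prod_(i < m) row_density (tnth g i).

Definition rows m (g : m.-tuple (N.-tuple (plane R))) : seq ('I_N -> C) :=
  [seq rowf r | r <- g].

Lemma rows_density_cons m (p : N.-tuple (plane R) * m.-tuple (N.-tuple (plane R))) :
  rows_density (tuple_cons p) = row_density p.1 * rows_density p.2.
Proof.
rewrite /rows_density big_ord_recl tnth_tuple_cons0; congr *%R.
by apply: eq_bigr => i _; rewrite tnth_tuple_consS.
Qed.

Lemma rows_cons m (p : N.-tuple (plane R) * m.-tuple (N.-tuple (plane R))) :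
  rows (tuple_cons p) = rowf p.1 :: rows p.2.
Proof. by []. Qed.

(** Induction on the number [m] of rows left. The next row is independent of the others, so by
    [cpair_bilinear] the mean factorizes; it keeps the product of the starting vectors and adds
    [c k * conjc (d k) * xw b] at every later diagonal position [b]. Summing with the inductive
    weights is [kap_step]. *)
Lemma cint_cpair m k c d : (k + m = N)%N ->
  let f (g : m.-tuple (N.-tuple (plane R))) :=
    cpair w1 w2 k (rows g) c d * (rows_density g)%:C in
  cintegrable (tuple_measure rm m) f /\
  cint (tuple_measure rm m) f =
  (\sum_a c a * conjc (d a) * kap xw k a) * (emass ^+ N) ^+ m.
Proof.
elim: m k c d => [|m IH] k c d km f.
  rewrite addn0 in km; subst k.
  have fE : f = (fun=> \sum_a c a * conjc (d a)).
    apply/funext => g; rewrite /f /rows_density big_ord0 mulr1 /rows.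
    by rewrite tuple0.
  have [|] := @cint_tuple_prod _ _ R rm 0 (fun _ _ => 1); first by case.
  under eq_fun do rewrite big_ord0.
  rewrite big_ord0 => h1 h2.
  have -> : f = (fun g => (\sum_a c a * conjc (d a)) * 1).
    by rewrite fE; apply/funext => g; rewrite mulr1.
  split; first exact: cintegrableZ.
  rewrite cintZ// h2 expr0; congr (_ * _); apply: eq_bigr => a _.
  by rewrite /kap ltn_ord mulr1.
have kN : (k < N)%N by rewrite -km addnS ltnS leq_addr.
pose k' : 'I_N := Ordinal kN.
have ik : inord k = k' by apply: val_inj; rewrite /= inordK.
have km' : (k.+1 + m = N)%N by rewrite addSnnS.
pose e (b a : 'I_N) : C := (a == b)%:R.
have fE p : f (tuple_cons p) = \sum_b \sum_b'
    (row_step w1 k' (rowf p.1) c b * conjc (row_step w2 k' (rowf p.1) d b') *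
      (row_density p.1)%:C) *
    (cpair w1 w2 k.+1 (rows p.2) (e b) (e b') * (rows_density p.2)%:C).
  rewrite /f rows_density_cons rows_cons.
  rewrite [X in X * _](_ : _ = cpair w1 w2 k.+1 (rows p.2)
    (row_step w1 k' (rowf p.1) c) (row_step w2 k' (rowf p.1) d)); last first.
    by rewrite /cpair /= ik.
  rewrite cpair_bilinear mulr_suml; apply: eq_bigr => b _.
  by rewrite mulr_suml; apply: eq_bigr => b' _; rewrite rmorphM /e; ring.
have ri b b' := (cint_row_step k' c d b b').1.
have re b b' := (cint_row_step k' c d b b').2.
have ii b b' := (IH k.+1 (e b) (e b') km').1.
have ie b b' := (IH k.+1 (e b) (e b') km').2.
have pri b b' := cintegrable_prod (ri b b') (ii b b').
have pre b b' := cint_prod (ri b b') (ii b b').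
have fi : cintegrable (rm \x tuple_measure rm m)%E (fun p => f (tuple_cons p)).
  under eq_fun do rewrite fE.
  by apply: cintegrable_sum => b _; apply: cintegrable_sum => b' _; exact: pri.
have [ti te] := cint_tupleS' fi.
split => //; rewrite te.
under eq_fun do rewrite fE.
rewrite cint_sum; last by move=> b _; apply: cintegrable_sum => b' _; exact: pri.
(* Pairs with [b' != b] drop out: by induction the remaining rows pair the unit vectors [e b] and
   [e b'] to 0. *)
have sumE b : cint (rm \x tuple_measure rm m)%E (fun p => \sum_b'
    (row_step w1 k' (rowf p.1) c b * conjc (row_step w2 k' (rowf p.1) d b') *
      (row_density p.1)%:C) *
    (cpair w1 w2 k.+1 (rows p.2) (e b) (e b') * (rows_density p.2)%:C)) =
   (c b * conjc (d b) + (k' < b)%N%:R * (c k' * conjc (d k') * xw b)) *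
     kap xw k.+1 b * (emass ^+ N) ^+ m.+1.
  rewrite cint_sum; last by move=> b' _; exact: pri.
  under eq_bigr => b' _ do rewrite pre re ie.
  rewrite (bigD1 b)//= [X in _ + X]big1 => [|b' b'b]; last first.
    rewrite [X in _ * (X * _)]big1 ?mul0r ?mulr0// => a _.
    rewrite /e; have [->|_] := eqVneq a b; last by rewrite !mul0r.
    by rewrite eq_sym (negPf b'b) conjc0 mulr0 mul0r.
  rewrite (bigD1 b)//= [X in _ * ((_ + X) * _)]big1 => [|a ab]; last first.
    by rewrite /e (negPf ab) !mul0r.
  by rewrite /e !eqxx conjc1 /= !mul1r !addr0 mulrACA -exprS.
under eq_bigr => b _ do rewrite sumE.
rewrite -mulr_suml; congr (_ * _).
under eq_bigr => b _ do rewrite mulrDl.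
rewrite big_split/=.
have -> : \sum_(b < N) (k' < b)%N%:R * (c k' * conjc (d k') * xw b) * kap xw k.+1 b =
    c k' * conjc (d k') * \sum_(b < N | (k' < b)%N) xw b * kap xw k.+1 b.
  rewrite mulr_sumr [RHS]big_mkcond/=; apply: eq_bigr => b _.
  by case: ifP => _; rewrite ?(mul0r, mul1r)// !mulrA.
(* The feedback from row [k] raises the weight of entry [k] from 1 to [kap xw k k]; the other
   entries keep theirs. *)
have := kap_step xw k'; rewrite (_ : nat_of_ord k' = k)// => /(canRL (addrK _)) ->.
rewrite (bigD1 k')//= [RHS](bigD1 k')//= mulrBr mulr1.
have -> : kap xw k.+1 k' = 1 by rewrite /kap /= ltnSn.
rewrite mulr1 addrAC [X in X + _]addrC subrK; congr (_ + _).
apply: eq_bigr => a ak; rewrite /kap ltnS.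
rewrite leq_eqVlt [X in X || _](_ : _ = false)//.
by apply/negP => /eqP ak'; move: ak; rewrite -val_eqE /= ak' eqxx.
Qed.

End weights.
End gaussian_rows.

Section conjugation.
Context {R : realType}.
Implicit Types z w : R[i].
Lemma conjcM z w : conjc (z * w) = conjc z * conjc w.
Proof. exact: rmorphM. Qed.
Lemma conjcD z w : conjc (z + w) = conjc z + conjc w.
Proof. exact: rmorphD. Qed.
Lemma conjcN z : conjc (- z) = - conjc z.
Proof. exact: rmorphN. Qed.
Lemma conjcB z w : conjc (z - w) = conjc z - conjc w.
Proof. exact: rmorphB. Qed.
Lemma conjcX z k : conjc (z ^+ k) = conjc z ^+ k.
Proof. exact: rmorphXn. Qed.
Lemma real_complexM (x y : R) : (x * y)%:C = x%:C * y%:C.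
Proof. exact: rmorphM. Qed.
End conjugation.

(** * The mean overlap for a fixed spectrum, and a crude bound *)

Section overlap_given_spectrum.
Context {R : realType} (n : nat).
Local Notation N := n.+2.
Local Notation C := R[i].
Local Notation pm := (@plane_measure R).
Local Notation rm := (tuple_measure pm N).
Variable lam : 'I_N -> C.

Definition wt (s a : 'I_N) : C := (lam s - lam a)^-1.

Definition ov (rs : seq ('I_N -> C)) : C :=
  - conjc (leftvec lam rs 0 1) * \sum_a leftvec lam rs 0 a * conjc (leftvec lam rs 1 a).

Lemma leftvec01 rs : size rs = N ->
  leftvec lam rs 0 1 = nth (fun _ => 0) rs 0 1 * wt 0 1.
Proof.
move=> rsN; rewrite leftvecE//= add0r (bigD1 0)//= big1 ?addr0.
  by rewrite leftvec1// mul1r.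
move=> j /andP[j1 j0]; case/eqP: j0; apply: val_inj => /=.
by move: (j1 : (j < 1)%N); case: (nat_of_ord j).
Qed.

(** Row 0 is treated apart because the prefactor [conjc (leftvec 0 1)] also depends on it, through
    its entry 1 only. Its mean selects the entry 1 of the first vector, so the remaining rows see
    the pair ([e 1], [e 1]), whose weight from row 1 on is the product over [1 < b]. *)
Lemma cint_ov :
  let f (g : N.-tuple (N.-tuple (plane R))) := ov (rows g) * (rows_density g)%:C in
  cintegrable (tuple_measure rm N) f /\
  cint (tuple_measure rm N) f =
    - (wt 0 1 * conjc (wt 0 1) / N%:R) *
    (\prod_(b < N | (1 < b)%N) (1 + xw (wt 0) (wt 1) b)) * (emass n ^+ N) ^+ N.
Proof.
move=> f.
pose e (b a : 'I_N) : C := (a == b)%:R.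
(* Everything that involves row 0: the coordinate [b] of the first vector after its step, times the
   prefactor. The second vector [e 1] has entry 0 at position 0 and is unchanged by this step. *)
pose c1 (r : N.-tuple (plane R)) (b : 'I_N) : C :=
  ((b == 0)%:R + (if (0 < b)%N then wt 0 b else 0) * rowf r b) *
  (0 + - conjc (wt 0 1) * conjc (rowf r 1)) * (row_density r)%:C.
have fE p : f (tuple_cons p) = \sum_b
   c1 p.1 b * (cpair (wt 0) (wt 1) 1 (rows p.2) (e b) (e 1) * (rows_density p.2)%:C).
  rewrite /f rows_density_cons /ov.
  rewrite leftvec01; last by rewrite size_map size_tuple.
  rewrite rows_cons /=.
  rewrite [X in _ * X * _](_ : _ = cpair (wt 0) (wt 1) 1 (rows p.2)
    (row_step (wt 0) 0 (rowf p.1) (e 0)) (e 1)); last first.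
    rewrite /cpair; apply: eq_bigr => a _.
    rewrite /leftvec /=.
    have -> : inord 0 = 0 :> 'I_N by apply: val_inj; rewrite /= inordK.
    congr (_ * conjc (proc _ _ _ _ _)); apply/funext => b.
    rewrite /row_step; case: ifP => _; last by rewrite addr0.
    by rewrite !mul0r addr0.
  rewrite cpair_bilinear mulr_sumr mulr_suml; apply: eq_bigr => b _.
  rewrite (bigD1 1)//= big1 ?addr0; last first.
    by move=> b' b'1; rewrite /e (negPf b'1) conjc0 mulr0 mul0r.
  have e1 k : e k k = 1 by rewrite /e eqxx.
  rewrite (_ : 1 -i* 0 = 1 :> C); last by rewrite oppr0.
  rewrite /c1 /row_step !e1 conjcM real_complexM /e.
  by case: ifP => _; ring.
have c1i (b : 'I_N) := (cint_row_quad ((b == 0)%:R) 0 (if (0 < b)%N then wt 0 b else 0)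
   (- conjc (wt 0 1)) b 1).1.
have c1e (b : 'I_N) := (cint_row_quad ((b == 0)%:R) 0 (if (0 < b)%N then wt 0 b else 0)
   (- conjc (wt 0 1)) b 1).2.
have N1 : (1 + n.+1 = N)%N by rewrite add1n.
have ii b := (cint_cpair (wt 0) (wt 1) (e b) (e 1) N1).1.
have ie b := (cint_cpair (wt 0) (wt 1) (e b) (e 1) N1).2.
have pri b := cintegrable_prod (c1i b) (ii b).
have pre b := cint_prod (c1i b) (ii b).
have fi : cintegrable (rm \x tuple_measure rm n.+1)%E (fun p => f (tuple_cons p)).
  under eq_fun do rewrite fE.
  by apply: cintegrable_sum => b _; exact: pri.
have [ti te] := cint_tupleS' fi.
split => //; rewrite te.
under eq_fun do rewrite fE.
rewrite cint_sum; last by move=> b _; exact: pri.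
under eq_bigr => b _ do rewrite pre c1e ie.
(* The covariance of entry [b] with the conjugate entry 1 leaves only [b = 1]. *)
rewrite (bigD1 1)//= [X in _ + X]big1 => [|b b1]; last first.
  by rewrite (negPf b1) !(mul0r, mulr0, addr0).
rewrite (bigD1 1)//= [X in _ * ((_ + X) * _)]big1 => [|a a1]; last first.
  by rewrite /e (negPf a1) !mul0r.
rewrite /e !eqxx (_ : 1 -i* 0 = 1 :> C); last by rewrite oppr0.
rewrite mulr0 add0r !mul1r !addr0 mulrACA -exprS.
rewrite /kap ltnn /=; congr (_ * _ * _).
by rewrite mulrN mulNr.
Qed.

Lemma sum_le_prod (I : finType) (P : pred I) (t : I -> R) :
  (forall i, 0 <= t i) -> 1 + \sum_(i | P i) t i <= \prod_(i | P i) (1 + t i).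
Proof.
move=> t0; have : 1 + \sum_(i | P i) t i <= \prod_(i | P i) (1 + t i) /\
    1 <= \prod_(i | P i) (1 + t i).
  apply: (big_ind2 (fun s p => 1 + s <= p /\ 1 <= p)); first by rewrite addr0.
    move=> s1 p1 s2 p2 [h1 h1'] [h2 h2']; split; nra.
  by move=> i _; split => //; rewrite lerDl.
by case.
Qed.

(** A product that dominates all column sums of moduli; being multiplicative over the entries, its
    powers are integrable against the Gaussian density entry by entry. *)
Definition GG (g : N.-tuple (N.-tuple (plane R))) : R :=
  \prod_i \prod_j (1 + normc (rowf (tnth g i) j)).

Lemma ge1_prod (I : finType) (P : pred I) (t : I -> R) :
  (forall i, 1 <= t i) -> 1 <= \prod_(i | P i) t i.
Proof.
move=> t1; elim/big_ind : _ => // x y x1 y1.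
by rewrite -[1]mulr1 ler_pM.
Qed.

Lemma GG_ge1 g : 1 <= GG g.
Proof. by do 2 (apply: ge1_prod => ?); rewrite lerDl normc_ge0. Qed.

Lemma GG_col g (a : 'I_N) (P : pred 'I_N) :
  1 + \sum_(j | P j) normc (rowf (tnth g j) a) <= GG g.
Proof.
apply: le_trans (sum_le_prod _ (fun j => normc_ge0 _)) _.
rewrite /GG [leRHS](bigID P)/= -[X in X <= _]mulr1; apply: ler_pM => //.
- by apply: prodr_ge0 => i _; rewrite addr_ge0// normc_ge0.
- apply: ler_prod => i _; rewrite addr_ge0 ?normc_ge0//= [leRHS](bigD1 a)//=.
  rewrite ler_peMr ?addr_ge0 ?sqrtr_ge0//.
  by apply: ge1_prod => j; rewrite lerDl ?normc_ge0 ?sqrtr_ge0.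
- by do 2 (apply: ge1_prod => ?); rewrite lerDl sqrtr_ge0.
Qed.

(** The point of the bound is that every singular weight [wt s j] appears to the first power only:
    each recursion step contributes the factor [1 + normc (wt s a)] once. *)
Lemma leftvec_bound s a g :
  normc (leftvec lam (rows g) s a) <= \prod_j (1 + normc (wt s j)) * GG g ^+ N.
Proof.
set G := GG g; have G1 : 1 <= G by exact: GG_ge1.
have w1 j : 1 <= 1 + normc (wt s j) by rewrite lerDl normc_ge0.
(* Restricting the product and the power of [G] to indices up to [a] makes the induction on [a]
   close. *)
suff H : normc (leftvec lam (rows g) s a) <=
    \prod_(j < N | (j <= a)%N) (1 + normc (wt s j)) * G ^+ a.+1.
  apply: (le_trans H); apply: ler_pM.
  - by apply: prodr_ge0 => j _; rewrite (le_trans ler01).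
  - by rewrite exprn_ge0// (le_trans ler01).
  - rewrite [leRHS](bigID (fun j : 'I_N => (j <= a)%N))/= ler_peMr//.
      by apply: prodr_ge0 => j _; rewrite (le_trans ler01).
    exact: ge1_prod.
  - by apply: ler_weXn2l.
have [m] := ubnP (a : nat); elim: m a => // m IH a; rewrite ltnS => am.
rewrite leftvecE ?size_map ?size_tuple//.
apply: (le_trans (le_normcD _ _)).
set P := \prod_(j < N | (j < a)%N) (1 + normc (wt s j)).
have P1 : 1 <= P by exact: ge1_prod.
have Ga1 : 1 <= G ^+ a by rewrite exprn_ege1.
have -> : \prod_(j < N | (j <= a)%N) (1 + normc (wt s j)) = (1 + normc (wt s a)) * P.
  rewrite (bigD1 a)//=; congr (_ * _); apply: eq_bigl => j.
  by rewrite ltn_neqAle andbC -val_eqE.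
apply: (@le_trans _ _ (1 + P * G ^+ a * (G - 1) * normc (wt s a))).
  apply: lerD.
    by case: (a == s); rewrite ?normc1 ?normc0.
  apply: (le_trans (le_normc_sum _ _ _)).
  apply: (@le_trans _ _ (\sum_(j < N | (j < a)%N)
    P * G ^+ a * normc (rowf (tnth g j) a) * normc (wt s a))).
    apply: ler_sum => j ja; rewrite !normcM -/(wt s a).
    rewrite (nth_map [tuple of nseq N point]) ?size_tuple// -tnth_nth.
    rewrite ler_wpM2r ?normc_ge0// ler_wpM2r ?normc_ge0//.
    apply: (le_trans (IH _ (leq_trans ja am))).
    apply: ler_pM.
    - by apply: prodr_ge0 => k _; rewrite (le_trans ler01).
    - by rewrite exprn_ge0// (le_trans ler01).
    - rewrite /P [leRHS](bigID (fun k : 'I_N => (k <= j)%N))/=.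
      rewrite (eq_bigl (fun k : 'I_N => (k < a)%N && (k <= j)%N)) => [|k]; last first.
        by case: (leqP k j) => kj; rewrite ?andbF// (leq_ltn_trans kj ja).
      rewrite ler_peMr//; last exact: ge1_prod.
      by apply: prodr_ge0 => k _; rewrite (le_trans ler01).
    - by apply: ler_weXn2l.
  rewrite -mulr_suml -mulr_sumr ler_wpM2r ?normc_ge0// ler_wpM2l//.
    by rewrite mulr_ge0// (le_trans ler01).
  by rewrite lerBrDl; exact: GG_col.
have w0 := normc_ge0 (wt s a).
rewrite exprS; set u := normc (wt s a) in w0 *; set Ga := G ^+ a in Ga1 *.
have PG : 1 <= P * Ga by rewrite -[1]mulr1 ler_pM.
rewrite [leRHS](_ : _ = (1 + u) * G * (P * Ga)); last by ring.
set q := P * Ga in PG *.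
have q0 : 0 <= q by exact: le_trans ler01 PG.
have h1 : 0 <= q * (G - 1) by rewrite mulr_ge0// subr_ge0.
have h2 : 0 <= q * u by rewrite mulr_ge0.
rewrite -subr_ge0 [X in 0 <= X](_ : _ = (q - 1) + q * (G - 1) + q * u); last by ring.
by rewrite addr_ge0// addr_ge0// subr_ge0.
Qed.

End overlap_given_spectrum.

(* Keeps [/=] from unfolding a norm into a square root. *)
#[local] Arguments normc : simpl never.
#[local] Arguments conjc : simpl never.

(** * Integrability and reduction to an integral over the eigenvalues *)

Section joint.
Context {R : realType} (n : nat) (z1 z2 : R[i]).
Hypothesis z12 : z1 != z2.
Local Notation N := n.+2.
Local Notation C := R[i].
Local Notation pm := (@plane_measure R).
Local Notation rm := (tuple_measure pm N).
Local Notation lam := (spectrum z1 z2).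
Local Notation eig := (eigenvalue_density z1 z2).
Implicit Types (l : n.-tuple (plane R)) (g : N.-tuple (N.-tuple (plane R))).

Lemma spectrum0 l : lam l 0 = z1. Proof. by []. Qed.
Lemma spectrum1 l : lam l 1 = z2. Proof. by []. Qed.
Lemma spectrumS l k : lam l (lift ord0 (lift ord0 k)) = cplx (tnth l k).
Proof.
rewrite /spectrum (tnth_nth 0) /= (nth_map point); last first.
  by rewrite size_tuple; exact: ltn_ord.
by rewrite -tnth_nth.
Qed.

Lemma big_spectrum (T : Type) (idx : T) (op : Monoid.law idx) (F : 'I_N -> T) :
  \big[op/idx]_(i < N) F i =
  op (F 0) (op (F 1) (\big[op/idx]_(k < n) F (lift ord0 (lift ord0 k)))).
Proof.
rewrite !big_ord_recl.
have -> : ord0 = 0 :> 'I_N by apply: val_inj.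
by have -> : lift ord0 ord0 = 1 :> 'I_N by apply: val_inj.
Qed.

Lemma eig_neq0_inj l : eig l != 0 -> injective (lam l).
Proof.
rewrite /eigenvalue_density mulf_eq0 negb_or => /andP[V0 W0].
have W k : z1 != cplx (tnth l k) /\ z2 != cplx (tnth l k).
  move/prodf_neq0 : W0 => /(_ k isT).
  rewrite mulf_eq0 mulf_eq0 !negb_or !sqrf_eq0 => /andP[/andP[]].
  by rewrite !normc_eq0 !subr_eq0.
have V (j k : 'I_n) : (j < k)%N -> cplx (tnth l j) != cplx (tnth l k).
  move=> jk; move/prodf_neq0 : V0 => /(_ j isT) /prodf_neq0 /(_ k jk).
  by rewrite sqrf_eq0 normc_eq0 subr_eq0.
have H (i j : 'I_N) : (i < j)%N -> lam l i != lam l j.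
  case: (unliftP ord0 j) => [j' ->|->//].
  case: (unliftP ord0 i) => [i' ->|-> _]; last first.
    rewrite (_ : lam l ord0 = z1)//.
    case: (unliftP ord0 j') => [k ->|->]; last by rewrite (_ : lam l _ = z2).
    by rewrite spectrumS; have [] := W k.
  rewrite !lift0 ltnS.
  case: (unliftP ord0 j') => [k ->|->//].
  case: (unliftP ord0 i') => [i0 ->|-> _]; last first.
    by rewrite spectrumS (_ : lam l _ = z2)//; have [] := W k.
  by rewrite !lift0 ltnS !spectrumS; exact: V.
move=> i j e; apply: val_inj => /=.
by case: (ltngtP i j) => // /H; rewrite e eqxx.
Qed.

Lemma nth_rows g (i j : 'I_N) :
  nth (fun _ => 0) (rows g) i j = cplx (tnth (tnth g i) j).
Proof.
by rewrite (nth_map [tuple of nseq N point]) ?size_tuple// -tnth_nth.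
Qed.

Lemma overlap12E l g : eig l != 0 -> overlap12 z1 z2 (l, g) = ov (lam l) (rows g).
Proof.
move=> el; apply: overlap_leftvec.
- by move=> i; rewrite mxE eqxx.
- move=> i j ji; rewrite mxE -val_eqE/= gtn_eqF//.
  by rewrite ltnNge (ltnW ji).
- exact: eig_neq0_inj.
- by rewrite size_map size_tuple.
- by move=> i j ij; rewrite nth_rows mxE -val_eqE/= ltn_eqF// ij.
Qed.

Definition jointF (x : n.-tuple (plane R) * N.-tuple (N.-tuple (plane R))) : C :=
  (eig x.1)%:C * (ov (lam x.1) (rows x.2) * (rows_density x.2)%:C).

(** If two eigenvalues coincide, the density vanishes and so do both sides; the identity holds
    everywhere, with no exceptional null set. *)
Lemma jointFE x : overlap12 z1 z2 x * (cond_density z1 z2 x)%:C = jointF x.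
Proof.
case: x => l g; rewrite /jointF /cond_density /= -/(rows_density g) real_complexM.
have [->|el] := eqVneq (eig l) 0; first by rewrite !(mul0r, mulr0).
by rewrite overlap12E//; ring.
Qed.

Lemma cmeas_spectrum i : cmeas (fun l => lam l i).
Proof.
case: (unliftP ord0 i) => [i' ->|->]; last exact: cmeas_cst.
case: (unliftP ord0 i') => [k ->|->]; last exact: cmeas_cst.
under eq_fun do rewrite spectrumS.
exact: (cmeas_tnth k (@cmeas_cplx R)).
Qed.

Lemma cmeas_entry i j : cmeas (fun g => cplx (tnth (tnth g i) j)).
Proof.
exact: (cmeas_tnth i (cmeas_tnth j (@cmeas_cplx R))).
Qed.

Lemma cmeasl (f : n.-tuple (plane R) -> C) : cmeas f ->
  cmeas (fun x : n.-tuple (plane R) * N.-tuple (N.-tuple (plane R)) => f x.1).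
Proof. exact: cmeas_fst. Qed.

Lemma cmeasr (f : N.-tuple (N.-tuple (plane R)) -> C) : cmeas f ->
  cmeas (fun x : n.-tuple (plane R) * N.-tuple (N.-tuple (plane R)) => f x.2).
Proof. exact: cmeas_snd. Qed.

Lemma cmeas_leftvec s a : cmeas (fun x : n.-tuple (plane R) * N.-tuple (N.-tuple (plane R)) =>
  leftvec (lam x.1) (rows x.2) s a).
Proof.
have [m] := ubnP (a : nat); elim: m a => // m IH a; rewrite ltnS => am.
under eq_fun do rewrite leftvecE ?size_map ?size_tuple//.
apply: cmeasD; first exact: cmeas_cst.
apply: cmeas_sum => j ja; apply: cmeasM; first apply: cmeasM.
- exact: IH (leq_trans ja am).
- under eq_fun do rewrite nth_rows.
  exact: (cmeasr (cmeas_entry j a)).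
- apply: cmeasV; apply: cmeasB; first exact: (cmeasl (cmeas_spectrum s)).
  exact: (cmeasl (cmeas_spectrum a)).
Qed.

Lemma real_complex_prod (I : Type) (s : seq I) (P : pred I) (F : I -> R) :
  (\prod_(i <- s | P i) F i)%:C = \prod_(i <- s | P i) (F i)%:C.
Proof. exact: rmorph_prod. Qed.

Lemma cmeas_normc2 d (T : measurableType d) (f : T -> C) :
  cmeas f -> cmeas (fun x => (normc (f x) ^+ 2)%:C).
Proof. by move=> mf; apply: cmeas_real; apply: measurable_funX; exact: measurable_normc. Qed.

Lemma cmeas_eig : cmeas (fun l => (eig l)%:C).
Proof.
have mt k : cmeas (fun l => cplx (tnth l k)) by exact: (cmeas_tnth k (@cmeas_cplx R)).
under eq_fun do rewrite real_complexM !real_complex_prod.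
apply: cmeasM.
  apply: cmeas_prod => j _; under eq_fun do rewrite real_complex_prod.
  by apply: cmeas_prod => k _; exact: (cmeas_normc2 (cmeasB (mt j) (mt k))).
apply: cmeas_prod => k _; under eq_fun do rewrite real_complexM [X in X * _]real_complexM.
apply: cmeasM; first apply: cmeasM.
- exact: (cmeas_normc2 (cmeasB (cmeas_cst _ z1) (mt k))).
- exact: (cmeas_normc2 (cmeasB (cmeas_cst _ z2) (mt k))).
- apply: cmeas_real; exact: (measurableT_comp (measurable_gplane (Npos n)) (measurable_tnth k)).
Qed.

Lemma cmeas_rows_density : cmeas (fun g => (rows_density g)%:C).
Proof.
under eq_fun do rewrite real_complex_prod.
apply: cmeas_prod => i _; under eq_fun do rewrite real_complex_prod.
apply: cmeas_prod => j _.
have me : cmeas (fun w : plane R => (entry_density n w)%:C).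
  by apply: cmeas_real; apply: measurable_funM => //; exact: measurable_gplane (Npos n).
exact: (cmeas_tnth i (cmeas_tnth j me)).
Qed.

Lemma cmeas_jointF : cmeas jointF.
Proof.
apply: cmeasM; first exact: (cmeasl cmeas_eig).
apply: cmeasM; last exact: (cmeasr cmeas_rows_density).
apply: cmeasM; first by apply: cmeasN; apply: cmeas_conj; exact: cmeas_leftvec.
apply: cmeas_sum => a _; apply: cmeasM; first exact: cmeas_leftvec.
by apply: cmeas_conj; exact: cmeas_leftvec.
Qed.

Definition PP l : R := \prod_(k < n) (1 + normc (cplx (tnth l k))).
Definition gl l : R := \prod_(k < n) gplane N%:R (tnth l k).

Lemma PP_ge1 l : 1 <= PP l.
Proof. by apply: ge1_prod => k; rewrite lerDl normc_ge0. Qed.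

Lemma gl_ge0 l : 0 <= gl l.
Proof. by apply: prodr_ge0 => k _; exact: expR_ge0. Qed.

Lemma eig_bound l : 0 <= eig l <= PP l ^+ (4 * n) *
  \prod_(k < n) (normc (z1 - cplx (tnth l k)) ^+ 2 * normc (z2 - cplx (tnth l k)) ^+ 2) * gl l.
Proof.
have u1 (k : 'I_n) : 1 <= 1 + normc (cplx (tnth l k)) by rewrite lerDl normc_ge0.
have u0 (k : 'I_n) : 0 <= 1 + normc (cplx (tnth l k)) by rewrite (le_trans ler01).
have V0 : 0 <= \prod_(j < n) \prod_(k < n | (j < k)%N)
      normc (cplx (tnth l j) - cplx (tnth l k)) ^+ 2.
  by apply: prodr_ge0 => j _; apply: prodr_ge0 => k _; rewrite sqr_ge0.
have W0 : 0 <= \prod_(k < n) (normc (z1 - cplx (tnth l k)) ^+ 2 *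
    normc (z2 - cplx (tnth l k)) ^+ 2).
  by apply: prodr_ge0 => k _; rewrite mulr_ge0 ?sqr_ge0.
have -> : eig l = (\prod_(j < n) \prod_(k < n | (j < k)%N)
      normc (cplx (tnth l j) - cplx (tnth l k)) ^+ 2) *
  (\prod_(k < n) (normc (z1 - cplx (tnth l k)) ^+ 2 *
    normc (z2 - cplx (tnth l k)) ^+ 2) * gl l).
  by rewrite /gl -big_split.
rewrite mulr_ge0 ?mulr_ge0 ?gl_ge0//= -[leRHS]mulrA ler_wpM2r ?mulr_ge0 ?gl_ge0//.
(* Each difference is at most the product of the [1 + normc] of its two points, and the pairs
   [j < k] are extended to all pairs by factors at least 1. This produces [2 n + 2 n] powers of
   [PP l]. *)
apply: (@le_trans _ _ (\prod_(j < n) \prod_(k < n)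
   ((1 + normc (cplx (tnth l j))) ^+ 2 * (1 + normc (cplx (tnth l k))) ^+ 2))).
  apply: ler_prod => j _; rewrite prodr_ge0 ?andTb; last by move=> k _; exact: sqr_ge0.
  rewrite [leRHS](bigID (fun k : 'I_n => (j < k)%N)) -[leLHS]mulr1; apply: ler_pM => //.
  - by apply: prodr_ge0 => k _; exact: sqr_ge0.
  - apply: ler_prod => k _; rewrite sqr_ge0 andTb -exprMn lerXn2r ?nnegrE ?normc_ge0 ?mulr_ge0//.
    apply: (le_trans (le_normcD _ _)); rewrite normcN.
    have := normc_ge0 (cplx (tnth l j)); have := normc_ge0 (cplx (tnth l k)); nra.
  - by apply: ge1_prod => k; rewrite mulr_ege1// exprn_ege1.
under eq_bigr => j _ do rewrite big_split/= prodr_const card_ord prodrXl.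
rewrite big_split/= prodr_const card_ord -/(PP l).
under eq_bigr => j _ do rewrite -exprM.
by rewrite prodrXl -/(PP l) -exprM -exprD -mulnDl.
Qed.

Lemma wt_prod (s : 'I_N) (z : C) l : lam l s = z -> (s == 0) || (s == 1) ->
  \prod_j (1 + normc (wt (lam l) s j)) =
  (1 + normc (z1 - z2)^-1) * \prod_(k < n) (1 + normc (z - cplx (tnth l k))^-1).
Proof.
move=> sz s01; rewrite big_spectrum/= mulrA; congr (_ * _); last first.
  by apply: eq_bigr => k _; rewrite /wt spectrumS sz.
rewrite /wt; case/orP: s01 => /eqP ->.
  by rewrite spectrum0 spectrum1 subrr invr0 normc0 addr0 mul1r.
by rewrite spectrum0 spectrum1 subrr invr0 normc0 addr0 mulr1 normcV normcB -normcV.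
Qed.

(** The quadratic repulsion in the density absorbs the simple pole of an eigenvector weight. *)
Lemma inv_sq_bound (z w : C) : (1 + normc (z - w)^-1) * normc (z - w) ^+ 2 <=
  (1 + normc z) ^+ 2 * (1 + normc w) ^+ 2.
Proof.
set u := normc (z - w); have u0 : 0 <= u by exact: normc_ge0.
have uz : u <= normc z + normc w by rewrite (le_trans (le_normcD _ _))// normcN.
apply: (@le_trans _ _ ((1 + u) ^+ 2)).
  rewrite normcV -/u; have [->|un] := eqVneq u 0.
    by rewrite expr0n mulr0 sqr_ge0.
  have -> : (1 + u^-1) * u ^+ 2 = u ^+ 2 + u by field.
  nra.
rewrite -exprMn lerXn2r ?nnegrE ?addr_ge0 ?mulr_ge0 ?addr_ge0 ?normc_ge0//.
by have := normc_ge0 z; have := normc_ge0 w; nra.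
Qed.

Definition bigconst : R := normc (z1 - z2)^-1 * N%:R * (1 + normc (z1 - z2)^-1) ^+ 2 *
  ((1 + normc z1) ^+ 2 * (1 + normc z2) ^+ 2) ^+ n.

Lemma ov_bound l g : normc (ov (lam l) (rows g)) <=
  normc (z1 - z2)^-1 * N%:R * (\prod_j (1 + normc (wt (lam l) 0 j))) *
  (\prod_j (1 + normc (wt (lam l) 1 j))) * GG g ^+ (N + N).+1.
Proof.
rewrite /ov normcM normcN normc_conj leftvec01 ?size_map ?size_tuple//.
rewrite (nth_rows g 0 1) normcM.
have G0 : 0 <= GG g by rewrite (le_trans ler01)// GG_ge1.
have t01 : normc (cplx (tnth (tnth g 0) 1)) <= GG g.
  apply: le_trans (GG_col g 1 (fun j => j == 0)).
  by rewrite big_pred1_eq lerDr.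
set W0 := \prod_j _; set W1 := \prod_j _.
have S : normc (\sum_a leftvec (lam l) (rows g) 0 a *
      conjc (leftvec (lam l) (rows g) 1 a)) <= N%:R * (W0 * GG g ^+ N * (W1 * GG g ^+ N)).
  apply: (le_trans (le_normc_sum _ _ _)).
  apply: (@le_trans _ _ (\sum_(a < N) W0 * GG g ^+ N * (W1 * GG g ^+ N))); last first.
    by rewrite sumr_const card_ord mulr_natl.
  apply: ler_sum => a _; rewrite normcM normc_conj.
  by apply: ler_pM; rewrite ?normc_ge0 ?leftvec_bound.
rewrite /wt spectrum0 spectrum1.
apply: (@le_trans _ _ (GG g * normc (z1 - z2)^-1 * (N%:R * (W0 * GG g ^+ N * (W1 * GG g ^+ N))))).
  by apply: ler_pM; rewrite ?mulr_ge0 ?normc_ge0// ler_wpM2r ?normc_ge0.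
by rewrite [GG g ^+ (N + N).+1]exprS exprD le_eqVlt; apply/orP; left; apply/eqP; ring.
Qed.

(** Repulsion from [z1] cancels the poles of the left vector 0, repulsion from [z2] those of the
    left vector 1. The exponent [4 * n + 4] counts the Vandermonde factor and the two uses of
    [inv_sq_bound]; [(N + N).+1] counts two left vectors and one single entry. *)
Lemma jointF_bound x : normc (jointF x) <= bigconst *
  ((PP x.1 ^+ (4 * n + 4) * gl x.1) * (GG x.2 ^+ (N + N).+1 * rows_density x.2)).
Proof.
case: x => l g /=; rewrite /jointF /= normcM (normcM (ov _ _)) !normc_real.
have /andP[e0 eb] := eig_bound l.
have rd0 : 0 <= rows_density g.
  apply: prodr_ge0 => i _; apply: prodr_ge0 => j _.
  by rewrite mulr_ge0 ?expR_ge0// divr_ge0// pi_ge0.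
have G0 : 0 <= GG g ^+ (N + N).+1 by rewrite exprn_ge0// (le_trans ler01)// GG_ge1.
rewrite (ger0_norm e0) (ger0_norm rd0) mulrA.
rewrite [leRHS](_ : _ = bigconst * (PP l ^+ (4 * n + 4) * gl l) *
  GG g ^+ (N + N).+1 * rows_density g); last by ring.
rewrite ler_wpM2r//.
apply: (le_trans (ler_wpM2l e0 (ov_bound l g))).
rewrite [leLHS]mulrA ler_wpM2r//.
rewrite (@wt_prod 0 z1)// (@wt_prod 1 z2)//.
set W0 := \prod_(k < n) (1 + normc (z1 - _)^-1).
set W1 := \prod_(k < n) (1 + normc (z2 - _)^-1).
set a := normc (z1 - z2)^-1.
have a0 : 0 <= a by exact: normc_ge0.
have W00 : 0 <= W0 by apply: prodr_ge0 => k _; rewrite addr_ge0// normc_ge0.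
have W10 : 0 <= W1 by apply: prodr_ge0 => k _; rewrite addr_ge0// normc_ge0.
rewrite (_ : eig l * _ = a * N%:R * (1 + a) ^+ 2 * (eig l * (W0 * W1))); last by ring.
rewrite /bigconst -/a -[leRHS]mulrA ler_wpM2l//.
  by rewrite !mulr_ge0// ?addr_ge0 ?exprn_ge0 ?addr_ge0.
apply: (le_trans (ler_wpM2r (mulr_ge0 W00 W10) eb)).
rewrite mulrAC [leRHS]mulrA ler_wpM2r ?gl_ge0// -mulrA exprD [leRHS]mulrCA.
rewrite ler_wpM2l ?exprn_ge0 ?(le_trans ler01) ?PP_ge1//.
have Acst (A : R) : A ^+ n = \prod_(k < n) A by rewrite prodr_const card_ord.
rewrite -prodrXl Acst -!big_split/=.
apply: ler_prod => k _.
set u := cplx (tnth l k).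
rewrite !mulr_ge0 ?addr_ge0 ?normc_ge0//=.
have h1 := inv_sq_bound z1 u; have h2 := inv_sq_bound z2 u.
rewrite [leLHS](_ : _ = ((1 + normc (z1 - u)^-1) * normc (z1 - u) ^+ 2) *
  ((1 + normc (z2 - u)^-1) * normc (z2 - u) ^+ 2)); last by ring.
rewrite [leRHS](_ : _ = ((1 + normc z1) ^+ 2 * (1 + normc u) ^+ 2) *
  ((1 + normc z2) ^+ 2 * (1 + normc u) ^+ 2)); last by ring.
by apply: ler_pM; rewrite ?mulr_ge0 ?addr_ge0 ?normc_ge0 ?sqr_ge0.
Qed.

Lemma integrable_PPgl m :
  (tuple_measure pm n).-integrable setT (fun l => (PP l ^+ m * gl l)%:E).
Proof.
have := @integrable_tuple_prod _ _ R pm n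
  (fun _ w => (1 + normc (cplx w)) ^+ m * gplane N%:R w)
  (fun _ => integrable_pow1_gplane (Npos n) m).
by under eq_fun do rewrite big_split/= prodrXl.
Qed.

Lemma integrable_GGrd m :
  (tuple_measure rm N).-integrable setT (fun g => (GG g ^+ m * rows_density g)%:E).
Proof.
have ei : pm.-integrable setT
    (fun w => ((1 + normc (cplx w)) ^+ m * entry_density n w)%:E).
  rewrite (_ : (fun w => _) = (fun w => (N%:R / pi)%:E *
     ((1 + normc (cplx w)) ^+ m * gplane N%:R w)%:E)%E).
    by apply: integrableZl => //; exact: integrable_pow1_gplane (Npos n) m.
  by apply/funext => w; rewrite entry_densityE -EFinM mulrCA.
have ri := @integrable_tuple_prod _ _ R pm N _ (fun _ => ei).
have := @integrable_tuple_prod _ _ R rm N _ (fun _ => ri).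
rewrite (_ : (fun t => _) = (fun g => (GG g ^+ m * rows_density g)%:E))//.
apply/funext => g; congr EFin; rewrite /GG /rows_density -prodrXl -big_split/=.
by apply: eq_bigr => i _; rewrite -prodrXl -big_split.
Qed.

Lemma cintegrable_jointF : cintegrable (@cond_measure R n) jointF.
Proof.
have i := integrable_prod_fun (integrable_PPgl (4 * n + 4)) (integrable_GGrd (N + N).+1).
apply: (@cintegrable_le _ _ _ _ _ (fun x => bigconst *
  ((PP x.1 ^+ (4 * n + 4) * gl x.1) * (GG x.2 ^+ (N + N).+1 * rows_density x.2)))).
- exact: cmeas_jointF.
- by under eq_fun do rewrite EFinM; apply: integrableZl.
- exact: jointF_bound.
Qed.

Lemma cintegrable_eig : cintegrable (tuple_measure pm n) (fun l => (eig l)%:C).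
Proof.
apply: (@cintegrable_le _ _ _ _ _ (fun l => ((1 + normc z1) ^+ 2 * (1 + normc z2) ^+ 2) ^+ n *
  (PP l ^+ (4 * n + 4) * gl l))).
- exact: cmeas_eig.
- by under eq_fun do rewrite EFinM; apply: integrableZl => //; exact: integrable_PPgl.
move=> l; have /andP[e0 eb] := eig_bound l.
rewrite normc_real ger0_norm// (le_trans eb)// [leRHS]mulrA ler_wpM2r ?gl_ge0//.
rewrite exprD [leRHS]mulrCA ler_wpM2l ?exprn_ge0 ?(le_trans ler01) ?PP_ge1//.
have Acst (A : R) : A ^+ n = \prod_(k < n) A by rewrite prodr_const card_ord.
rewrite -prodrXl Acst -!big_split/=.
apply: ler_prod => k _; set u := cplx (tnth l k).
rewrite !mulr_ge0 ?normc_ge0//=.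
have H z : normc (z - u) ^+ 2 <= (1 + normc z) ^+ 2 * (1 + normc u) ^+ 2.
  apply: le_trans (inv_sq_bound z u); rewrite ler_peMl ?sqr_ge0//.
  by rewrite lerDl normc_ge0.
rewrite [leRHS](_ : _ = ((1 + normc z1) ^+ 2 * (1 + normc u) ^+ 2) *
  ((1 + normc z2) ^+ 2 * (1 + normc u) ^+ 2)); last by ring.
by apply: ler_pM; rewrite ?sqr_ge0.
Qed.

Definition cond_weight l : C := - (wt (lam l) 0 1 * conjc (wt (lam l) 0 1) / N%:R) *
    (\prod_(b < N | (1 < b)%N) (1 + xw (wt (lam l) 0) (wt (lam l) 1) b)).

Lemma cond_weightE l : cond_weight l =
  - ((normc (z1 - z2) ^+ 2)%:C^-1 / N%:R) *
  \prod_(k < n) (1 + (z1 - cplx (tnth l k))^-1 * conjc (z2 - cplx (tnth l k))^-1 / N%:R).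
Proof.
rewrite /cond_weight; congr (- (_ / _) * _).
  rewrite /wt spectrum0 spectrum1 mul_conjc normcV exprVn.
  by rewrite (rmorphV (real_complex R)) ?unitfE ?expf_neq0 ?normc_eq0 ?subr_eq0//.
rewrite big_mkcond big_spectrum/= !mul1r; apply: eq_bigr => k _.
by rewrite /xw /wt spectrumS.
Qed.

(** Fubini with the Gaussian entries integrated first, for each fixed spectrum. *)
Lemma cint_jointF : cint (@cond_measure R n) jointF =
  cint (tuple_measure pm n) (fun l => (emass n ^+ N) ^+ N * ((eig l)%:C * cond_weight l)).
Proof.
rewrite cint_fubini; last 2 first.
- exact: cintegrable_jointF.
- by move=> l; exact: (cintegrableZ (eig l)%:C (cint_ov (lam l)).1).
apply: eq_cint => l.
rewrite (cintZ (eig l)%:C (cint_ov (lam l)).1) (cint_ov (lam l)).2 /cond_weight.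
by rewrite [RHS]mulrC -[RHS]mulrA.
Qed.

Lemma cint_rows_density : cintegrable (tuple_measure rm N) (fun g => (rows_density g)%:C) /\
  cint (tuple_measure rm N) (fun g => (rows_density g)%:C) = (emass n ^+ N) ^+ N.
Proof.
have [i e] := cint_row0 (R := R) n.
have [] := @cint_tuple_prod _ _ R rm N (fun _ r => (row_density r)%:C) (fun _ => i).
have -> : (fun t => \prod_(j < N) (row_density (tnth t j))%:C) =
    (fun g : N.-tuple (N.-tuple (plane R)) => (rows_density g)%:C).
  by apply/funext => g; rewrite /rows_density real_complex_prod.
by move=> ? ->; rewrite prodr_const card_ord e.
Qed.

Lemma cint_cond_density : (\int[@cond_measure R n]_x cond_density z1 z2 x)%:C =
  (emass n ^+ N) ^+ N * cint (tuple_measure pm n) (fun l => (eig l)%:C).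
Proof.
rewrite -cint_real.
have [i e] := cint_rows_density.
rewrite mulrC -e -(cint_prod cintegrable_eig i).
by apply: eq_cint => x; rewrite -real_complexM.
Qed.

Lemma overlap12_integrableP : overlap12_integrable n z1 z2.
Proof.
have [i1 i2] := cintegrable_jointF; split.
  rewrite (_ : (fun x => _) = (fun x => (complex.Re (jointF x))%:E))//.
  by apply/funext => x; rewrite -jointFE cReM /= mulr0 subr0.
rewrite (_ : (fun x => _) = (fun x => (complex.Im (jointF x))%:E))//.
by apply/funext => x; rewrite -jointFE cImM /= mulr0 add0r.
Qed.

Lemma cond_expectationE : cond_expectation_overlap12 n z1 z2 =
  cint (tuple_measure pm n) (fun l => (emass n ^+ N) ^+ N * ((eig l)%:C * cond_weight l)) /
  ((emass n ^+ N) ^+ N * cint (tuple_measure pm n) (fun l => (eig l)%:C)).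
Proof.
rewrite /cond_expectation_overlap12 cint_cond_density -cint_jointF; congr (_ / _).
apply: complex_eqP => /=; apply: eq_Rintegral => x _.
  by rewrite -jointFE cReM /= mulr0 subr0.
by rewrite -jointFE cImM /= mulr0 add0r.
Qed.

End joint.

(** * Eigenvalue averages as determinants of Gaussian moments *)

Section andreief.
Context d (T : measurableType d) (R : realType).
Variable mu : {sigma_finite_measure set T -> \bar R}.
Local Notation C := R[i].

(** Expand both determinants over permutations and integrate factor by factor. For each permutation
    of the first one, the sum over the second is the determinant of a row permutation of the moment
    matrix; the signs cancel, which gives [n!] equal terms. *)
Lemma andreief n (f g : 'I_n -> T -> C) (phi : T -> C) :
  (forall i j, cintegrable mu (fun w => f i w * g j w * phi w)) ->
  let F l := \det (\matrix_(k, i) f i (tnth l k)) *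
    \det (\matrix_(k, i) g i (tnth l k)) * \prod_k phi (tnth l k) in
  cintegrable (tuple_measure mu n) F /\
  cint (tuple_measure mu n) F = n`!%:R * \det (\matrix_(i, j) cint mu (fun w => f i w * g j w * phi w)).
Proof.
move=> fgi F; set M := (X in _ = _ * \det X).
have pint (s t : 'S_n) := @cint_tuple_prod _ _ R mu n
  (fun k w => f (s k) w * g (t k) w * phi w) (fun k => fgi (s k) (t k)).
have -> : F = (fun l => \sum_(s : 'S_n) \sum_(t : 'S_n)
    ((-1) ^+ s * (-1) ^+ t) *
    \prod_k (f (s k) (tnth l k) * g (t k) (tnth l k) * phi (tnth l k))).
  apply/funext => l; rewrite /F /determinant !mulr_suml; apply: eq_bigr => s _.
  rewrite mulr_sumr mulr_suml; apply: eq_bigr => t _.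
  rewrite !big_split/=.
  under eq_bigr do rewrite mxE.
  under [X in _ * (_ * X) * _]eq_bigr do rewrite mxE.
  by rewrite mulrACA -!mulrA.
split.
  apply: cintegrable_sum => s _; apply: cintegrable_sum => t _.
  by apply: cintegrableZ; exact: (pint s t).1.
rewrite cint_sum; last first.
  move=> s _; apply: cintegrable_sum => t _; apply: cintegrableZ; exact: (pint s t).1.
transitivity (\sum_(s : 'S_n) (-1) ^+ s * \det (row_perm s M)).
  apply: eq_bigr => s _; rewrite cint_sum; last first.
    by move=> t _; apply: cintegrableZ; exact: (pint s t).1.
  rewrite /determinant mulr_sumr; apply: eq_bigr => t _.
  rewrite cintZ; last exact: (pint s t).1.
  rewrite (pint s t).2 mulrA; congr (_ * _); apply: eq_bigr => k _.
  by rewrite !mxE.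
under eq_bigr => s _ do rewrite row_permE det_mulmx det_perm mulrA -signr_addb addbb mul1r.
by rewrite sumr_const card_Sn mulr_natl.
Qed.

End andreief.

Section gaussian_form.
Context {R : realType}.
Local Notation C := R[i].
Implicit Types p q : {poly C}.

(** The mean of p(W) q(conj W) for a standard complex Gaussian W, through orthogonality of
    monomials. It is bilinear: the conjugation sits in the argument of the second polynomial, not in
    its coefficients. *)
Definition gform p q : C := \sum_(i < size p) p`_i * q`_i * i`!%:R.

Lemma gformE m p q : (size p <= m)%N ->
  gform p q = \sum_(i < m) p`_i * q`_i * i`!%:R.
Proof.
move=> pm; rewrite /gform (big_ord_widen m (fun i => p`_i * q`_i * i`!%:R))//.
rewrite big_mkcond/=; apply: eq_bigr => i _; case: ltnP => // pi.
by rewrite nth_default// !mul0r.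
Qed.

Lemma gformC p q : gform p q = gform q p.
Proof.
rewrite (gformE _ (leq_maxl (size p) (size q))) (gformE _ (leq_maxr (size p) (size q))).
by apply: eq_bigr => i _; rewrite (mulrC p`_i).
Qed.

Lemma gformDl p1 p2 q : gform (p1 + p2) q = gform p1 q + gform p2 q.
Proof.
pose m := maxn (size p1) (size p2).
rewrite (gformE (m := m)) ?size_polyD// (gformE (m := m) (p := p1)) ?leq_maxl//.
rewrite (gformE (m := m) (p := p2)) ?leq_maxr// -big_split/=.
by apply: eq_bigr => i _; rewrite coefD !mulrDl.
Qed.

Lemma gformZl c p q : gform (c *: p) q = c * gform p q.
Proof.
rewrite (gformE (m := size p)) ?size_scale_leq// mulr_sumr.
by apply: eq_bigr => i _; rewrite coefZ -!mulrA.
Qed.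

Lemma gformDr p q1 q2 : gform p (q1 + q2) = gform p q1 + gform p q2.
Proof. by rewrite gformC gformDl gformC (gformC q2). Qed.
Lemma gformZr c p q : gform p (c *: q) = c * gform p q.
Proof. by rewrite gformC gformZl gformC. Qed.

(* Stein's identity: multiplication by the variable on one side is adjoint to
   differentiation on the other. *)
Lemma gform_mulX p q : gform p ('X * q) = gform p^`() q.
Proof.
pose m := maxn (size p) (size p^`()).
rewrite (gformE (m := m.+1)) ?(leq_trans (leq_maxl _ _) (leqnSn _))//.
rewrite (gformE (m := m) (p := p^`())) ?leq_maxr// big_ord_recl.
rewrite coefXM eqxx mulr0 mul0r add0r; apply: eq_bigr => i _.
rewrite lift0 coefXM/= coef_deriv factS natrM -mulr_natr; ring.
Qed.

Section moments.
Variable N : R.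
Hypothesis N0 : 0 < N.
Let r : C := (Num.sqrt N)%:C.

Lemma cint_gform p q :
  let f (w : plane R) := p.[r * cplx w] * q.[conjc (r * cplx w)] * (gplane N w)%:C in
  cintegrable (@plane_measure R) f /\
  cint (@plane_measure R) f = gform p q * moment N 0 0.
Proof.
move=> f.
have rr : conjc r = r by rewrite /r conjc_real.
have r2 : r * r = N%:C by rewrite /r -real_complexM -expr2 sqr_sqrtr// ltW.
have fE : f = (fun w => \sum_(i < size p) \sum_(j < size q) (p`_i * q`_j * r ^+ (i + j)) *
    (cplx w ^+ i * conjc (cplx w) ^+ j * (gplane N w)%:C)).
  apply/funext => w; rewrite /f !horner_coef !mulr_suml; apply: eq_bigr => i _.
  rewrite mulr_sumr mulr_suml; apply: eq_bigr => j _.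
  rewrite conjcM rr !exprMn exprD; ring.
have mi i j := cintegrable_moment N0 i j.
rewrite fE; split.
  by apply: cintegrable_sum => i _; apply: cintegrable_sum => j _; exact: cintegrableZ.
rewrite cint_sum; last by move=> i _; apply: cintegrable_sum => j _; exact: cintegrableZ.
rewrite /gform mulr_suml; apply: eq_bigr => i _.
rewrite cint_sum; last by move=> j _; exact: cintegrableZ.
under eq_bigr => j _ do rewrite cintZ// -/(moment N i j) (momentE N0).
have Nn : N%:C != 0 by apply/eqP => -[] /eqP; rewrite gt_eqF.
have cancel : r ^+ (i + i) * (i`!%:R / N%:C ^+ i) = i`!%:R.
  by rewrite exprD -exprMn r2 mulrCA mulfV ?mulr1// expf_neq0.
have [iq|qi] := ltnP i (size q); last first.
  rewrite [q`_i]nth_default// mulr0 !mul0r big1// => j _.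
  by rewrite (_ : (i == j :> nat) = false) ?mul0r ?mulr0// gtn_eqF// (leq_trans _ qi).
rewrite (bigD1 (Ordinal iq))//= eqxx mul1r big1 ?addr0; last first.
  move=> j ji; rewrite (_ : (i == j :> nat) = false) ?mul0r ?mulr0//.
  by apply: contraNF ji => /eqP ij; apply/eqP/val_inj.
by rewrite mulrA -(mulrA (p`_i * q`_i)) cancel.
Qed.

End moments.
End gaussian_form.

Section determinant_ratio.
Context {R : realType} (n : nat) (z1 z2 : R[i]).
Hypothesis z12 : z1 != z2.
Local Notation N := n.+2.
Local Notation C := R[i].
Local Notation pm := (@plane_measure R).
Local Notation eig := (eigenvalue_density z1 z2).
Let r : C := (Num.sqrt (N%:R : R))%:C.
Let x1 := r * z1.
Let x2 := r * z2.
Local Notation lin a := (a%:P - 'X).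

(** The pairing [gform] with the additional weight 1 + (a - W)(b - conj W). *)
Definition bform (a b : C) (p q : {poly C}) : C :=
  gform p q + gform (lin a * p) (lin b * q).

Definition numM : 'M[C]_n := \matrix_(i, j)
  bform x1 (conjc x2) (lin x2 * 'X^i) (lin (conjc x1) * 'X^j).

Definition denM : 'M[C]_n := \matrix_(i, j)
  gform (lin x1 * (lin x2 * 'X^i)) (lin (conjc x1) * (lin (conjc x2) * 'X^j)).

(** The powers of N that the squared Vandermonde product picks up when the eigenvalues are scaled by
    [r]. *)
Let vc : R := \prod_(j < n) \prod_(k < n | (j < k)%N) N%:R.

Let r2 : r * conjc r = N%:R.
Proof.
by rewrite mul_conjc normc_real ger0_norm ?sqrtr_ge0// sqr_sqrtr ?ler0n// rmorph_nat.
Qed.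

Let N0 : N%:R != 0 :> C. Proof. by rewrite pnatr_eq0. Qed.

Lemma vandermonde_sq (l : n.-tuple (plane R)) :
  (vc * \prod_(j < n) \prod_(k < n | (j < k)%N)
      normc (cplx (tnth l j) - cplx (tnth l k)) ^+ 2)%:C =
  \det (\matrix_(k < n, i < n) (r * cplx (tnth l k)) ^+ i) *
  \det (\matrix_(k < n, i < n) conjc (r * cplx (tnth l k)) ^+ i).
Proof.
have V (u : 'I_n -> C) : \det (\matrix_(k < n, i < n) u k ^+ i) =
    \prod_(i < n) \prod_(j < n | (i < j)%N) (u j - u i).
  have := det_Vandermonde (\row_k u k); rewrite -det_tr.
  rewrite (_ : (Vandermonde n _)^T = \matrix_(k, i) u k ^+ i) => [->|].
    by apply: eq_bigr => i _; apply: eq_bigr => j _; rewrite !mxE.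
  by apply/matrixP => i j; rewrite !mxE.
rewrite !V -!big_split/= real_complex_prod; apply: eq_bigr => j _.
rewrite -!big_split/= real_complex_prod; apply: eq_bigr => k _.
rewrite -conjcB -mulrBr conjcM mulrACA r2 mul_conjc real_complexM normcB.
by rewrite rmorph_nat.
Qed.

Lemma cint_moment_matrix (p q : {poly C}) :
  cint pm (fun w => p.[r * cplx w] * q.[conjc (r * cplx w)] * (gplane N%:R w)%:C) =
  gform p q * moment N%:R 0 0.
Proof. exact: (cint_gform (Npos n) p q).2. Qed.

Let horner_lin (a x : C) : (lin a).[x] = a - x.
Proof. by rewrite hornerD hornerN hornerC hornerX. Qed.

Definition den_weight (w : plane R) : C :=
  (normc (z1 - cplx w) ^+ 2 * normc (z2 - cplx w) ^+ 2)%:C * (gplane N%:R w)%:C.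

Definition num_weight (w : plane R) : C :=
  den_weight w * (1 + (z1 - cplx w)^-1 * conjc (z2 - cplx w)^-1 / N%:R).

Lemma den_entry i j :
  let f w := (r * cplx w) ^+ i * conjc (r * cplx w) ^+ j * den_weight w in
  cintegrable pm f /\
  cint pm f = N%:R ^- 2 * moment N%:R 0 0 *
    gform (lin x1 * (lin x2 * 'X^i)) (lin (conjc x1) * (lin (conjc x2) * 'X^j)).
Proof.
move=> f.
set p := lin x1 * _; set q := lin (conjc x1) * _.
have [] := cint_gform (Npos n) p q.
set g := (X in cintegrable _ X) => gi ge.
have fE : f = (fun w => N%:R ^- 2 * g w).
  apply/funext => w; rewrite /f /g /den_weight /p /q !hornerM !hornerXn !horner_lin.
  rewrite /x1 /x2 -!conjcB -!mulrBr !conjcM real_complexM -!mul_conjc.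
  rewrite -/r; set A := z1 - _; set B := z2 - _.
  transitivity (N%:R ^- 2 * (r * conjc r) ^+ 2 *
    ((r * cplx w) ^+ i * (conjc r * conjc (cplx w)) ^+ j *
     (A * conjc A * (B * conjc B) * (gplane N%:R w)%:C))).
    by rewrite r2 mulVf ?mul1r// expf_neq0.
  ring.
rewrite fE; split; first exact: cintegrableZ.
by rewrite cintZ// ge mulrAC -mulrA.
Qed.

(** The factors |z1 - w|^2 |z2 - w|^2 turn the rational weight into a polynomial: one linear factor
    of each kind survives unconditionally, and the other two enter through 1 + (x1 - W)(conj x2 -
    conj W), which is [bform]. *)
Lemma num_entry i j :
  let f w := (r * cplx w) ^+ i * conjc (r * cplx w) ^+ j * num_weight w in
  cintegrable pm f /\
  cint pm f = N%:R ^- 2 * moment N%:R 0 0 *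
    bform x1 (conjc x2) (lin x2 * 'X^i) (lin (conjc x1) * 'X^j).
Proof.
move=> f.
set p := lin x2 * _; set q := lin (conjc x1) * _.
have [] := cint_gform (Npos n) p q.
set g := (X in cintegrable _ X) => gi ge.
have [] := cint_gform (Npos n) (lin x1 * p) (lin (conjc x2) * q).
set h := (X in cintegrable _ X) => hi he.
have fE : f = (fun w => N%:R ^- 2 * (g w + h w)).
  apply/funext => w; rewrite /f /g /h /num_weight /den_weight /p /q.
  rewrite !hornerM !hornerXn !horner_lin.
  rewrite /x1 /x2 -!conjcB -!mulrBr !conjcM real_complexM -!mul_conjc.
  rewrite -/r; set A := z1 - _; set B := z2 - _.
  (* With [0^-1 = 0] the cleared form also holds where [A] or [B] vanishes, both sides being 0. *)
  have E : A * conjc A * (B * conjc B) * (1 + A^-1 * conjc B^-1 / N%:R) =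
     N%:R ^- 2 * (N%:R ^+ 2 * (A * conjc A * (B * conjc B)) + N%:R * (conjc A * B)).
    rewrite conjc_inv.
    have [->|A0] := eqVneq A 0; first by rewrite conjc0 !(mul0r, mulr0, addr0).
    have [->|B0] := eqVneq B 0; first by rewrite conjc0 !(mul0r, mulr0, addr0).
    have cB0 : conjc B != 0 by rewrite conjc_eq0.
    move: (N%:R : C) N0 (conjc A) (conjc B) cB0 => Nn Nn0 cA cB cB0.
    by field; rewrite Nn0 A0 cB0.
  transitivity (N%:R ^- 2 * (N%:R ^+ 2 * (A * conjc A * (B * conjc B)) + N%:R * (conjc A * B)) *
    ((r * cplx w) ^+ i * (conjc r * conjc (cplx w)) ^+ j * (gplane N%:R w)%:C)).
    by rewrite -E; ring.
  by rewrite -r2; ring.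
rewrite fE; split; first by apply: cintegrableZ; exact: cintegrableD.
rewrite cintZ; last exact: cintegrableD.
by rewrite cintD// ge he -mulrDl mulrAC -mulrA.
Qed.

(** The same instance of Andreief's identity ([andn]) is applied to the numerator and to the
    normalization, so factorials, scaling powers and Gaussian masses cancel. *)
Lemma cond_expectation_det : \det denM != 0 ->
  cond_expectation_overlap12 n z1 z2 =
  - ((N%:R * normc (z1 - z2) ^+ 2)%:C)^-1 * (\det numM / \det denM).
Proof.
move=> den0.
have vc0 : vc%:C != 0.
  apply/eqP => -[] /eqP; apply/negP/prodf_neq0 => j _; apply/prodf_neq0 => k _.
  by rewrite pnatr_eq0.
set m0 := N%:R ^- 2 * moment N%:R 0 0 : C.
have m00 : m0 != 0.
  have [e m1] := moment00 (Npos n : 0 < (N%:R : R)).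
  rewrite /m0 mulf_neq0 ?invr_neq0 ?expf_neq0// e.
  by apply/eqP => -[] /eqP; rewrite gt_eqF.
have andn (phi : plane R -> C) (M : 'M[C]_n)
    (h : forall i j : 'I_n,
     cintegrable pm (fun w => (r * cplx w) ^+ i * conjc (r * cplx w) ^+ j * phi w) /\
     cint pm (fun w => (r * cplx w) ^+ i * conjc (r * cplx w) ^+ j * phi w) =
     m0 * M i j) :
   let F l := \det (\matrix_(k < n, i < n) (r * cplx (tnth l k)) ^+ i) *
    \det (\matrix_(k < n, i < n) conjc (r * cplx (tnth l k)) ^+ i) *
    \prod_k phi (tnth l k) in
   cintegrable (tuple_measure pm n) F /\
   cint (tuple_measure pm n) F = n`!%:R * (m0 ^+ n * \det M).
  have [h1 h2] := @andreief _ _ R pm n (fun (i : 'I_n) w => (r * cplx w) ^+ i)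
    (fun (i : 'I_n) w => conjc (r * cplx w) ^+ i) phi (fun i j => (h i j).1).
  split; first exact: h1.
  apply: etrans h2 _; rewrite -detZ; congr (_ * \det _).
  by apply/matrixP => i j; rewrite !mxE (h i j).2.
have eigE l : vc%:C * (eig l)%:C =
    \det (\matrix_(k < n, i < n) (r * cplx (tnth l k)) ^+ i) *
    \det (\matrix_(k < n, i < n) conjc (r * cplx (tnth l k)) ^+ i) *
    \prod_k den_weight (tnth l k).
  rewrite -vandermonde_sq /eigenvalue_density -real_complexM mulrA real_complexM.
  by congr (_ * _); rewrite real_complex_prod; apply: eq_bigr => k _; rewrite /den_weight -real_complexM.
have denE : vc%:C * cint (tuple_measure pm n) (fun l => (eig l)%:C) =
    n`!%:R * (m0 ^+ n * \det denM).
  have [|_ <-] := andn den_weight denM.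
    by move=> i j; rewrite [denM i j]mxE; exact: den_entry.
  rewrite -(cintZ _ (@cintegrable_eig R n z1 z2)).
  by apply: eq_cint => l; exact: eigE.
set k0 := (emass n ^+ N) ^+ N : C.
have k00 : k0 != 0 by rewrite !expf_neq0// emass_neq0.
have ci : forall c, cint (tuple_measure pm n) (fun l => c * ((eig l)%:C * cond_weight z1 z2 l)) =
   c * (- ((normc (z1 - z2) ^+ 2)%:C^-1 / N%:R) * (vc%:C^-1 * (n`!%:R * (m0 ^+ n * \det numM)))).
  move=> c; have [|ni <-] := andn num_weight numM.
    by move=> i j; rewrite [numM i j]mxE; exact: num_entry.
  rewrite -!cintZ//; last exact: cintegrableZ.
  - apply: eq_cint => l; rewrite cond_weightE//; congr (c * _).
    have -> : \prod_k num_weight (tnth l k) = (\prod_k den_weight (tnth l k)) *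
       \prod_(k < n) (1 + (z1 - cplx (tnth l k))^-1 * conjc (z2 - cplx (tnth l k))^-1 / N%:R).
      by rewrite -big_split.
    by rewrite [\det _ * \det _ * (_ * _)]mulrA -eigE -(mulrA vc%:C) mulKf// mulrCA.
  - by do 2 apply: cintegrableZ.
rewrite cond_expectationE// ci.
have -> : cint (tuple_measure pm n) (fun l => (eig l)%:C) =
    vc%:C^-1 * (n`!%:R * (m0 ^+ n * \det denM)).
  by rewrite -denE mulKf.
have f0 : n`!%:R != 0 :> C by rewrite pnatr_eq0 -lt0n fact_gt0.
rewrite (real_complexM N%:R) rmorph_nat.
have d0 : (normc (z1 - z2) ^+ 2)%:C != 0.
  by apply/eqP => -[] /eqP; rewrite expf_eq0 normc_eq0 subr_eq0 (negPf z12).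
rewrite -/k0.
have mn0 : m0 ^+ n != 0 by rewrite expf_neq0.
move: (\det numM) (\det denM) den0 (m0 ^+ n) mn0 k0 k00 (vc%:C) vc0 => Dn Dd Dd0 m mn k1 k10 V V0.
move: (normc _ ^+ 2)%:C d0 (N%:R : C) N0 (n`!%:R : C) f0 => d d0 Nn Nn0 fn fn0.
by field; rewrite Dd0 d0 Nn0 V0 mn fn0 k10.
Qed.

End determinant_ratio.

(** * Christoffel's formula for moment determinants *)

Section bidiagonal.
Context {F : fieldType} (n : nat).
Implicit Types (w y : F).

(** Matrix of the multiplication by [w - 'X] from degree below [n] to degree at most [n], in the
    monomial basis. *)
Definition bidiag w : 'M[F]_(n, 1 + n) :=
  \matrix_(i, j) (w * (j == i :> nat)%:R - (j == i.+1 :> nat)%:R).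

Lemma bidiag_mul m w (A : 'M[F]_(1 + n, m)) (i : 'I_n) j :
  (bidiag w *m A) i j = w * A (widen_ord (leqnSn n) i) j - A (lift ord0 i) j.
Proof.
rewrite mxE; under eq_bigr => k _ do rewrite mxE mulrBl.
rewrite big_split/= sumrN; congr (_ - _).
  rewrite (bigD1 (widen_ord (leqnSn n) i))//= eqxx mulr1 big1 ?addr0// => k ki.
  rewrite (_ : (k == i :> nat) = false) ?mulr0 ?mul0r//.
  by apply: contraNF ki => /eqP ki; apply/eqP/val_inj.
rewrite (bigD1 (lift ord0 i))//= /bump /= add1n eqxx mul1r big1 ?addr0// => k ki.
rewrite (_ : (k == i.+1 :> nat) = false) ?mul0r//.
by apply: contraNF ki => /eqP ki; apply/eqP/val_inj; rewrite /= /bump add1n.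
Qed.

(** The vector of powers of [w] spans the kernel of [bidiag w]. Making it the first column of a
    unipotent column operation [U] leaves a block triangular matrix, whose corner is the value at
    [w] and whose rest has diagonal entries -1. *)
Lemma det_bidiag w (k : 'rV[F]_(1 + n)) :
  \det (col_mx k (bidiag w)) = (-1) ^+ n * \sum_i k 0 i * w ^+ i.
Proof.
pose U : 'M[F]_(1 + n) := \matrix_(i, j) if j == 0 then w ^+ i else (i == j)%:R.
have detU : \det U = 1.
  rewrite det_trig; last first.
    apply/is_trig_mxP => i j ij; rewrite mxE; case: eqP => [j0|_].
      by move: ij; rewrite j0.
    by rewrite -val_eqE ltn_eqF.
  by rewrite big1// => i _; rewrite mxE; case: eqP => [->|_]; rewrite ?expr0 ?eqxx.
have E : col_mx k (bidiag w) *m U =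
  block_mx (\sum_i k 0 i * w ^+ i)%:M (rsubmx (k *m U)) 0 (rsubmx (bidiag w *m U)).
  have l1 : lsubmx (k *m U) = (\sum_i k 0 i * w ^+ i)%:M.
    apply/matrixP => i j; rewrite !ord1 !mxE mulr1n; apply: eq_bigr => l _.
    by rewrite !mxE; case: eqP => // h; case: h; apply: val_inj.
  have l2 : lsubmx (bidiag w *m U) = 0.
    apply/matrixP => i j; rewrite ord1 mxE bidiag_mul !mxE.
    case: eqP => [_|h]; last by case: h; apply: val_inj.
    by rewrite /= /bump add1n exprS subrr.
  by rewrite /block_mx -l1 -l2 !hsubmxK mul_col_mx.
transitivity (\det (col_mx k (bidiag w) *m U)).
  by rewrite det_mulmx detU mulr1.
rewrite E det_ublock det_scalar1 mulrC; congr (_ * _).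
rewrite det_trig; last first.
  apply/is_trig_mxP => i j ij; rewrite mxE bidiag_mul !mxE.
  rewrite -!val_eqE/= /bump/= !add1n eqSS.
  by rewrite !ltn_eqF ?mulr0 ?subr0// ltnW.
rewrite (eq_bigr (fun _ => -1)) ?prodr_const ?card_ord// => i _.
rewrite mxE bidiag_mul !mxE -!val_eqE/= /bump/= !add1n eqSS eqxx ltn_eqF// mulr0.
by rewrite sub0r.
Qed.

(** Border the left factor with [k] and the right one with the first unit vector. Since [k *m M] is
    the vector of powers of [y], which [bidiag y] kills, the bordered product is block triangular
    with corner 1, while the determinants of its square factors are known from [det_bidiag]. *)
Lemma det_bidiag_kernel (M : 'M[F]_(1 + n)) w y (k : 'rV[F]_(1 + n)) :
  k *m M = \row_j y ^+ j ->
  \det (bidiag w *m M *m (bidiag y)^T) = \det M * \sum_i k 0 i * w ^+ i.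
Proof.
move=> kM.
pose e0 : 'rV[F]_(1 + n) := \row_j (j == 0)%:R.
have h : \det (col_mx k (bidiag w) *m M *m (col_mx e0 (bidiag y))^T) =
    \det (bidiag w *m M *m (bidiag y)^T).
  rewrite tr_col_mx mul_col_mx mul_col_row.
  have -> : k *m M *m (bidiag y)^T = 0.
    rewrite kM; apply: trmx_inj; rewrite trmx_mul trmxK trmx0.
    apply/matrixP => i j; rewrite bidiag_mul !mxE.
    by rewrite /= /bump add1n exprS subrr.
  have -> : k *m M *m e0^T = 1%:M.
    apply/matrixP => i j; rewrite kM !ord1 mxE (bigD1 ord0)//= !mxE eqxx mulr1 expr0.
    by rewrite big1 ?addr0// => l l0; rewrite !mxE (negPf l0) mulr0.
  by rewrite det_lblock det1 mul1r.
rewrite -h !det_mulmx det_tr !det_bidiag.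
have -> : \sum_i e0 0 i * y ^+ i = 1.
  rewrite (bigD1 ord0)//= mxE eqxx mul1r expr0 big1 ?addr0// => i i0.
  by rewrite mxE (negPf i0) mul0r.
set K := \sum_i _.
have sg : (-1) ^+ n * (-1) ^+ n = 1 :> F by rewrite -exprMn mulrNN mulr1 expr1n.
by rewrite mulr1 mulrAC [(-1) ^+ n * K * _]mulrAC sg mul1r mulrC.
Qed.

End bidiagonal.

Section christoffel.
Context {F : fieldType}.
Variable B : {poly F} -> {poly F} -> F.
Hypothesis BDl : forall p1 p2 q, B (p1 + p2) q = B p1 q + B p2 q.
Hypothesis BZl : forall c p q, B (c *: p) q = c * B p q.
Hypothesis BDr : forall p q1 q2, B p (q1 + q2) = B p q1 + B p q2.
Hypothesis BZr : forall c p q, B p (c *: q) = c * B p q.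
Local Notation lin a := (a%:P - 'X).

Lemma B_suml m (c : 'I_m -> F) (p : 'I_m -> {poly F}) q :
  B (\sum_i c i *: p i) q = \sum_i c i * B (p i) q.
Proof.
apply: (big_ind2 (fun p s => B p q = s)).
- by rewrite -(scale0r 0) BZl mul0r.
- by move=> p1 s1 p2 s2 <- <-; rewrite BDl.
- by move=> i _; rewrite BZl.
Qed.

(* Christoffel's formula: [k] represents evaluation at [y]. *)
Lemma christoffel n (k : {poly F}) w y :
  (size k <= n.+1)%N -> (forall j, (j <= n)%N -> B k 'X^j = y ^+ j) ->
  \det (\matrix_(i < n, j < n) B (lin w * 'X^i) (lin y * 'X^j)) =
  \det (\matrix_(i < n.+1, j < n.+1) B 'X^i 'X^j) * k.[w].
Proof.
move=> sk kB.
pose M : 'M[F]_(1 + n) := \matrix_(i, j) B 'X^i 'X^j.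
have kM : (\row_(i < 1 + n) k`_i) *m M = \row_j y ^+ j.
  apply/rowP => j; rewrite mxE [RHS]mxE -kB; last by rewrite -ltnS.
  have kE : k = \sum_(i < 1 + n) k`_i *: 'X^i.
    rewrite -poly_def; apply/polyP => i; rewrite coef_poly.
    by case: ltnP => // ni; rewrite nth_default// (leq_trans sk).
  by rewrite [in RHS]kE B_suml; apply: eq_bigr => i _; rewrite !mxE.
have linE (c : F) (i : nat) :
    lin c * 'X^i = c *: 'X^i + (-1) *: 'X^(i.+1).
  by rewrite mulrBl mul_polyC -exprS scaleN1r.
have := det_bidiag_kernel w kM.
rewrite (_ : bidiag n w *m M *m _ =
  \matrix_(i < n, j < n) B (lin w * 'X^i) (lin y * 'X^j)) => [->|].
  by rewrite (horner_coef_wide _ sk); congr (_ * _); apply: eq_bigr => i _; rewrite mxE.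
apply/matrixP => i j; transitivity ((bidiag n y *m (bidiag n w *m M)^T) j i).
  by rewrite -[in RHS](trmxK (bidiag n y)) -trmx_mul [RHS]mxE.
rewrite bidiag_mul [RHS]mxE.
have E (l : 'I_(1 + n)) : (bidiag n w *m M)^T l i =
   w * B 'X^i 'X^l - B 'X^(i.+1) 'X^l.
  by rewrite mxE bidiag_mul !mxE.
rewrite !E /= /bump leq0n add1n !linE !(BDl, BZl, BDr, BZr); ring.
Qed.

End christoffel.

(** * The normalizing determinant: cut-off exponentials *)

Section gram.
Context {R : realType}.
Local Notation C := R[i].
Local Notation lin a := (a%:P - 'X).
Implicit Types (a b w y t : C).

Definition ep m (s : C) : C := \sum_(i < m) s ^+ i / i`!%:R.

(** The reproducing kernel of [gform] on polynomials of degree below [m], at the point [y]. *)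
Definition expo m y : {poly C} := \poly_(i < m) (y ^+ i / i`!%:R).

Let fact_neq0 i : i`!%:R != 0 :> C.
Proof. by rewrite pnatr_eq0 -lt0n fact_gt0. Qed.

Lemma horner_expo m y x : (expo m y).[x] = ep m (x * y).
Proof.
by rewrite horner_poly; apply: eq_bigr => i _; rewrite exprMn mulrAC [y ^+ i * _]mulrC.
Qed.

Lemma gformXr (p : {poly C}) j : gform p 'X^j = p`_j * j`!%:R.
Proof.
have [jp|pj] := ltnP j (size p); last first.
  rewrite nth_default// mul0r /gform big1// => i _; rewrite coefXn.
  rewrite (_ : (i == j :> nat) = false) ?mulr0 ?mul0r//.
  by rewrite ltn_eqF// (leq_trans _ pj).
rewrite /gform (bigD1 (Ordinal jp))//= coefXn eqxx mulr1 big1 ?addr0// => i ij.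
rewrite coefXn (_ : (i == j :> nat) = false) ?mulr0 ?mul0r//.
by apply: contraNF ij => /eqP ij; apply/eqP/val_inj.
Qed.

Lemma gform_expo m y j : (j < m)%N -> gform (expo m y) 'X^j = y ^+ j.
Proof. by move=> jm; rewrite gformXr coef_poly jm divfK. Qed.

Lemma gformXX i j : gform 'X^i 'X^j = (i == j)%:R * i`!%:R :> C.
Proof.
rewrite gformXr coefXn eq_sym.
by have [->|_] := eqVneq i j; rewrite ?mul0r.
Qed.

Lemma det_gformXX m : \det (\matrix_(i < m, j < m) (gform 'X^i 'X^j : C)) =
  \prod_(i < m) i`!%:R.
Proof.
rewrite det_trig; last first.
  by apply/is_trig_mxP => i j ij; rewrite mxE gformXX ltn_eqF// mul0r.
by apply: eq_bigr => i _; rewrite mxE gformXX eqxx mul1r.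
Qed.

Lemma det_gform_lin m a b :
  \det (\matrix_(i < m, j < m) gform (lin a * 'X^i) (lin b * 'X^j)) =
  \prod_(i < m.+1) i`!%:R * ep m.+1 (a * b).
Proof.
rewrite (@christoffel _ _ (@gformDl R) (@gformZl R) (@gformDr R) (@gformZr R)
  _ (expo m.+1 b)); first by rewrite det_gformXX horner_expo.
- exact: size_poly.
- by move=> j jm; rewrite gform_expo.
Qed.

(** Christoffel's formula a second time, for the pairing [B1] that already contains one linear
    factor on each side. Its kernel at [y] is the exponential kernel at [y], corrected by the one at
    [b] so as to vanish at [a], and then divided by the linear factors. *)
Lemma det_gform_lin2 m a b w y : a != w -> b != y -> ep m.+2 (a * b) != 0 ->
  \det (\matrix_(i < m, j < m)
     gform (lin a * (lin w * 'X^i)) (lin b * (lin y * 'X^j))) =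
  \prod_(i < m.+2) i`!%:R *
    ((ep m.+2 (a * b) * ep m.+2 (w * y) - ep m.+2 (a * y) * ep m.+2 (w * b)) /
     ((a - w) * (b - y))).
Proof.
move=> aw by0 e0.
(* Chosen so that [p] has the root [a]. *)
pose c := ep m.+2 (a * y) / ep m.+2 (a * b).
pose p := expo m.+2 y - c *: expo m.+2 b.
have pa : root p a.
  by rewrite /root hornerD hornerN hornerZ !horner_expo /c divfK// subrr.
have /factor_theorem [q pq] := pa.
have bn : b - y != 0 by rewrite subr_eq0.
pose k := - (b - y)^-1 *: q.
have kE : lin a * k = (b - y)^-1 *: p.
  rewrite pq /k -scalerAr (_ : lin a = - ('X - a%:P)); last by rewrite opprB.
  by rewrite mulNr scalerN scaleNr opprK mulrC.
have sk : (size k <= m.+1)%N.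
  rewrite /k; have [->|q0] := eqVneq q 0; first by rewrite scaler0 size_poly0.
  apply: (leq_trans (size_scale_leq _ _)).
  have : (size p <= m.+2)%N.
    rewrite (leq_trans (size_polyD _ _))// geq_max size_poly/= size_polyN.
    by rewrite (leq_trans (size_scale_leq _ _))// size_poly.
  by rewrite pq size_mul ?polyXsubC_eq0// size_XsubC addn2.
pose B1 (p q : {poly C}) := gform (lin a * p) (lin b * q).
rewrite (@christoffel _ B1 _ _ _ _ _ k _ y sk).
- have -> : k.[w] = (ep m.+2 (a * b) * ep m.+2 (w * y) - ep m.+2 (a * y) * ep m.+2 (w * b)) /
      (ep m.+2 (a * b) * ((a - w) * (b - y))).
    have awn : a - w != 0 by rewrite subr_eq0.
    apply: (mulfI awn).
    have -> : (a - w) * k.[w] = (lin a * k).[w].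
      by rewrite hornerM hornerD hornerN hornerC hornerX.
    rewrite kE hornerZ /p hornerD hornerN hornerZ !horner_expo /c.
    by field; rewrite e0 awn bn.
  rewrite det_gform_lin -mulrA; congr (_ * _).
  by field; rewrite e0 !subr_eq0 aw by0.
- by move=> p1 p2 q'; rewrite /B1 mulrDr gformDl.
- by move=> d p1 q'; rewrite /B1 -scalerAr gformZl.
- by move=> p1 q1 q2; rewrite /B1 mulrDr gformDr.
- by move=> d p1 q'; rewrite /B1 -scalerAr gformZr.
move=> j jm; rewrite /B1 kE gformZl /p.
have bX : lin b * 'X^j = b *: 'X^j + (-1) *: 'X^(j.+1).
  by rewrite mulrBl mul_polyC -exprS scaleN1r.
(* At [z = b] this vanishes, so the correction does not disturb the reproducing property. *)
have ge z : gform (expo m.+2 z) (lin b * 'X^j) = (b - z) * z ^+ j.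
  rewrite bX gformDr !gformZr !gform_expo//; last exact: ltnW.
  by rewrite exprS; ring.
by rewrite -scaleNr gformDl gformZl !ge subrr mul0r mulr0 addr0 mulKf.
Qed.

(** Closed form of the sum of the first [m.+1] exponential sums ([ffE]). This form shows the main
    term [(m.+1 - t) e^t]; the sum has nonnegative coefficients, which serves for upper bounds. *)
Definition ff m t : C := (m.+1%:R - t) * ep m.+1 t + t ^+ m.+1 / m`!%:R.

Lemma ffE m t : ff m t = \sum_(k < m.+1) ep k.+1 t.
Proof.
elim: m => [|m IH].
  by rewrite big_ord1 /ff /ep big_ord1 fact0 expr0 expr1 !divr1; ring.
rewrite big_ord_recr/= -IH /ff.
have -> : ep m.+2 t = ep m.+1 t + t ^+ m.+1 / m.+1`!%:R by rewrite /ep big_ord_recr.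
rewrite factS natrM [t ^+ m.+2]exprS.
have m0 : m.+1%:R != 0 :> C by rewrite pnatr_eq0.
have := fact_neq0 m; move: (m`!%:R : C) (t ^+ m.+1) (ep m.+1 t) => fm tm e fm0.
have -> : m.+2%:R = m.+1%:R + 1 :> C by rewrite natr1.
by move: (m.+1%:R : C) m0 => M M0; field; rewrite M0 fm0.
Qed.

Definition DD m t : C := m`!%:R * ff m t.

(** The recurrence of the tridiagonal determinants in [det_bformXX], and also the reason why the
    functional [ell] vanishes on the range of [Lop]. *)
Lemma DD_rec m t : DD m.+2 t = (t + m.+3%:R) * DD m.+1 t - t * m.+1%:R * DD m t.
Proof.
rewrite /DD /ff.
have -> : ep m.+3 t = ep m.+1 t + t ^+ m.+1 / m.+1`!%:R + t ^+ m.+2 / m.+2`!%:R.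
  by rewrite /ep !big_ord_recr.
have -> : ep m.+2 t = ep m.+1 t + t ^+ m.+1 / m.+1`!%:R by rewrite /ep big_ord_recr.
rewrite !factS !natrM [t ^+ m.+3]exprS [t ^+ m.+2]exprS [t ^+ m.+1]exprS.
have m0 : m.+1%:R != 0 :> C by rewrite pnatr_eq0.
have m1 : m.+2%:R != 0 :> C by rewrite pnatr_eq0.
have := fact_neq0 m; move: (m`!%:R : C) (t ^+ m) (ep m.+1 t) => fm tm e fm0.
have e3 : m.+3%:R = m.+1%:R + 2%:R :> C by rewrite -natrD addn2.
have e2 : m.+2%:R = m.+1%:R + 1 :> C by rewrite natr1.
rewrite e3 e2; rewrite e2 in m1.
by move: (m.+1%:R : C) m0 m1 => M M0 M1; field; rewrite M0 M1 fm0.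
Qed.

Lemma det_tridiag (f : nat -> nat -> C) m :
  (forall i j, (i.+1 < j)%N || (j.+1 < i)%N -> f i j = 0) ->
  \det (\matrix_(i < m.+2, j < m.+2) f i j) =
  f m.+1 m.+1 * \det (\matrix_(i < m.+1, j < m.+1) f i j) -
  f m m.+1 * f m.+1 m * \det (\matrix_(i < m, j < m) f i j).
Proof.
move=> f0; set A := (X in \det X = _).
have lm k (i : 'I_k) : lift ord_max i = i :> nat by rewrite lift_max.
have [j0 j0E] : {j0 : 'I_m.+2 | j0 = m :> nat}.
  by exists (lift ord_max ord_max); rewrite lm.
have j0P (j : 'I_m.+2) : (j == j0) = (j == m :> nat) by rewrite (_ : (j == j0) = (j == j0 :> nat))// j0E.
rewrite (expand_det_row _ ord_max) (bigD1 ord_max)//= (bigD1 j0)/=; last first.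
  by rewrite eq_sym j0P gtn_eqF.
rewrite [X in _ + (_ + X)]big1; last first.
  move=> j /andP[jm jj0]; rewrite mxE f0 ?mul0r//=; apply/orP; right.
  have := ltn_ord j; rewrite ltnS leq_eqVlt -val_eqE/= in jm * => /orP[/eqP jm'|].
    by rewrite jm' eqxx in jm.
  rewrite ltnS leq_eqVlt => /orP[/eqP jm'|//].
  by move: jj0; rewrite j0P jm' eqxx.
rewrite [X in _ + X]addr0 [A ord_max ord_max]mxE [A ord_max j0]mxE j0E /=; congr (_ * _ + _).
  rewrite /cofactor /= addnn -signr_odd odd_double expr0 mul1r; congr (\det _).
  by apply/matrixP => i j; rewrite !mxE !lm.
rewrite /cofactor /= j0E addSn -signr_odd /= oddD addbb expr1.
rewrite (expand_det_col _ ord_max) (bigD1 ord_max)//= big1 ?addr0; last first.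
  move=> i im; rewrite !mxE f0 ?mul0r//.
  have -> : lift j0 ord_max = m.+1 :> nat by rewrite /= /bump j0E leqnn add1n.
  rewrite lm; apply/orP; left; rewrite ltnS.
  by have := ltn_ord i; rewrite ltnS leq_eqVlt -val_eqE/= in im * => /orP[/eqP e|//]; rewrite e eqxx in im.
have -> : row' ord_max (col' j0 A) ord_max ord_max = f m m.+1.
  by rewrite !mxE lm /= /bump j0E leqnn add1n.
rewrite /cofactor /= addnn -signr_odd odd_double expr0 mul1r.
have -> : row' ord_max (col' ord_max (row' ord_max (col' j0 A))) =
    \matrix_(i < m, j < m) f i j.
  apply/matrixP => i j; rewrite !mxE !lm.
  congr f; change (bump j0 (lift ord_max j) = j :> nat).
  by rewrite lm /bump j0E leqNgt ltn_ord add0n.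
by ring.
Qed.

End gram.

(** * The numerator: a tridiagonal determinant and its kernel polynomial *)

Section overlap_kernel.
Context {R : realType}.
Local Notation C := R[i].
Local Notation lin a := (a%:P - 'X).
Variables (a b : C).
Let t := a * b.
Implicit Types (p q k : {poly C}).

Let linX (c : C) i : lin c * 'X^i = c *: 'X^i + (-1) *: 'X^(i.+1).
Proof. by rewrite mulrBl mul_polyC -exprS scaleN1r. Qed.

Lemma bformXX i j : bform a b 'X^i 'X^j =
  (i == j)%:R * ((t + i.+2%:R) * i`!%:R) - a * ((i == j.+1)%:R * i`!%:R)
  - b * ((i.+1 == j)%:R * i.+1`!%:R).
Proof.
rewrite /bform !linX !(gformDl, gformDr, gformZl, gformZr) !gformXX eqSS factS natrM.
have -> : i.+2%:R = i.+1%:R + 1 :> C by rewrite natr1.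
rewrite /t; move: (i.+1%:R : C) (i`!%:R : C) => I1 fi.
move: ((i == j)%:R : C) ((i == j.+1)%:R : C) ((i.+1 == j)%:R : C) => d1 d2 d3.
ring.
Qed.

Lemma DD0 : DD 0 t = 1.
Proof. by rewrite /DD ffE big_ord1 /ep big_ord1 expr0 fact0 !mul1r invr1. Qed.

Lemma DD1 : DD 1 t = t + 2.
Proof.
rewrite /DD ffE !big_ord_recr big_ord0 /ep !big_ord_recr big_ord0 /=.
by rewrite -[0`!%N]/1%N -[1`!%N]/1%N !invr1 expr0 expr1; ring.
Qed.

Lemma det_bformXX m : \det (\matrix_(i < m, j < m) bform a b 'X^i 'X^j) =
  \prod_(i < m) i`!%:R * DD m t.
Proof.
suff H : \det (\matrix_(i < m, j < m) bform a b 'X^i 'X^j) =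
    \prod_(i < m) i`!%:R * DD m t /\
  \det (\matrix_(i < m.+1, j < m.+1) bform a b 'X^i 'X^j) =
    \prod_(i < m.+1) i`!%:R * DD m.+1 t by case: H.
elim: m => [|m [IH1 IH2]].
  rewrite det_mx00 big_ord0 DD0 mulr1; split => //.
  rewrite det_mx11 mxE bformXX big_ord1 DD1 eqxx fact0.
  by rewrite !(mul0r, mulr0, mul1r, mulr1, subr0).
split => //.
rewrite (det_tridiag (f := fun i j => bform a b 'X^i 'X^j)); last first.
  move=> i j ij; rewrite bformXX.
  have -> : (i == j) = false by lia.
  have -> : (i == j.+1) = false by lia.
  have -> : (i.+1 == j) = false by lia.
  by rewrite !(mul0r, mulr0, subr0).
rewrite IH1 IH2 !bformXX !eqxx DD_rec !big_ord_recr/=.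
have -> : (m == m.+1) = false by lia.
have -> : (m.+1 == m) = false by lia.
have -> : (m == m.+2) = false by lia.
have -> : (m.+1 == m.+2) = false by lia.
have -> : (m.+2 == m) = false by lia.
have -> : (m.+2 == m.+1) = false by lia.
rewrite factS natrM /t.
move: (\prod_(i < m) _) (m`!%:R : C) (m.+1%:R : C) (m.+3%:R : C) => P fm M1 M3.
move: (DD m _) (DD m.+1 _) => d0 d1.
by rewrite !(mul0r, mulr0, mul1r, mulr1, subr0, sub0r); ring.
Qed.

(** The operator that reduces [bform] to [gform]: multiplication by the conjugate variable on the
    right is moved to the left as a derivative. The kernel of [bform] therefore solves a first order
    differential equation, singular at [a]. *)
Definition Lop k : {poly C} := 2%:R *: k + b *: (lin a * k) - lin a * k^`().

Lemma bformE k q : bform a b k q = gform (Lop k) q.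
Proof.
have -> : bform a b k q = gform k q + (b * gform (lin a * k) q - gform (lin a * k)^`() q).
  rewrite /bform; congr (_ + _).
  have -> : lin b * q = b *: q + (-1) *: ('X * q).
    by rewrite mulrBl mul_polyC scaleN1r.
  by rewrite gformDr !gformZr gform_mulX mulN1r.
have -> : Lop k = k + (b *: (lin a * k) + (-1) *: (lin a * k)^`()).
  rewrite /Lop derivM derivB derivC derivX sub0r mulN1r scaleN1r opprD opprK.
  rewrite [2%:R *: k]scaler_nat mulr2n; ring.
by rewrite gformDl (gformDl (b *: _)) !gformZl mulN1r.
Qed.

Lemma LopX i : Lop 'X^i =
  (t + i.+2%:R) *: 'X^i - b *: 'X^(i.+1) - (a * i%:R) *: 'X^(i.-1).
Proof.
rewrite /Lop derivXn [lin a * (_ *+ i)]mulrnAr !linX.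
have -> : (a *: 'X^(i.-1) + (-1) *: 'X^((i.-1).+1)) *+ i =
   (a * i%:R) *: 'X^(i.-1) - i%:R *: 'X^i :> {poly C}.
  case: i => [|i] /=; first by rewrite mulr0n mulr0 !scale0r subr0.
  by rewrite -scaler_nat scalerDr !scalerA mulrN1 scaleNr [_ * a]mulrC.
rewrite scalerDr !scalerA /t mulrN1 scaleNr opprB.
have -> : i.+2%:R = 2%:R + i%:R :> C by rewrite -natrD addnC addn2.
by rewrite !scalerDl (mulrC b); ring.
Qed.

Lemma LopD p q : Lop (p + q) = Lop p + Lop q.
Proof. by rewrite /Lop derivD !mulrDr !scalerDr; ring. Qed.
Lemma LopZ c p : Lop (c *: p) = c *: Lop p.
Proof.
rewrite /Lop derivZ -!scalerAr !scalerBr !scalerDr !scalerA.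
by rewrite (mulrC c) (mulrC c).
Qed.

Section functional.
Variable n : nat.
(** [Lop] maps degree at most [n] into degree at most [n.+1], missing one dimension; this functional
    annihilates its range. The powers of [b] are complementary, so that no division by [b]
    occurs. *)
Definition ell p : C := \sum_(m < n.+2) p`_m * (DD m t * b ^+ (n.+1 - m)).

Lemma ellD p q : ell (p + q) = ell p + ell q.
Proof. by rewrite /ell -big_split/=; apply: eq_bigr => i _; rewrite coefD mulrDl. Qed.
Lemma ellZ c p : ell (c *: p) = c * ell p.
Proof. by rewrite /ell mulr_sumr; apply: eq_bigr => i _; rewrite coefZ mulrA. Qed.
Lemma ellX j : (j <= n.+1)%N -> ell 'X^j = DD j t * b ^+ (n.+1 - j).
Proof.
move=> jn; have jn' : (j < n.+2)%N by rewrite ltnS.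
rewrite /ell (bigD1 (Ordinal jn'))//= coefXn eqxx mul1r big1 ?addr0// => i ij.
rewrite coefXn (_ : (i == j :> nat) = false) ?mul0r//.
by apply: contraNF ij => /eqP ij; apply/eqP/val_inj.
Qed.

Lemma ell_LopX i : (i <= n)%N -> ell (Lop 'X^i) = 0.
Proof.
move=> i_n; rewrite LopX.
have -> : (t + i.+2%:R) *: 'X^i - b *: 'X^(i.+1) - (a * i%:R) *: 'X^(i.-1) =
    (t + i.+2%:R) *: 'X^i + (- b) *: 'X^(i.+1) + (- (a * i%:R)) *: 'X^(i.-1) :> {poly C}.
  by rewrite !scaleNr.
rewrite !(ellD, ellZ) !ellX//; last 2 first.
- by rewrite (leq_trans (leq_pred _))// (leq_trans i_n).
- by rewrite (leq_trans i_n).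
rewrite subSS; case: i i_n => [|i] i_n /=.
  by rewrite mulr0 oppr0 mul0r addr0 DD0 DD1 !subn0 exprS; ring.
rewrite DD_rec subSS.
have -> : (n.+1 - i = (n - i.+1).+2)%N by rewrite subnSK// subSn// ltnW.
rewrite -(subnSK i_n) !exprS /t; ring.
Qed.

Lemma ell_Lop k : (size k <= n.+1)%N -> ell (Lop k) = 0.
Proof.
move=> sk; have -> : k = \sum_(i < n.+1) k`_i *: 'X^i.
  rewrite -poly_def; apply/polyP => i; rewrite coef_poly.
  by case: ltnP => // ni; rewrite nth_default// (leq_trans sk).
apply: (big_ind (fun p => ell (Lop p) = 0)).
- by rewrite -(scale0r 0) LopZ ellZ mul0r.
- by move=> p q hp hq; rewrite LopD ellD hp hq addr0.
- by move=> i _; rewrite LopZ ellZ ell_LopX ?mulr0// -ltnS.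
Qed.

(** The kernel exists because the moment matrix is invertible. Testing against monomials shows that
    [Lop k] is the exponential kernel up to degree [n]; the one remaining coefficient [c], in degree
    [n.+1], is fixed by [ell (Lop k) = 0]. *)
Lemma overlap_kernel y : DD n.+1 t != 0 -> exists k c,
  [/\ Lop k = expo n.+1 y + c *: 'X^(n.+1),
      c * DD n.+1 t = - \sum_(m < n.+1) y ^+ m * ff m t * b ^+ (n.+1 - m) &
      forall w, \det (\matrix_(i < n, j < n) bform a b (lin w * 'X^i) (lin y * 'X^j)) =
        \prod_(i < n.+1) i`!%:R * DD n.+1 t * k.[w]].
Proof.
move=> D0.
pose M : 'M[C]_n.+1 := \matrix_(i, j) bform a b 'X^i 'X^j.
have detM : \det M = \prod_(i < n.+1) i`!%:R * DD n.+1 t by exact: det_bformXX.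
have f0 i : i`!%:R != 0 :> C by rewrite pnatr_eq0 -lt0n fact_gt0.
have uM : M \in unitmx.
  rewrite unitmxE detM unitfE mulf_neq0//; apply/prodf_neq0 => i _; exact: f0.
pose ka := (\row_j y ^+ j) *m invmx M.
pose k : {poly C} := \poly_(i < n.+1) ka 0 (inord i).
have sk : (size k <= n.+1)%N by exact: size_poly.
have bDl p1 p2 q : bform a b (p1 + p2) q = bform a b p1 q + bform a b p2 q.
  by rewrite !bformE LopD gformDl.
have bZl c p q : bform a b (c *: p) q = c * bform a b p q.
  by rewrite !bformE LopZ gformZl.
have bDr p q1 q2 : bform a b p (q1 + q2) = bform a b p q1 + bform a b p q2.
  by rewrite !bformE gformDr.
have bZr c p q : bform a b p (c *: q) = c * bform a b p q.
  by rewrite !bformE gformZr.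
have kB j : (j <= n)%N -> bform a b k 'X^j = y ^+ j.
  move=> jn; have jn' : (j < n.+1)%N by rewrite ltnS.
  have : (ka *m M) 0 (Ordinal jn') = y ^+ j.
    by rewrite /ka -mulmxA mulVmx// mulmx1 mxE.
  rewrite mxE => <-; rewrite /k poly_def (B_suml bDl bZl).
  by apply: eq_bigr => i _; rewrite !mxE inord_val.
have sL : (size (Lop k) <= n.+2)%N.
  have slin p : (size p <= n.+1)%N -> (size (lin a * p)%R <= n.+2)%N.
    move=> sp; apply: (leq_trans (size_polyMleq _ _)).
    rewrite -opprB size_polyN size_XsubC add2n/= ltnS.
    exact: sp.
  rewrite /Lop (leq_trans (size_polyD _ _))// geq_max; apply/andP; split.
    rewrite (leq_trans (size_polyD _ _))// geq_max; apply/andP; split.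
      by rewrite (leq_trans (size_scale_leq _ _))// (leq_trans sk).
    by rewrite (leq_trans (size_scale_leq _ _))// slin.
  rewrite size_polyN slin// (leq_trans _ sk)//.
  have [->|k0] := eqVneq k 0; first by rewrite deriv0.
  exact: ltnW (lt_size_deriv k0).
pose c := (Lop k)`_n.+1.
have Lk : Lop k = expo n.+1 y + c *: 'X^(n.+1).
  apply/polyP => i; rewrite [RHS]coefD [X in _ = _ + X]coefZ coefXn coef_poly.
  have [i_n|ni] := ltnP i n.+1.
    rewrite ltn_eqF// mulr0 addr0 -(kB i i_n) bformE gformXr mulfK//.
  have [->|i1] := eqVneq i n.+1; first by rewrite mulr1 add0r.
  by rewrite mulr0 addr0 nth_default// (leq_trans sL)// ltn_neqAle eq_sym i1.
exists k, c; split => //.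
  have := ell_Lop sk; rewrite Lk ellD ellZ ellX// subnn expr0 mulr1.
  move=> /eqP; rewrite addrC addr_eq0 => /eqP ->; congr (- _).
  rewrite /ell big_ord_recr/= coef_poly ltnn mul0r addr0.
  apply: eq_bigr => i _; rewrite coef_poly ltn_ord /DD mulrA; congr (_ * _).
  by rewrite mulrA divfK.
by move=> w; rewrite (christoffel bDl bZl bDr bZr w sk kB) -/M detM.
Qed.

End functional.
End overlap_kernel.

(** * The complex exponential, a mean value inequality and exponential tails *)

Section cexp.
Context {R : realType}.
Local Notation C := R[i].

Definition cexp (z : C) : C :=
  expR (complex.Re z) * cos (complex.Im z) +i* (expR (complex.Re z) * sin (complex.Im z)).

Lemma cexpD z w : cexp (z + w) = cexp z * cexp w.
Proof.
case: z => a b; case: w => c d; apply: complex_eqP => /=.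
  by rewrite expRD cosD; ring.
by rewrite expRD sinD; ring.
Qed.

Lemma cexp_real (x : R) : cexp x%:C = (expR x)%:C.
Proof. by apply: complex_eqP => /=; rewrite ?cos0 ?sin0 ?mulr0 ?mulr1. Qed.

Lemma cexp0 : cexp 0 = 1.
Proof. by rewrite -[0]/(0%:C) cexp_real expR0. Qed.

Lemma normc_cexp z : normc (cexp z) = expR (complex.Re z).
Proof.
apply/eqP; rewrite -(eqrXn2 (n := 2))// ?normc_ge0 ?expR_ge0// normcE2 /=.
by rewrite !exprMn -mulrDr cos2Dsin2 mulr1.
Qed.

Lemma cexp_conj z : conjc (cexp z) = cexp (conjc z).
Proof.
case: z => a b; apply: complex_eqP; rewrite ?cRe_conj ?cIm_conj /= ?cosN ?sinN //.
by rewrite mulrN.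
Qed.

Lemma cexpN z : cexp z * cexp (- z) = 1.
Proof. by rewrite -cexpD subrr cexp0. Qed.

Lemma cexp_neq0 z : cexp z != 0.
Proof. by rewrite -normc_eq0 normc_cexp gt_eqF// expR_gt0. Qed.

Definition cderiv (f : R -> C) (x : R) (d : C) :=
  is_derive x 1 (fun x => complex.Re (f x)) (complex.Re d) /\
  is_derive x 1 (fun x => complex.Im (f x)) (complex.Im d).

Lemma cderivD f g x d e : cderiv f x d -> cderiv g x e ->
  cderiv (fun x => f x + g x) x (d + e).
Proof.
move=> [f1 f2] [g1 g2]; split.
  have -> : (fun x => complex.Re (f x + g x)) =
     (fun x => complex.Re (f x)) + (fun x => complex.Re (g x)).
    by apply/funext => y; rewrite cReD.
  by rewrite cReD; exact: is_deriveD.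
have -> : (fun x => complex.Im (f x + g x)) =
   (fun x => complex.Im (f x)) + (fun x => complex.Im (g x)).
  by apply/funext => y; rewrite cImD.
by rewrite cImD; exact: is_deriveD.
Qed.

Lemma cderivM f g x d e : cderiv f x d -> cderiv g x e ->
  cderiv (fun x => f x * g x) x (d * g x + f x * e).
Proof.
move=> [f1 f2] [g1 g2]; split.
  have -> : (fun x => complex.Re (f x * g x)) =
     (fun x => complex.Re (f x)) * (fun x => complex.Re (g x)) -
     (fun x => complex.Im (f x)) * (fun x => complex.Im (g x)).
    by apply/funext => y; rewrite cReM.
  apply: is_derive_eq (is_deriveB (is_deriveM f1 g1) (is_deriveM f2 g2)) _.
  by rewrite cReD !cReM /GRing.scale/=; lra.
have -> : (fun x => complex.Im (f x * g x)) =
   (fun x => complex.Re (f x)) * (fun x => complex.Im (g x)) +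
   (fun x => complex.Im (f x)) * (fun x => complex.Re (g x)).
  by apply/funext => y; rewrite cImM.
apply: is_derive_eq (is_deriveD (is_deriveM f1 g2) (is_deriveM f2 g1)) _.
by rewrite cImD !cImM /GRing.scale/=; lra.
Qed.

Lemma cderiv_cst (c : C) x : cderiv (fun _ => c) x 0.
Proof. by split; exact: is_derive_cst. Qed.

Lemma cderiv_real (f : R -> R) (x d : R) : is_derive x 1 f d -> cderiv (fun x => (f x)%:C) x d%:C.
Proof. by move=> fd; split => //=; exact: is_derive_cst. Qed.

Lemma cderiv_id x : cderiv (fun x => x%:C) x 1.
Proof. by apply: cderiv_real; exact: is_derive_id. Qed.

Lemma cderiv_eq f x d e : cderiv f x d -> d = e -> cderiv f x e.
Proof. by move=> ? <-. Qed.

Lemma cderivZ (c : C) f x d : cderiv f x d -> cderiv (fun x => c * f x) x (c * d).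
Proof.
by move=> fd; apply: cderiv_eq (cderivM (cderiv_cst c x) fd) _; rewrite mul0r add0r.
Qed.

Lemma cderivN f x d : cderiv f x d -> cderiv (fun x => - f x) x (- d).
Proof.
move=> fd; have -> : (fun x => - f x) = (fun x => -1 * f x).
  by apply/funext => y; rewrite mulN1r.
by apply: cderiv_eq (cderivZ (-1) fd) _; rewrite mulN1r.
Qed.

Lemma cderivB f g x d e : cderiv f x d -> cderiv g x e ->
  cderiv (fun x => f x - g x) x (d - e).
Proof. by move=> fd ge; apply: cderivD => //; exact: cderivN. Qed.

Lemma cderiv_horner (p : {poly C}) f x d : cderiv f x d ->
  cderiv (fun x => p.[f x]) x (p^`().[f x] * d).
Proof.
move=> fd; elim/poly_ind: p => [|p c IH].
  rewrite (_ : (fun x => _) = (fun _ => 0)); last by apply/funext => y; rewrite horner0.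
  by rewrite derivC horner0 mul0r; exact: cderiv_cst.
rewrite (_ : (fun x => _) = (fun x => p.[f x] * f x + c)); last first.
  by apply/funext => y; rewrite hornerMXaddC.
apply: cderiv_eq (cderivD (cderivM IH fd) (cderiv_cst c x)) _.
by rewrite derivD derivC derivM derivX mulr1 !addr0 hornerD hornerMX; ring.
Qed.

Lemma cderiv_cexp (c : C) x :
  cderiv (fun x => cexp (x%:C * c)) x (c * cexp (x%:C * c)).
Proof.
case: c => a b; split.
  rewrite (_ : (fun x => _) = (fun x => expR (x * a) * cos (x * b))); last first.
    by apply/funext => y /=; rewrite !mul0r subr0 addr0.
  have h : is_derive x 1 ((expR \o ( *%R^~ a)) * (cos \o ( *%R^~ b)))
     (expR (x * a) *: (- sin (x * b) * b) + cos (x * b) *: (expR (x * a) * a)).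
    apply: is_deriveM; apply: is_derive1_comp.
      by apply: is_derive_eq; rewrite /GRing.scale/= ?mulr1 ?mulr0 ?add0r ?addr0.
    by apply: is_derive_eq; rewrite /GRing.scale/= ?mulr1 ?mulr0 ?add0r ?addr0.
  by apply: is_derive_eq h _; rewrite /GRing.scale/= !mul0r subr0 addr0; ring.
rewrite (_ : (fun x => _) = (fun x => expR (x * a) * sin (x * b))); last first.
  by apply/funext => y /=; rewrite !mul0r subr0 addr0.
have h : is_derive x 1 ((expR \o ( *%R^~ a)) * (sin \o ( *%R^~ b)))
   (expR (x * a) *: (cos (x * b) * b) + sin (x * b) *: (expR (x * a) * a)).
  apply: is_deriveM; apply: is_derive1_comp.
    by apply: is_derive_eq; rewrite /GRing.scale/= ?mulr1 ?mulr0 ?add0r ?addr0.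
  by apply: is_derive_eq; rewrite /GRing.scale/= ?mulr1 ?mulr0 ?add0r ?addr0.
by apply: is_derive_eq h _; rewrite /GRing.scale/= !mul0r subr0 addr0; ring.
Qed.

(** The real mean value theorem applied to the component of [f] in the direction of its own
    increment [D]. *)
Lemma cmean_value (f : R -> C) (df : R -> C) (B : R) :
  (forall x, cderiv f x (df x)) -> (forall x : R, 0 <= x <= 1 -> normc (df x) <= B) ->
  normc (f 1 - f 0) <= B.
Proof.
move=> fd dB; set D := f 1 - f 0.
have [D0|D0] := eqVneq D 0.
  by rewrite D0 normc0 (le_trans (normc_ge0 (df 0)))// dB// lexx ler01.
have nD : 0 < normc D by rewrite normc_gt0.
pose g x := complex.Re (conjc D * f x).
have gd (x : R) : is_derive x (1 : R) g (complex.Re (conjc D * df x)).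
  by have [] := cderivZ (conjc D) (fd x).
have gc : {within `[0, 1], continuous g}.
  apply: continuous_subspaceT => x; apply/differentiable_continuous/derivable1_diffP.
  by have [] := gd x.
have [c c01] := MVT ltr01 (fun x _ => gd x) gc.
rewrite subr0 mulr1 => e.
have gE : g 1 - g 0 = normc D ^+ 2.
  rewrite /g -(cReN) -cReD -mulrN -mulrDr -/D mulrC mul_conjc.
  by [].
rewrite -(ler_pM2l nD) -expr2 -gE e (le_trans (ler_norm _))// (le_trans (normRe _))//.
rewrite normcM normc_conj ler_wpM2l ?normc_ge0// dB//.
by move: c01; rewrite in_itv/= => /andP[/ltW -> /ltW ->].
Qed.

End cexp.

Section tail.
Context {R : realType}.
Local Notation C := R[i].

(** From [tau <= expR (tau - 1)]; the exponent is then at most [- rho] since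
    [(1 - tau) * (m - rho) >= 0]. *)
Lemma exp_decay m (tau rho : R) : 0 <= tau <= 1 -> rho <= m%:R ->
  tau ^+ m * expR (- (tau * rho)) <= expR (- rho).
Proof.
move=> /andP[t0 t1] rm.
have h : tau ^+ m <= expR (m%:R * (tau - 1)).
  rewrite expRM_natl lerXn2r// ?nnegrE ?expR_ge0//.
  by have := expR_ge1Dx (tau - 1); lra.
rewrite (le_trans (ler_wpM2r (expR_ge0 _) h))// -expRD ler_expR.
have := mulr_ge0 (_ : 0 <= 1 - tau) (_ : 0 <= m%:R - rho); rewrite !subr_ge0.
by move=> /(_ t1 rm); lra.
Qed.

Lemma deriv_expo m (y : C) : (expo m.+1 y)^`() = y *: expo m y.
Proof.
apply/polyP => i; rewrite coef_deriv coefZ !coef_poly ltnS.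
case: ltnP => im; last by rewrite mulr0 mul0rn.
rewrite factS natrM -[LHS]mulr_natr exprS.
have fi0 : i`!%:R != 0 :> C by rewrite pnatr_eq0 -lt0n fact_gt0.
have i0 : i.+1%:R != 0 :> C by rewrite pnatr_eq0.
by move: (i.+1%:R : C) (i`!%:R : C) i0 fi0 (y ^+ i) => p q p0 q0 z; field; rewrite p0 q0.
Qed.

(** Along the ray to [z], the derivative of e^(-xz) times the cut-off series at xz is the single
    term - z e^(-xz) (xz)^m / m!. By [exp_decay] its modulus is largest at the end point. *)
Lemma ep_tail m (z : C) : complex.Re z <= m%:R ->
  normc (cexp z - ep m.+1 z) <= normc z ^+ m.+1 / m`!%:R.
Proof.
move=> zm.
pose h (x : R) := cexp (x%:C * - z) * (expo m.+1 z).[x%:C].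
pose dh (x : R) := - (z * cexp (x%:C * - z) * (x%:C * z) ^+ m / m`!%:R).
have hd x : cderiv h x (dh x).
  have := cderivM (cderiv_cexp (- z) x) (cderiv_horner (expo m.+1 z) (cderiv_id x)).
  move=> H; apply: cderiv_eq H _.
  rewrite deriv_expo hornerZ !horner_expo /dh {1}/ep big_ord_recr/= -/(ep m _).
  by move: (cexp _) (ep m _) (_ ^+ m) (_^-1) => A B D E; ring.
have fact_ge0 : 0 <= (m`!%:R : R)^-1 by rewrite invr_ge0.
have dhB x : 0 <= x <= 1 ->
    normc (dh x) <= expR (- complex.Re z) * (normc z ^+ m.+1 / m`!%:R).
  move=> x01; rewrite /dh normcN !normcM normcV normc_nat normcX normcM normc_real.
  have x0 : 0 <= x by case/andP: x01.
  rewrite (ger0_norm x0) normc_cexp.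
  have -> : complex.Re (x%:C * - z) = - (x * complex.Re z).
    by rewrite cReM cReN /= mul0r subr0 mulrN.
  rewrite [leLHS](_ : _ = x ^+ m * expR (- (x * complex.Re z)) *
     (normc z ^+ m.+1 / m`!%:R)); last by rewrite exprMn exprS; ring.
  apply: ler_wpM2r (exp_decay x01 zm).
  by rewrite mulr_ge0// exprn_ge0// normc_ge0.
have := cmean_value hd dhB.
have -> : h 1 - h 0 = - (cexp (- z) * (cexp z - ep m.+1 z)).
  rewrite /h mul1r mul0r cexp0 mul1r !horner_expo mul1r mul0r.
  have -> : ep m.+1 0 = 1 :> C.
    by rewrite /ep big_ord_recl big1 ?addr0 ?expr0 ?fact0 ?divr1// => i _; rewrite exprS mul0r mul0r.
  by have := cexpN z; rewrite mulrC => e; rewrite mulrBr e; ring.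
rewrite normcN normcM normc_cexp cReN.
by rewrite ler_pM2l ?expR_gt0.
Qed.

End tail.

Lemma real_complexB (R : realType) (x y : R) : (x - y)%:C = x%:C - y%:C.
Proof. exact: rmorphB. Qed.
Lemma real_complexN (R : realType) (x : R) : (- x)%:C = - x%:C.
Proof. exact: rmorphN. Qed.

Lemma real_complexV (R : realType) (x : R) : (x^-1)%:C = x%:C^-1.
Proof. exact: fmorphV. Qed.
Lemma real_complexD (R : realType) (x y : R) : (x + y)%:C = x%:C + y%:C.
Proof. exact: rmorphD. Qed.

Lemma sumr_cst_le (R : numDomainType) (k l : nat) (x : R) : 0 <= x -> (k <= l)%N ->
  \sum_(i < k) x <= l%:R * x.
Proof.
by move=> x0 kl; rewrite sumr_const card_ord -[x *+ k]mulr_natl ler_wpM2r// ler_nat.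
Qed.

Lemma powX_fact_le_expR (R : realType) (x : R) i : 0 <= x -> x ^+ i / i`!%:R <= expR x.
Proof.
case: i => [|i] x0; first by rewrite expr0 fact0 divr1 -expR0 ler_expR.
by have := expR_ge1Dxn i x0; lra.
Qed.

(** * Both determinants compared with their exponential limits *)

Section errors.
Context {R : realType}.
Local Notation C := R[i].
Variables (x1 x2 : C) (n : nat) (eta rm : R).
Local Notation r1 := (normc x1).
Local Notation r2 := (normc x2).
Local Notation om := (normc (x1 - x2)).
Local Notation t := (x1 * conjc x2).
Local Notation N := (n.+2%:R : R).

Hypothesis r1m : r1 <= rm.
Hypothesis r2m : r2 <= rm.
Hypothesis eta01 : 0 <= eta <= 1.
Hypothesis tails : forall rho : R, 0 <= rho <= rm ^+ 2 ->
  [/\ rho <= n%:R, rho ^+ n.+1 / n`!%:R <= eta * expR rho &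
      rho ^+ n.+2 / n.+1`!%:R <= eta * expR rho].

Let r10 : 0 <= r1. Proof. exact: normc_ge0. Qed.
Let r20 : 0 <= r2. Proof. exact: normc_ge0. Qed.
Let om0 : 0 <= om. Proof. exact: normc_ge0. Qed.
Let rm0 : 0 <= rm. Proof. exact: le_trans r1m. Qed.
Let eta0 : 0 <= eta. Proof. by case/andP: eta01. Qed.
Let eta1 : eta <= 1. Proof. by case/andP: eta01. Qed.

Lemma Re_mul_conjc : complex.Re t = (r1 ^+ 2 + r2 ^+ 2 - om ^+ 2) / 2.
Proof.
rewrite !normcE2; case: x1 => a b; case: x2 => c d.
by rewrite cReM cReD cImD cReN cImN cRe_conj cIm_conj /=; field.
Qed.

Lemma normc_mul_conjc : normc t = r1 * r2.
Proof. by rewrite normcM normc_conj. Qed.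

Let rr_rm p q : 0 <= p -> 0 <= q -> p <= rm -> q <= rm -> 0 <= p * q <= rm ^+ 2.
Proof. by move=> p0 q0 pr qr; rewrite mulr_ge0//= expr2 ler_pM. Qed.

(** Errors come with the modulus of [t], main terms with its real part; this is the price of passing
    from one to the other. *)
Lemma exp_sub_Re : expR (r1 * r2) <= expR (complex.Re t) * expR (om ^+ 2 / 2).
Proof.
rewrite -expRD ler_expR Re_mul_conjc.
by have := sqr_ge0 (r1 - r2); lra.
Qed.

Lemma ep_near z rho : normc z <= rho -> 0 <= rho <= rm ^+ 2 ->
  normc (cexp z - ep n.+2 z) <= eta * expR rho /\
  normc (cexp z - ep n.+1 z) <= eta * expR rho.
Proof.
move=> zr rr; have [rn T1 T2] := tails rr.
have zn : complex.Re z <= n%:R.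
  by rewrite (le_trans (ler_norm _))// (le_trans (normRe z))// (le_trans zr).
split.
  rewrite (le_trans (ep_tail _))//; first by rewrite (le_trans zn)// ler_nat.
  rewrite (le_trans _ T2)// ler_wpM2r ?invr_ge0//.
  by rewrite lerXn2r// nnegrE ?normc_ge0// (le_trans (normc_ge0 z)).
rewrite (le_trans (ep_tail _))// (le_trans _ T1)// ler_wpM2r ?invr_ge0//.
by rewrite lerXn2r// nnegrE ?normc_ge0// (le_trans (normc_ge0 z)).
Qed.

Local Notation S := (r1 ^+ 2 + r2 ^+ 2).

(** The constant 6 is 3 for the product of the two real series and 3 for the product of the two
    mixed ones, each with two linear error terms and one quadratic term. *)
Lemma den_near : exists kap, normc kap <= 6 * eta /\
  ep n.+2 (x1 * conjc x1) * ep n.+2 (x2 * conjc x2) -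
  ep n.+2 t * ep n.+2 (x2 * conjc x1) =
  (expR S)%:C * ((1 - expR (- om ^+ 2))%:C + kap).
Proof.
rewrite !mul_conjc.
have e1 (x : C) : normc x <= rm -> exists2 d, normc d <= eta &
    ep n.+2 (normc x ^+ 2)%:C = (expR (normc x ^+ 2))%:C * (1 + d).
  move=> xr.
  have xx : 0 <= normc x ^+ 2 <= rm ^+ 2.
    by rewrite sqr_ge0 lerXn2r// nnegrE ?normc_ge0.
  have [] := @ep_near (normc x ^+ 2)%:C (normc x ^+ 2) _ xx.
    by rewrite normc_real ger0_norm ?sqr_ge0.
  rewrite cexp_real => h _.
  have E0 : (expR (normc x ^+ 2))%:C != 0 :> C.
    by rewrite -cexp_real cexp_neq0.
  exists ((ep n.+2 (normc x ^+ 2)%:C - (expR (normc x ^+ 2))%:C) / (expR (normc x ^+ 2))%:C).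
    rewrite normcM normcV normc_real ger0_norm ?expR_ge0// normcB.
    by rewrite ler_pdivrMr ?expR_gt0.
  by move: (ep _ _) (_%:C) E0 => A B B0; field.
have [d1 d1e ->] := e1 _ r1m; have [d2 d2e ->] := e1 _ r2m.
have [] := @ep_near t (r1 * r2); rewrite ?normc_mul_conjc ?rr_rm// => h3 _.
have [] := @ep_near (x2 * conjc x1) (r1 * r2); rewrite ?rr_rm//.
  by rewrite normcM normc_conj mulrC.
move=> h4 _.
set E := expR (r1 * r2) in h3 h4.
have ES : E ^+ 2 <= expR S.
  by rewrite /E -expRM_natl ler_expR; have := sqr_ge0 (r1 - r2); lra.
have E0 : 0 <= E by exact: expR_ge0.
have tE (z : C) : complex.Re z <= r1 * r2 -> normc (cexp z) <= E.
  by move=> ?; rewrite normc_cexp ler_expR.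
have h5 : normc (cexp t) <= E.
  by apply: tE; rewrite (le_trans (ler_norm _))// (le_trans (normRe t))// normc_mul_conjc.
have h6 : normc (cexp (x2 * conjc x1)) <= E.
  apply: tE; rewrite (le_trans (ler_norm _))// (le_trans (normRe _))//.
  by rewrite normcM normc_conj mulrC.
have h7 : cexp t * cexp (x2 * conjc x1) = (expR S * expR (- om ^+ 2))%:C.
  rewrite -cexpD -expRD -cexp_real; congr cexp.
  have -> : x2 * conjc x1 = conjc t.
    by rewrite conjcM conjcK mulrC.
  apply: complex_eqP; rewrite ?cReD ?cImD ?cRe_conj ?cIm_conj /=; last by rewrite subrr.
  by rewrite Re_mul_conjc; field.
move: h3 h4; set a := ep _ t; set b := ep _ (x2 * _) => h3 h4.
set ct := cexp t in h3 h5 h7; set ct' := cexp (x2 * _) in h4 h6 h7.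
have h8 : normc (ct * ct' - a * b) <= 3 * eta * expR S.
  rewrite (_ : _ - _ = (ct - a) * ct' + ct * (ct' - b) - (ct - a) * (ct' - b)); last by ring.
  rewrite (le_trans (le_normcD _ _))// normcN.
  rewrite (_ : 3 * _ * _ = eta * expR S + eta * expR S + eta * expR S); last by ring.
  rewrite lerD// ?(le_trans (le_normcD _ _))// ?lerD//.
  - rewrite normcM (le_trans (ler_pM _ _ h3 h6)) ?normc_ge0//.
    by rewrite -mulrA -expr2 ler_wpM2l.
  - rewrite normcM (le_trans (ler_pM _ _ h5 h4)) ?normc_ge0//.
    by rewrite mulrCA -expr2 ler_wpM2l.
  - rewrite normcM (le_trans (ler_pM _ _ h3 h4)) ?normc_ge0//.
    rewrite mulrACA -expr2 (ler_pM _ _ _ ES) ?mulr_ge0 ?exprn_ge0//.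
    by rewrite ler_piMr.
have S0 : (expR S)%:C != 0 :> C by rewrite -cexp_real cexp_neq0.
exists (d1 + d2 + d1 * d2 + (ct * ct' - a * b) / (expR S)%:C); split.
  have -> : 6 * eta = eta + eta + eta + 3 * eta by ring.
  rewrite (le_trans (le_normcD _ _))// lerD//.
    rewrite (le_trans (le_normcD _ _))// lerD//.
      by rewrite (le_trans (le_normcD _ _))// lerD.
    rewrite normcM -[leRHS]mulr1 ler_pM ?normc_ge0//.
    exact: le_trans eta1.
  rewrite normcM normcV normc_real ger0_norm ?expR_ge0//.
  by rewrite ler_pdivrMr ?expR_gt0.
set Q := (_ - a * b) / _.
have -> : a * b = ct * ct' - (expR S)%:C * Q.
  by rewrite /Q mulrCA divff// mulr1; ring.
rewrite h7 !real_complexM expRD !real_complexM real_complexB.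
by move: (Q) (expR _)%:C (expR _)%:C (expR _)%:C => Q0 A B D; ring.
Qed.

Lemma norm_subN : 1 <= normc (N%:C - t).
Proof.
have [tn _ _] := tails (rr_rm r10 r20 r1m r2m).
have : normc N%:C <= normc (N%:C - t) + normc t.
  by rewrite -[X in normc X <= _](subrK t) le_normcD.
rewrite normc_real ger0_norm// normc_mul_conjc.
have : n%:R + 2 = N by rewrite -natrD addn2.
lra.
Qed.

Lemma ff_near : exists kap, normc kap <= 2 * eta * expR (om ^+ 2 / 2) /\
  ff n.+1 t = (N%:C - t) * cexp t * (1 + kap).
Proof.
have tt := rr_rm r10 r20 r1m r2m.
have [] := @ep_near t (r1 * r2); rewrite ?normc_mul_conjc// => h3 _.
have [_ _ T2] := tails tt.
have N1 := norm_subN.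
have N0 : N%:C - t != 0 by rewrite -normc_gt0 (lt_le_trans _ N1).
have ct0 := cexp_neq0 t.
set e1 := ep n.+2 t - cexp t.
exists (e1 / cexp t + t ^+ n.+2 / n.+1`!%:R / (N%:C - t) / cexp t); split.
  have -> (u : R) : 2 * eta * u = eta * u + eta * u by ring.
  rewrite (le_trans (le_normcD _ _))// lerD//.
    rewrite normcM normcV normc_cexp ler_pdivrMr ?expR_gt0//.
    rewrite /e1 normcB (le_trans h3)// -mulrA ler_wpM2l// [leRHS]mulrC.
    exact: exp_sub_Re.
  rewrite normcM [X in X * _]normcM !normcV normc_cexp ler_pdivrMr ?expR_gt0//.
  rewrite ler_pdivrMr ?(lt_le_trans _ N1)//.
  rewrite normcM normcX normc_mul_conjc normcV normc_nat (le_trans T2)//.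
  rewrite -[leLHS]mulr1 ler_pM ?mulr_ge0 ?expR_ge0//.
  by rewrite -mulrA ler_wpM2l// [leRHS]mulrC exp_sub_Re.
rewrite /ff /e1 rmorph_nat; move: N0; rewrite rmorph_nat.
move: (ep _ _) (t ^+ _ / _) (cexp t) ct0 (_ - _) => A B D D0 E E0.
by field; rewrite D0 E0.
Qed.

Local Notation big := (Num.max r1 r2).
Local Notation small := (Num.min r1 r2).

(** Powers of the smaller modulus are traded for powers of the larger one, keeping only [r1 * small]
    in the index [i]; summing over [i] then gives an exponential that still fits [exponent_le]. *)
Lemma monomial_le m i : (i <= m <= n)%N ->
  r1 ^+ m * r2 ^+ (n.+1 - m) * (r1 * r2) ^+ i <= big ^+ n.+1 * (r1 * small) ^+ i.
Proof.
case/andP => im mn; case: (leP r1 r2) => r12.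
  have -> : r1 ^+ m = r1 ^+ i * r1 ^+ (m - i) by rewrite -exprD subnKC.
  have -> : r2 ^+ n.+1 = r2 ^+ (m - i) * (r2 ^+ (n.+1 - m) * r2 ^+ i).
    by rewrite -!exprD; congr (_ ^+ _); lia.
  rewrite !exprMn.
  rewrite [leLHS](_ : _ = r1 ^+ (m - i) * (r2 ^+ (n.+1 - m) * r2 ^+ i * (r1 ^+ i * r1 ^+ i))); last by ring.
  rewrite [leRHS](_ : _ = r2 ^+ (m - i) * (r2 ^+ (n.+1 - m) * r2 ^+ i * (r1 ^+ i * r1 ^+ i))); last by ring.
  by rewrite ler_wpM2r ?mulr_ge0 ?exprn_ge0// lerXn2r// nnegrE.
have -> : r1 ^+ n.+1 = r1 ^+ m * r1 ^+ (n.+1 - m).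
  by rewrite -!exprD; congr (_ ^+ _); lia.
rewrite ler_wpM2r ?exprn_ge0 ?mulr_ge0// ler_wpM2l ?exprn_ge0//.
by rewrite lerXn2r// ?nnegrE// ltW.
Qed.

Let big0 : 0 <= big. Proof. by rewrite le_max r10. Qed.
Let small0 : 0 <= small. Proof. by rewrite le_min r10. Qed.

Lemma ff_weight_le m : (m <= n)%N ->
  r1 ^+ m * normc (ff m t) * r2 ^+ (n.+1 - m) <=
  N ^+ 2 * (big ^+ n.+1 * expR (r1 * small)).
Proof.
move=> mn; rewrite ffE mulrAC.
apply: le_trans (_ : \sum_(k < m.+1) N * (big ^+ n.+1 * expR (r1 * small)) <= _).
  rewrite (le_trans (ler_wpM2l _ (le_normc_sum _ _ _)))// ?mulr_ge0 ?exprn_ge0//.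
  rewrite mulr_sumr ler_sum// => k _.
  rewrite (le_trans (ler_wpM2l _ (le_normc_sum _ _ _)))// ?mulr_ge0 ?exprn_ge0//.
  rewrite mulr_sumr.
  apply: le_trans (_ : \sum_(i < k.+1) big ^+ n.+1 * expR (r1 * small) <= _).
    rewrite ler_sum// => i _.
    rewrite normcM normcV normc_nat normcX normc_mul_conjc mulrA.
    rewrite (le_trans (ler_wpM2r _ (monomial_le _)))// ?invr_ge0//.
      by rewrite (leq_trans (_ : i <= k)%N) -1?ltnS ?ltn_ord.
    by rewrite -mulrA ler_wpM2l ?exprn_ge0// powX_fact_le_expR// mulr_ge0.
  by rewrite sumr_cst_le ?mulr_ge0 ?exprn_ge0 ?expR_ge0// (leq_trans (ltn_ord k))// ltnW.
rewrite expr2 -[leRHS]mulrA sumr_cst_le ?mulr_ge0 ?exprn_ge0 ?expR_ge0//.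
by rewrite ltnS (leq_trans mn).
Qed.

Hypothesis eta_om : 2 * eta * expR (om ^+ 2 / 2) <= 2^-1.

Lemma ff_lower : expR (complex.Re t) <= 2 * normc (ff n.+1 t).
Proof.
have [kap [kape ->]] := ff_near.
have k2 : normc kap <= 2^-1 by exact: le_trans eta_om.
have k1 : 2^-1 <= normc (1 + kap).
  have : normc (1 : C) <= normc (1 + kap) + normc kap.
    by rewrite -[X in normc X <= _](addrK kap) (le_trans (le_normcD _ _))// normcN.
  by rewrite normc1; lra.
rewrite !normcM normc_cexp.
have := norm_subN; move: (normc (_ - _)) (expR_gt0 (complex.Re t)).
move: (expR _) (normc (1 + _)) k1 => E K K2 P E0 P1.
have : 2^-1 <= P * K by rewrite -[leLHS]mul1r ler_pM.
by move=> h; have := ler_wpM2l (ltW E0) h; lra.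
Qed.

Lemma ff_neq0 : ff n.+1 t != 0.
Proof.
rewrite -normc_gt0; have := ff_lower; have := expR_gt0 (complex.Re t); lra.
Qed.

(** The formula for [c] is a sum over at most N indices bounded by [ff_weight_le], divided by
    [DD n.+1 t], which is bounded below through [ff_lower]. *)
Lemma correction_le c :
  c * DD n.+1 t =
    - \sum_(m < n.+1) conjc x1 ^+ m * ff m t * conjc x2 ^+ (n.+1 - m) ->
  normc c * expR (complex.Re t) * n.+1`!%:R <=
    2 * N ^+ 3 * (big ^+ n.+1 * expR (r1 * small)).
Proof.
move=> /(congr1 (@normc R)); rewrite normcN normcM /DD normcM normc_nat => e.
have h : normc c * (n.+1`!%:R * normc (ff n.+1 t)) <=
     N ^+ 3 * (big ^+ n.+1 * expR (r1 * small)).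
  rewrite e (le_trans (le_normc_sum _ _ _))//.
  apply: le_trans (_ : \sum_(m < n.+1) N ^+ 2 * (big ^+ n.+1 * expR (r1 * small)) <= _).
    rewrite ler_sum// => m _; rewrite !normcM !normcX !normc_conj ff_weight_le//.
    by rewrite -ltnS.
  by rewrite [N ^+ 3]exprS -[leRHS]mulrA sumr_cst_le ?mulr_ge0 ?exprn_ge0 ?expR_ge0.
have := ler_wpM2l (_ : 0 <= normc c * n.+1`!%:R) ff_lower.
rewrite mulr_ge0 ?normc_ge0// => /(_ isT); lra.
Qed.

Hypothesis om_gt0 : 0 < om.
Variables (k : {poly C}) (c : C).
Hypothesis kc : Lop x1 (conjc x2) k = expo n.+1 (conjc x1) + c *: 'X^(n.+1).
Hypothesis cE : c * DD n.+1 t =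
    - \sum_(m < n.+1) conjc x1 ^+ m * ff m t * conjc x2 ^+ (n.+1 - m).

Local Notation u x := (x1 - x%:C * (x1 - x2)).
Local Notation q x := ((1 - x) * r1 + x * r2).
Local Notation bv := (conjc x2 * (x1 - x2)).

(** The integrating factor of the equation for [k] along the segment [u x] from [x1] to [x2], where
    [x1 - u x = x (x1 - x2)]. The factor x^2 removes the unknown value of [k] at the singular point
    [x1]. *)
Lemma flow_deriv (x : R) :
  cderiv (fun x => x%:C * x%:C * (cexp (x%:C * bv) * k.[u x])) x
    (x%:C * cexp (x%:C * bv) * (ep n.+1 (u x * conjc x1) + c * u x ^+ n.+1)).
Proof.
have hu := cderivB (cderiv_cst x1 x) (cderivM (cderiv_id x) (cderiv_cst (x1 - x2) x)).
have := cderivM (cderivM (cderiv_id x) (cderiv_id x))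
  (cderivM (cderiv_cexp bv x) (cderiv_horner k hu)).
move=> H; apply: cderiv_eq H _.
have : (Lop x1 (conjc x2) k).[u x] = ep n.+1 (u x * conjc x1) + c * u x ^+ n.+1.
  by rewrite kc hornerD hornerZ hornerXn horner_expo.
move=> <-; rewrite /Lop hornerD hornerN hornerD !hornerZ !hornerM hornerD hornerN hornerC hornerX.
ring.
Qed.

Lemma limit_deriv (s : R) (x : R) : 0 < s ->
  cderiv (fun x => (1 - (1 + s%:C * x%:C) * cexp (x%:C * (- s)%:C)) / (s ^+ 2)%:C) x
    (x%:C * cexp (x%:C * (- s)%:C)).
Proof.
move=> s0.
have hp := cderivD (cderiv_cst 1 x) (cderivZ s%:C (cderiv_id x)).
have := cderivM (cderivB (cderiv_cst 1 x) (cderivM hp (cderiv_cexp (- s)%:C x)))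
  (cderiv_cst (s ^+ 2)%:C^-1 x).
move=> H; apply: cderiv_eq H _.
have sc0 : s%:C != 0 :> C by rewrite -normc_gt0 normc_real gtr0_norm.
rewrite expr2 real_complexM real_complexN.
by move: (s%:C) sc0 (cexp _) => S S0 A; field.
Qed.

Lemma normc_u x : 0 <= x <= 1 -> normc (u x) <= q x <= rm.
Proof.
move=> /andP[x0 x1']; apply/andP; split.
  rewrite (_ : u x = (1 - x)%:C * x1 + x%:C * x2); last by rewrite real_complexB; ring.
  by rewrite (le_trans (le_normcD _ _))// !normcM !normc_real !ger0_norm ?subr_ge0.
have -> : rm = (1 - x) * rm + x * rm by ring.
by rewrite lerD// ler_wpM2l// subr_ge0.
Qed.

Lemma Re_bv : complex.Re bv = (r1 ^+ 2 - r2 ^+ 2 - om ^+ 2) / 2.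
Proof.
rewrite !normcE2; case: x1 => a b; case: x2 => p r.
by rewrite cReM cReD cImD cReN cImN cRe_conj cIm_conj /=; field.
Qed.

(** The exponents collected from the correction term in [flow_error]; in each ordering of [r1] and
    [r2] the difference is a nonnegative combination of squares. *)
Lemma exponent_le x : 0 <= x <= 1 ->
  x * complex.Re bv + big * q x + r1 * small <=
  r1 ^+ 2 + om ^+ 2 / 2 + complex.Re t.
Proof.
move=> /andP[x0 x1']; rewrite Re_bv Re_mul_conjc.
have h1 := mulr_ge0 x0 (sqr_ge0 (r1 - r2)).
have h2 := mulr_ge0 x0 (sqr_ge0 om).
have h3 := sqr_ge0 (r1 - r2).
have h4 : 0 <= (1 - x) * (r1 - r2) ^+ 2 by rewrite mulr_ge0 ?subr_ge0 ?sqr_ge0.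
by case: (leP r1 r2) => r12; lra.
Qed.

Lemma exponent_le1 x : 0 <= x <= 1 ->
  x * complex.Re bv + q x * r1 <= r1 ^+ 2 + om ^+ 2 / 2.
Proof.
move=> /andP[x0 x1']; rewrite Re_bv.
have h1 := mulr_ge0 x0 (sqr_ge0 (r1 - r2)).
have h2 := mulr_ge0 x0 (sqr_ge0 om).
have h3 := sqr_ge0 om.
lra.
Qed.

(** Two errors are compared with the limiting derivative: the cut-off of the exponential ([hB]) and
    the degree [n.+1] correction ([hC]). The correction contributes 2 N^3 and the cut-off at most
    N^3. *)
Lemma flow_error x : 0 <= x <= 1 ->
  normc (x%:C * cexp (x%:C * bv) * (ep n.+1 (u x * conjc x1) + c * u x ^+ n.+1) -
    (expR (r1 ^+ 2))%:C * (x%:C * cexp (x%:C * (- om ^+ 2)%:C))) <=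
  3 * N ^+ 3 * eta * expR (om ^+ 2 / 2) * expR (r1 ^+ 2).
Proof.
move=> x01; have /andP[uq qr] := normc_u x01; have /andP[x0 xle1] := x01.
have q0 : 0 <= q x by rewrite addr_ge0 ?mulr_ge0// subr_ge0.
(* The two exponents on the right add up to [r1 ^+ 2 - x * om ^+ 2]: this is how the distance [om]
   appears. *)
have hE : (expR (r1 ^+ 2))%:C * cexp (x%:C * (- om ^+ 2)%:C) =
    cexp (x%:C * bv) * cexp (u x * conjc x1).
  rewrite -cexp_real -!cexpD; congr cexp.
  by rewrite real_complexN -!mul_conjc conjcB; ring.
rewrite [(expR _)%:C * _]mulrCA hE.
set A := cexp (x%:C * bv); set B := ep _ _; set D := cexp (u x * _).
rewrite (_ : _ - _ = x%:C * (A * (B - D) + c * u x ^+ n.+1 * A)); last by ring.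
rewrite normcM normc_real ger0_norm//.
have nA : normc A = expR (x * complex.Re bv).
  by rewrite /A normc_cexp (cReM x%:C) mul0r subr0.
have hB : normc (A * (B - D)) <= eta * (expR (om ^+ 2 / 2) * expR (r1 ^+ 2)).
  have [] := @ep_near (u x * conjc x1) (q x * r1).
  - by rewrite normcM normc_conj ler_wpM2r.
  - exact: rr_rm.
  move=> _ h; rewrite normcM nA normcB.
  rewrite (le_trans (ler_wpM2l (expR_ge0 _) h))// mulrCA ler_wpM2l// -!expRD ler_expR.
  by rewrite [leRHS]addrC exponent_le1.
have hC : normc (c * u x ^+ n.+1 * A) <=
    2 * N ^+ 3 * eta * (expR (om ^+ 2 / 2) * expR (r1 ^+ 2)).
  have F0 : 0 < n.+1`!%:R :> R by rewrite ltr0n fact_gt0.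
  have E0 := expR_gt0 (complex.Re t).
  have cle := correction_le cE.
  have bigm : big <= rm by rewrite ge_max r1m r2m.
  have [_ T1 _] := tails (rr_rm big0 q0 bigm qr).
  have T2 : (big * q x) ^+ n.+1 <= n.+1`!%:R * (eta * expR (big * q x)).
    rewrite ler_pdivrMr ?ltr0n ?fact_gt0// in T1.
    rewrite (le_trans T1)// mulrC ler_wpM2r ?mulr_ge0 ?expR_ge0// ler_nat.
    by rewrite leq_fact.
  (* Multiplying by [expR (Re t)] and by the factorial brings [c] into the form bounded by
     [correction_le]. *)
  rewrite -(ler_pM2r E0) -(ler_pM2r F0).
  rewrite normcM normcM nA normcX.
  rewrite [leLHS](_ : _ = normc c * expR (complex.Re t) * n.+1`!%:R *
     (normc (u x) ^+ n.+1 * expR (x * complex.Re bv))); last by ring.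
  rewrite (le_trans (ler_wpM2r _ cle)) ?mulr_ge0 ?exprn_ge0 ?normc_ge0 ?expR_ge0//.
  rewrite [leLHS](_ : _ = 2 * N ^+ 3 * (big ^+ n.+1 * normc (u x) ^+ n.+1) *
     (expR (r1 * small) * expR (x * complex.Re bv))); last by ring.
  rewrite -exprMn.
  apply: le_trans (_ : 2 * N ^+ 3 * (n.+1`!%:R * (eta * expR (big * q x))) *
     (expR (r1 * small) * expR (x * complex.Re bv)) <= _).
    rewrite ler_wpM2r ?mulr_ge0 ?expR_ge0// ler_wpM2l ?mulr_ge0 ?exprn_ge0//.
    rewrite (le_trans _ T2)// lerXn2r// ?nnegrE ?mulr_ge0 ?normc_ge0//.
    by rewrite ler_wpM2l.
  rewrite [leLHS](_ : _ = 2 * N ^+ 3 * eta * n.+1`!%:R *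
    (expR (x * complex.Re bv) * expR (big * q x) * expR (r1 * small))); last by ring.
  rewrite [leRHS](_ : _ = 2 * N ^+ 3 * eta * n.+1`!%:R *
    (expR (r1 ^+ 2) * expR (om ^+ 2 / 2) * expR (complex.Re t))); last by ring.
  rewrite ler_wpM2l ?mulr_ge0 ?exprn_ge0//.
  by rewrite -!expRD ler_expR exponent_le.
have N1 : 1 <= N ^+ 3 by rewrite exprn_ege1// ler1n.
set K := expR (om ^+ 2 / 2) * expR (r1 ^+ 2) in hB hC.
have eK : 0 <= eta * K by rewrite mulr_ge0// mulr_ge0 ?expR_ge0.
have h1 := ler_wpM2r eK N1.
apply: le_trans (_ : normc (A * (B - D) + c * u x ^+ n.+1 * A) <= _).
  by rewrite ler_piMl// normc_ge0.
rewrite (le_trans (le_normcD _ _))//.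
rewrite [leRHS](_ : _ = 3 * (N ^+ 3 * (eta * K))); last by rewrite /K; ring.
lra.
Qed.

(** The mean value inequality for the difference of the flow and its explicit limit; both vanish at
    [x = 0], and at [x = 1] the flow has arrived at [x2]. *)
Lemma kernel_near : exists kap,
  normc kap <= 3 * N ^+ 3 * eta * expR (om ^+ 2 / 2) /\
  cexp bv * k.[x2] = (expR (r1 ^+ 2))%:C *
    (((1 - (1 + om ^+ 2) * expR (- om ^+ 2)) / om ^+ 4)%:C + kap).
Proof.
have s0 : 0 < om ^+ 2 by rewrite exprn_gt0.
have hd x := cderivB (flow_deriv x)
  (cderivZ (expR (r1 ^+ 2))%:C (limit_deriv x s0)).
have := cmean_value hd flow_error.
set E := (expR (r1 ^+ 2))%:C.
have E0 : E != 0 by rewrite /E -cexp_real cexp_neq0.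
set K := 3 * _ ^+ 3 * _ * _.
cbv beta; rewrite !mul0r !mulr0 addr0 !mul1r cexp0 subrr mul0r mulr0 subr0 mulr1 subr0.
have -> : x1 - (x1 - x2) = x2 by ring.
rewrite cexp_real.
set P := (_ / (_ ^+ 2)%:C); set Q := cexp bv * _ => h.
exists ((Q - E * P) / E); split.
  rewrite normcM normcV normc_real ger0_norm ?expR_ge0//.
  by rewrite ler_pdivrMr ?expR_gt0// -subr0.
have -> : ((1 - (1 + om ^+ 2) * expR (- om ^+ 2)) / om ^+ 4)%:C = P.
  rewrite (real_complexM _ (om ^+ 4)^-1) real_complexV /P -exprM; congr (_ / _).
  by rewrite real_complexB (real_complexM (1 + _)) real_complexD.
by move: (E) E0 (P) (Q) => F F0 P0 Q0; field.
Qed.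

End errors.

(** * Assembling the quotient with relative errors *)

Section limit_ratio.
Context {R : realType}.
Implicit Types s : R.

(** From [expR s >= (1 + s / 2) ^+ 2]. With [gap_ge] it turns absolute errors into relative ones,
    since both limiting expressions may be small. *)
Lemma kernel_limit_ge s : 0 < s ->
  expR (- s) / 4 <= (1 - (1 + s) * expR (- s)) / s ^+ 2.
Proof.
move=> s0; rewrite ler_pdivlMr ?exprn_gt0//.
have e1 : expR s * expR (- s) = 1 by rewrite -expRD subrr expR0.
have h : 1 + s + s ^+ 2 / 4 <= expR s.
  have h1 := expR_ge1Dx (s / 2).
  have -> : expR s = expR (s / 2) ^+ 2 by rewrite -expRM_natl; congr expR; field.
  have -> : 1 + s + s ^+ 2 / 4 = (1 + s / 2) ^+ 2 by field.
  by rewrite lerXn2r// nnegrE ?expR_ge0//; lra.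
have := ler_wpM2r (expR_ge0 (- s)) h; rewrite e1; lra.
Qed.

Lemma gap_ge s : 0 < s -> s * expR (- s) <= 1 - expR (- s).
Proof.
move=> s0; have e1 : expR s * expR (- s) = 1 by rewrite -expRD subrr expR0.
have := ler_wpM2r (expR_ge0 (- s)) (expR_ge1Dx s); rewrite e1; lra.
Qed.

Lemma ratio_error (k1 k2 k3 : R[i]) (th : R) : th <= 4^-1 ->
  normc k1 <= th -> normc k2 <= th -> normc k3 <= th ->
  1 + k3 != 0 /\ normc ((1 + k1) * (1 + k2) / (1 + k3) - 1) <= 8 * th.
Proof.
move=> t4 h1 h2 h3.
have th0 : 0 <= th by rewrite (le_trans _ h1)// normc_ge0.
have h : 2^-1 <= normc (1 + k3).
  have : normc (1 : R[i]) <= normc (1 + k3) + normc k3.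
    by rewrite -[X in normc X <= _](addrK k3) (le_trans (le_normcD _ _))// normcN.
  by rewrite normc1; lra.
have n0 : 1 + k3 != 0 by rewrite -normc_gt0; lra.
split=> //.
have -> : (1 + k1) * (1 + k2) / (1 + k3) - 1 = (k1 + k2 + k1 * k2 - k3) / (1 + k3).
  by field.
rewrite normcM normcV ler_pdivrMr ?normc_gt0//.
apply: le_trans (_ : 4 * th <= _); last first.
  by have := ler_wpM2l th0 h; lra.
have h12 : normc (k1 * k2) <= th.
  rewrite normcM -[leRHS]mulr1 ler_pM ?normc_ge0//; lra.
have := le_normcD (k1 + k2 + k1 * k2) (- k3); rewrite normcN.
have := le_normcD (k1 + k2) (k1 * k2).
have := le_normcD k1 k2.
lra.
Qed.

End limit_ratio.

Section cond_expectation.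
Context {R : realType}.
Local Notation C := R[i].
Variables (n : nat) (z1 z2 : C) (eta rm : R).
Local Notation N := (n.+2%:R : R).
Local Notation r := (Num.sqrt N).
Let x1 : C := r%:C * z1.
Let x2 : C := r%:C * z2.
Local Notation s := (r * normc (z1 - z2)).
Local Notation Psi := ((1 - (1 + s ^+ 2) * expR (- s ^+ 2)) / s ^+ 4).
Local Notation Delta := (1 - expR (- s ^+ 2)).
Local Notation theta := (12 * N ^+ 3 * eta * expR (2 * s ^+ 2) * (1 + (s ^+ 2)^-1)).

Hypothesis r1m : r * normc z1 <= rm.
Hypothesis r2m : r * normc z2 <= rm.
Hypothesis eta0 : 0 <= eta.
Hypothesis tails : forall rho : R, 0 <= rho <= rm ^+ 2 ->
  [/\ rho <= n%:R, rho ^+ n.+1 / n`!%:R <= eta * expR rho &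
      rho ^+ n.+2 / n.+1`!%:R <= eta * expR rho].
Hypothesis s_gt0 : 0 < s.
Hypothesis theta_le : theta <= 4^-1.

Let r_ge0 : 0 <= r. Proof. exact: sqrtr_ge0. Qed.

Let normc_r (z : C) : normc (r%:C * z) = r * normc z.
Proof. by rewrite normcM normc_real ger0_norm. Qed.

Let omE : normc (x1 - x2) = s.
Proof. by rewrite -mulrBr normc_r. Qed.

Let s2_gt0 : 0 < s ^+ 2. Proof. by rewrite exprn_gt0. Qed.

Let theta_ge (A x y : R) : 0 <= A <= 12 * N ^+ 3 -> x <= 2 * s ^+ 2 ->
  y <= 1 + (s ^+ 2)^-1 -> 0 <= y -> A * eta * expR x * y <= theta.
Proof.
move=> /andP[A0 A1] xs ys y0.
rewrite ler_pM ?mulr_ge0 ?expR_ge0// ler_pM ?mulr_ge0 ?expR_ge0// ?ler_expR//.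
by rewrite ler_wpM2r.
Qed.

Let N3 : 1 <= N ^+ 3. Proof. by rewrite exprn_ege1// ler1n. Qed.

Let y1 : 1 <= 1 + (s ^+ 2)^-1.
Proof. by rewrite lerDl invr_ge0 ltW. Qed.

Let eta1 : eta <= 4^-1.
Proof.
rewrite (le_trans _ theta_le)// (le_trans _ (theta_ge (A := 1) (x := 0) (y := 1) _ _ _ _))//.
- by rewrite expR0 mul1r !mulr1.
- by have := N3; lra.
- by have := s2_gt0; lra.
Qed.

(** The three relative errors, from [ff_near], [kernel_near] and [den_near], are each at most
    [theta], and [ratio_error] combines them. *)
Lemma cond_expectation_near : exists2 e : C, normc e <= 8 * theta &
  cond_expectation_overlap12 n z1 z2 =
  - (N%:C - x1 * conjc x2) * (Psi / Delta)%:C * (1 + e).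
Proof.
have r1m' : normc x1 <= rm by rewrite normc_r.
have r2m' : normc x2 <= rm by rewrite normc_r.
have eta01 : 0 <= eta <= 1 by rewrite eta0 (le_trans eta1)//; lra.
have om_gt0 : 0 < normc (x1 - x2) by rewrite omE.
have eta_om' : 2 * eta * expR (normc (x1 - x2) ^+ 2 / 2) <= theta.
  rewrite -[leLHS]mulr1 omE; apply: theta_ge => //.
  - by have := N3; lra.
  - by have := s2_gt0; lra.
have eta_om : 2 * eta * expR (normc (x1 - x2) ^+ 2 / 2) <= 2^-1.
  by rewrite (le_trans eta_om')// (le_trans theta_le)//; lra.
have Psi_gt0 : 0 < Psi.
  have := kernel_limit_ge s2_gt0; rewrite -exprM => h.
  by rewrite (lt_le_trans _ h)// divr_gt0 ?expR_gt0.
have Delta_gt0 : 0 < Delta.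
  by rewrite (lt_le_trans _ (gap_ge s2_gt0))// mulr_gt0 ?expR_gt0.
have [k2 [k2e ffE]] := ff_near r1m' r2m' eta01 tails.
have [k3 [k3e denE]] := den_near r1m' r2m' eta01 tails.
have ff0 := ff_neq0 r1m' r2m' eta01 tails eta_om.
have f0 : n.+1`!%:R != 0 :> C by rewrite pnatr_eq0 -lt0n fact_gt0.
have D0 : DD n.+1 (x1 * conjc x2) != 0 by rewrite /DD mulf_neq0.
have [k [c [kc cE kdet]]] := overlap_kernel (conjc x1) D0.
have [k1 [k1e kE]] := kernel_near r1m' r2m' eta01 tails eta_om om_gt0 kc cE.
rewrite !omE in k1e k2e k3e denE kE.
have x12 : x1 != x2 by rewrite -subr_eq0 -normc_gt0.
have z12 : z1 != z2 by apply: contraNneq x12; rewrite /x1 => ->.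
have x12' : conjc x1 != conjc x2 by rewrite -subr_eq0 -conjcB -normc_gt0 normc_conj.
have e11 : ep n.+2 (x1 * conjc x1) != 0.
  have rr : 0 <= normc x1 ^+ 2 <= rm ^+ 2.
    by rewrite sqr_ge0 lerXn2r// nnegrE ?normc_ge0// (le_trans _ r1m')// normc_ge0.
  have [] := @ep_near _ n eta rm tails (x1 * conjc x1) (normc x1 ^+ 2) _ rr.
    by rewrite normcM normc_conj.
  rewrite mul_conjc cexp_real => h _.
  apply: contraL h => /eqP ->; rewrite subr0 -ltNge normc_real ger0_norm ?expR_ge0//.
  by rewrite gtr_pMl ?expR_gt0// (le_lt_trans eta1)//; lra.
have P0 : \prod_(i < n.+1) i`!%:R != 0 :> C.
  by apply/prodf_neq0 => i _; rewrite pnatr_eq0 -lt0n fact_gt0.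
have sN : (x1 - x2) * (conjc x1 - conjc x2) = (s ^+ 2)%:C.
  by rewrite -conjcB mul_conjc omE.
have s0 : (s ^+ 2)%:C != 0 :> C by rewrite -normc_gt0 normc_real gtr0_norm.
have detD : \det (denM n z1 z2) = \prod_(i < n.+1) i`!%:R * n.+1`!%:R *
    ((expR (normc x1 ^+ 2 + normc x2 ^+ 2))%:C * (Delta%:C + k3) / (s ^+ 2)%:C).
  rewrite /denM -/x1 -/x2 det_gform_lin2// sN.
  by rewrite denE big_ord_recr.
have DeltaC : Delta%:C != 0 :> C by rewrite -normc_gt0 normc_real gtr0_norm.
have PsiC : Psi%:C != 0 :> C by rewrite -normc_gt0 normc_real gtr0_norm.
have [k3' k3E k3e'] : exists2 k3', k3 = Delta%:C * k3' & normc k3' <= theta.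
  exists (k3 / Delta%:C); first by rewrite mulrCA divff// mulr1.
  rewrite normcM normcV normc_real gtr0_norm// ler_pdivrMr// (le_trans k3e)//.
  apply: le_trans (_ : theta * (s ^+ 2 * expR (- s ^+ 2)) <= _); last first.
    by rewrite ler_wpM2l ?gap_ge// !mulr_ge0 ?exprn_ge0 ?expR_ge0// (le_trans _ y1).
  (* Dividing by the gap [1 - expR (- s ^+ 2)] is the source of the factor [(s ^+ 2)^-1] in
     [theta]. *)
  apply: le_trans (_ : 6 * eta * expR (s ^+ 2) * (s ^+ 2)^-1 *
      (s ^+ 2 * expR (- s ^+ 2)) <= _).
    rewrite expRN; have := expR_gt0 (s ^+ 2); move: (s ^+ 2) s2_gt0 (expR (s ^+ 2)) => u u0 E E0.
    by rewrite [leRHS](_ : _ = 6 * eta)//; field; rewrite !gt_eqF.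
  rewrite ler_wpM2r ?mulr_ge0 ?expR_ge0 ?sqr_ge0 ?normc_ge0//; apply: theta_ge.
  - by have := N3; lra.
  - by have := s2_gt0; lra.
  - by rewrite lerDr.
  - by rewrite invr_ge0 ltW.
have [k1' k1E k1e'] : exists2 k1', k1 = Psi%:C * k1' & normc k1' <= theta.
  exists (k1 / Psi%:C); first by rewrite mulrCA divff// mulr1.
  rewrite normcM normcV normc_real gtr0_norm// ler_pdivrMr// (le_trans k1e)//.
  apply: le_trans (_ : theta * (expR (- s ^+ 2) / 4) <= _); last first.
    have := kernel_limit_ge s2_gt0; rewrite -exprM => h.
    by rewrite ler_wpM2l// !mulr_ge0 ?exprn_ge0 ?expR_ge0// (le_trans _ y1).
  (* The constant 12 in [theta] is 3 from [kernel_near] times 4 from [kernel_limit_ge]. *)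
  apply: le_trans (_ : 12 * N ^+ 3 * eta * expR (s ^+ 2 / 2 + s ^+ 2) * 1 *
      (expR (- s ^+ 2) / 4) <= _).
    rewrite expRN expRD; have := expR_gt0 (s ^+ 2).
    move: (expR (s ^+ 2)) (expR (s ^+ 2 / 2)) => E F E0.
    rewrite [leRHS](_ : _ = 3 * N ^+ 3 * eta * F)//; field.
    by rewrite gt_eqF.
  rewrite ler_wpM2r ?mulr_ge0 ?expR_ge0//; apply: theta_ge => //.
  - by have := N3; lra.
  - by have := s2_gt0; lra.
have k2e' : normc k2 <= theta by move: eta_om'; rewrite omE; exact: le_trans.
have [n3 eE] := ratio_error theta_le k2e' k1e' k3e'.
exists ((1 + k2) * (1 + k1') / (1 + k3') - 1) => //.
have ES0 : (expR (normc x1 ^+ 2 + normc x2 ^+ 2))%:C != 0 :> C.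
  by rewrite -cexp_real cexp_neq0.
have k3D : Delta%:C + k3 = Delta%:C * (1 + k3') by rewrite k3E mulrDr mulr1.
have k1D : Psi%:C + k1 = Psi%:C * (1 + k1') by rewrite k1E mulrDr mulr1.
have detD0 : \det (denM n z1 z2) != 0.
  by rewrite detD k3D !mulf_neq0// invr_neq0.
rewrite cond_expectation_det// detD /numM -/x1 -/x2 kdet.
have -> : (N * normc (z1 - z2) ^+ 2)%:C = (s ^+ 2)%:C.
  by rewrite exprMn sqr_sqrtr.
rewrite /DD ffE k3D.
(* All exponential prefactors of numerator and denominator cancel by this identity. *)
have ct : cexp (x1 * conjc x2) * (expR (normc x1 ^+ 2))%:C =
    (expR (normc x1 ^+ 2 + normc x2 ^+ 2))%:C * cexp (conjc x2 * (x1 - x2)).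
  rewrite -!cexp_real -!cexpD real_complexD -!mul_conjc; congr cexp; ring.
have b0 := cexp_neq0 (conjc x2 * (x1 - x2)).
have -> : k.[x2] = (expR (normc x1 ^+ 2))%:C * (Psi%:C * (1 + k1')) /
    cexp (conjc x2 * (x1 - x2)).
  by rewrite -k1D -kE mulrAC divff// mul1r.
rewrite (real_complexM Psi Delta^-1) real_complexV.
move: (cexp (conjc x2 * _)) b0 ct => B B0 ct.
move: (expR (normc x1 ^+ 2 + _))%:C ES0 ct => ES ES0 ct.
have -> : ES = cexp (x1 * conjc x2) * (expR (normc x1 ^+ 2))%:C / B.
  by rewrite ct mulfK.
have E0 : (expR (normc x1 ^+ 2))%:C != 0 :> C by rewrite -cexp_real cexp_neq0.
move: (cexp_neq0 (x1 * conjc x2)) (expR (normc x1 ^+ 2))%:C E0.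
move: (cexp (x1 * conjc x2)) => ct' ct0 E E0.
move: (\prod_(i < n.+1) _) P0 => P P0.
move: (n.+1`!%:R) f0 => f f0.
move: (Psi%:C) (Delta%:C) DeltaC ((s ^+ 2)%:C) s0 => Ps De De0 S S0.
by field; rewrite n3 De0 S0 B0 E0 ct0 f0 P0.
Qed.

End cond_expectation.

(** * Poisson tails and the choice of scales *)

Section poisson_tail.
Context {R : realType}.
Implicit Types (u rho A r : R).

(** The factors (1 - u/2)^2 and 1 - u^2/4 are bounded by the two exponentials, and their product is
    at least 1 - u. *)
Lemma one_sub_le_expR u : 0 <= u <= 1 -> 1 - u <= expR (- u - u ^+ 2 / 4).
Proof.
move=> /andP[u0 u1].
have h1 : (1 - u / 2) ^+ 2 <= expR (- u).
  have -> : expR (- u) = expR (- (u / 2)) ^+ 2 by rewrite -expRM_natl; congr expR; field.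
  rewrite lerXn2r// ?nnegrE ?expR_ge0//; first lra.
  by have := expR_ge1Dx (- (u / 2)); lra.
have h2 : 1 - u ^+ 2 / 4 <= expR (- (u ^+ 2 / 4)).
  by have := expR_ge1Dx (- (u ^+ 2 / 4)); lra.
have u2 : 0 <= 1 - u ^+ 2 / 4.
  have : u ^+ 2 <= 1 by rewrite expr_le1. lra.
rewrite expRD; apply: le_trans (ler_pM (sqr_ge0 _) u2 h1 h2).
rewrite -subr_ge0.
have -> : (1 - u / 2) ^+ 2 * (1 - u ^+ 2 / 4) - (1 - u) =
  u ^+ 2 / 4 * (u * (1 - u / 4)) by field.
by rewrite !mulr_ge0 ?sqr_ge0//; lra.
Qed.

(** Write [rho = m (1 - u)]: the bound m^m / m! <= e^m replaces Stirling's formula, and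
    [one_sub_le_expR] supplies the Gaussian gain. *)
Lemma poisson_weight_le rho m : (0 < m)%N -> 0 <= rho <= m%:R ->
  rho ^+ m / m`!%:R <= expR (rho - (m%:R - rho) ^+ 2 / (4 * m%:R)).
Proof.
move=> m0 /andP[rho0 rhom]; have M0 : 0 < m%:R :> R by rewrite ltr0n.
pose u := 1 - rho / m%:R.
have u01 : 0 <= u <= 1.
  by rewrite /u subr_ge0 ler_pdivrMr// mul1r rhom /= gerBl divr_ge0// ltW.
have rhoE : rho = m%:R * (1 - u) by rewrite /u; field; rewrite gt_eqF.
have h1 : (1 - u) ^+ m <= expR (m%:R * (- u - u ^+ 2 / 4)).
  rewrite expRM_natl lerXn2r// ?nnegrE ?expR_ge0//; first by lra.
  exact: one_sub_le_expR.
have h2 := powX_fact_le_expR m (ltW M0).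
have -> : rho - (m%:R - rho) ^+ 2 / (4 * m%:R) = m%:R + m%:R * (- u - u ^+ 2 / 4).
  by rewrite rhoE; field; rewrite gt_eqF.
rewrite expRD rhoE exprMn mulrAC.
by apply: ler_pM => //; rewrite exprn_ge0; lra.
Qed.

(** Since [A <= r], [rho] lies at least [3/4 r A] below N; because [r A >= 4], the distance to
    [n.+1] is still at least [r A / 2]. Its square over [4 N] is [A ^+ 2 / 16]. The factor N
    compensates for the factorial of [m - 1] in place of that of [m]. *)
Lemma poisson_tails n A r : r ^+ 2 = n.+2%:R -> 4 <= r -> 1 <= A <= r ->
  forall rho, 0 <= rho <= (r - A / 2) ^+ 2 ->
  [/\ rho <= n%:R, rho ^+ n.+1 / n`!%:R <= n.+2%:R * expR (- (A ^+ 2 / 16)) * expR rho &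
      rho ^+ n.+2 / n.+1`!%:R <= n.+2%:R * expR (- (A ^+ 2 / 16)) * expR rho].
Proof.
move=> rN r4 /andP[A1 Ar] rho /andP[rho0 rhom].
have rA : 4 <= r * A by rewrite -[leLHS]mulr1 ler_pM.
have AA : A ^+ 2 <= r * A by rewrite expr2 ler_wpM2r//; lra.
have N2 : n%:R + 2 = n.+2%:R :> R by rewrite -[in RHS]addn2 natrD.
have N1 : n.+1%:R + 1 = n.+2%:R :> R by rewrite -[in RHS]addn1 natrD.
have rhoN : rho <= n.+2%:R - 3 / 4 * (r * A) by rewrite -rN; lra.
have key m : (0 < m)%N -> n.+1%:R <= m%:R :> R -> m%:R <= n.+2%:R :> R ->
    rho ^+ m / m.-1`!%:R <= n.+2%:R * expR (- (A ^+ 2 / 16)) * expR rho.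
  move=> m0 m1 m2; have M0 : 0 < m%:R :> R by rewrite ltr0n.
  have f0 : 0 < m.-1`!%:R :> R by rewrite ltr0n fact_gt0.
  have -> : rho ^+ m / m.-1`!%:R = m%:R * (rho ^+ m / m`!%:R).
    rewrite -{5}(prednK m0) factS natrM (prednK m0).
    by move: (m%:R) (m.-1`!%:R) M0 f0 => p q p0 q0; field; rewrite !gt_eqF.
  rewrite -[leRHS]mulrA; apply: ler_pM => //; first by rewrite divr_ge0 ?exprn_ge0.
  rewrite (le_trans (poisson_weight_le m0 _))//; first by rewrite rho0/=; lra.
  rewrite -expRD ler_expR [leRHS]addrC lerD2l lerN2 ler_pdivlMr; last by lra.
  have d : r * A / 2 <= m%:R - rho by lra.
  apply: le_trans (_ : (r * A / 2) ^+ 2 <= _); last first.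
    by rewrite lerXn2r// nnegrE; lra.
  have -> : (r * A / 2) ^+ 2 = A ^+ 2 / 16 * (4 * n.+2%:R) by rewrite -rN; field.
  by rewrite ler_wpM2l ?divr_ge0 ?sqr_ge0// ler_wpM2l.
split; first lra.
- by apply: (key n.+1) => //; lra.
- by apply: (key n.+2) => //; lra.
Qed.

End poisson_tail.

Section choice_of_scale.
Context {R : realType}.
Variables (kappa eps C : R).
Hypotheses (hkappa : 0 < kappa < 2^-1) (heps : 0 < eps) (hC : 0 < C).

(** The upper bound on [s] keeps the loss [expR (2 * s ^+ 2)] below half of the decay
    [expR (- (A ^+ 2 / 16))]; the other half beats any power of N, in particular the one coming from
    the prefactors and from the lower bound on [s]. *)
Lemma error_decay : exists (K : R) (N0 : nat), forall (n : nat) (s : R),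
  let N : R := n.+2%:R in let A := N `^ kappa in
  let theta := 12 * N ^+ 3 * (N * expR (- (A ^+ 2 / 16))) *
    expR (2 * s ^+ 2) * (1 + (s ^+ 2)^-1) in
  (N0 <= n.+2)%N -> N `^ (- C) <= s <= N `^ (kappa - eps) ->
  [/\ 4 <= Num.sqrt N, 1 <= A <= Num.sqrt N, 0 < s <= A / 2, theta <= 4^-1 &
      8 * theta <= K * N `^ (- 2 * kappa + eps)].
Proof.
have /andP[k0 k12] := hkappa.
(* With this [k], [A ^ (2 k)] exceeds [N ^ (5 + 2 C)]: 4 powers from the prefactor, [2 C] from [s],
   and one more to leave [1 / N]. *)
pose k := Num.bound ((5 + 2 * C) / (2 * kappa)).
have hk : 5 + 2 * C <= 2 * kappa * k%:R.
  have : 0 <= (5 + 2 * C) / (2 * kappa).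
    by rewrite divr_ge0 ?addr_ge0 ?mulr_ge0// ltW.
  by move=> /archi_boundP /ltW; rewrite -/k ler_pdivrMr ?mulr_gt0// [_ * (2 * _)]mulrC.
pose W : R := k`!%:R * 32 ^+ k.
have W0 : 0 <= W by rewrite mulr_ge0 ?exprn_ge0.
(* The three thresholds give [4 <= sqrt N], then [N ^ eps >= 8] and hence [s <= A / 8], then
   [24 W / N <= 1 / 4]. The constant 192 is 8 times 24. *)
exists (192 * W), (maxn 16 (maxn (Num.bound (8 `^ (eps^-1))) (Num.bound (96 * W)))).
move=> n s N A theta; rewrite !geq_max => /and3P[n16 n1 n2] /andP[sC sk].
have N16 : 16 <= N by rewrite /N ler_nat.
have N0 : 0 < N by rewrite (lt_le_trans _ N16).
have N1 : 1 <= N by rewrite (le_trans _ N16)// ler1n.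
have NW : 96 * W <= N.
  have /archi_boundP/ltW h : 0 <= 96 * W by rewrite mulr_ge0.
  by rewrite (le_trans h)// ler_nat.
have ND : 8 <= N `^ eps.
  have /archi_boundP/ltW h := powR_ge0 (8 : R) eps^-1.
  have h8 : 8 `^ eps^-1 <= N by rewrite (le_trans h)// ler_nat.
  have -> : 8 = (8 `^ eps^-1) `^ eps :> R.
    by rewrite -powRrM mulVf ?gt_eqF// powRr1.
  by apply: ge0_ler_powR; rewrite ?nnegrE ?powR_ge0// ltW.
have pD x y : N `^ (x + y) = N `^ x * N `^ y by rewrite powRD ?(gt_eqF N0) ?implybT.
have s0 : 0 < s by rewrite (lt_le_trans _ sC)// powR_gt0.
have A1 : 1 <= A by rewrite -(powRr0 N) ler_powR// ltW.
have A0 : 0 < A by rewrite (lt_le_trans _ A1).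
have sA : s <= A / 8.
  rewrite (le_trans sk)// powRB ?(gt_eqF N0) ?implybT// -/A.
  by rewrite ler_pM2l// lef_pV2 ?posrE// powR_gt0.
have s2A : 2 * s ^+ 2 <= A ^+ 2 / 32.
  have : s ^+ 2 <= (A / 8) ^+ 2 by rewrite lerXn2r// nnegrE; lra.
  by rewrite expr_div_n; lra.
have NC1 : 1 <= N `^ C by rewrite -(powRr0 N) ler_powR// ltW.
have sV : 1 + (s ^+ 2)^-1 <= 2 * (N `^ C) ^+ 2.
  have h1 : 1 <= (N `^ C) ^+ 2 by rewrite exprn_ege1.
  have h2 : (s ^+ 2)^-1 <= (N `^ C) ^+ 2.
    rewrite -exprVn lerXn2r// ?nnegrE ?invr_ge0 ?powR_ge0 ?(ltW s0)//.
    by rewrite -[leRHS]invrK lef_pV2 ?posrE ?invr_gt0 ?powR_gt0// -powRN.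
  lra.
have AW : expR (- (A ^+ 2 / 32)) <= W / (A ^+ 2) ^+ k.
  have x0 : 0 <= A ^+ 2 / 32 by rewrite divr_ge0 ?sqr_ge0.
  have := powX_fact_le_expR k x0.
  rewrite expRN => h; have h0 : 0 < (A ^+ 2 / 32) ^+ k / k`!%:R.
    by rewrite divr_gt0 ?exprn_gt0 ?divr_gt0 ?exprn_gt0// ltr0n fact_gt0.
  rewrite (le_trans (_ : _ <= ((A ^+ 2 / 32) ^+ k / k`!%:R)^-1))//.
    by rewrite lef_pV2 ?posrE ?expR_gt0.
  by rewrite invf_div expr_div_n invf_div mulrA.
have NA : N ^+ 4 * (N `^ C) ^+ 2 * N <= (A ^+ 2) ^+ k.
  rewrite -exprM -!powR_mulrn ?powR_ge0 ?(ltW N0)// -!powRrM natrM.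
  rewrite -[X in _ * X](powRr1 (ltW N0)) -!pD ler_powR//.
  by rewrite (le_trans _ (le_trans hk _))//; lra.
have thE : theta <= 24 * W / N.
  have h : theta <= 12 * N ^+ 3 * N * expR (- (A ^+ 2 / 32)) * (2 * (N `^ C) ^+ 2).
    rewrite /theta ler_pM ?addr_ge0 ?invr_ge0 ?sqr_ge0 ?mulr_ge0 ?expR_ge0 ?exprn_ge0 ?(ltW N0)//.
    rewrite mulrA -[leLHS]mulrA -expRD ler_wpM2l ?mulr_ge0 ?exprn_ge0 ?(ltW N0)//.
    by rewrite ler_expR; lra.
  rewrite (le_trans h)//.
  apply: le_trans (_ : 24 * (N ^+ 4 * (N `^ C) ^+ 2) * (W / (A ^+ 2) ^+ k) <= _).
    rewrite [leLHS](_ : _ = 24 * (N ^+ 4 * (N `^ C) ^+ 2) * expR (- (A ^+ 2 / 32))); last by ring.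
    by rewrite ler_wpM2l// !mulr_ge0 ?exprn_ge0 ?powR_ge0 ?(ltW N0).
  have P0 : 0 < (A ^+ 2) ^+ k by rewrite !exprn_gt0.
  have -> (x y : R) : 24 * x * (W / y) = 24 * W * (x / y) by ring.
  rewrite ler_wpM2l ?mulr_ge0// ler_pdivrMr// [leRHS]mulrC ler_pdivlMr//.
(* Here [kappa < 1/2] enters. *)
have NV : N^-1 <= N `^ (- 2 * kappa + eps).
  by rewrite -powR_inv1 ?(ltW N0)// ler_powR// mulNr; move: k12 heps; lra.
split.
- rewrite -(_ : Num.sqrt 16 = 4 :> R) ?ler_sqrt//.
  by rewrite (_ : 16 = 4 ^+ 2) ?sqrtr_sqr ?ger0_norm// expr2; ring.
- by rewrite A1 -powR12_sqrt ?(ltW N0)// ler_powR// ltW.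
- by rewrite s0; lra.
- rewrite (le_trans thE)// ler_pdivrMr//; lra.
- rewrite (le_trans (ler_wpM2l _ thE))//.
  rewrite [leLHS](_ : _ = 192 * W * N^-1); last by ring.
  by rewrite ler_wpM2l// mulr_ge0.
Qed.

End choice_of_scale.

(** * The uniform asymptotics in the original variables *)

Theorem theorem1p3 (R : realType) (kappa eps C : R)
    (hkappa : 0 < kappa < 2^-1) (heps : 0 < eps) (hC : 0 < C) :
  exists (K : R) (N0 : nat), forall (n : nat) (z1 z2 : R[i]),
    let N : R := n.+2%:R in
    let omega : R := Num.sqrt N * normc (z1 - z2) in
    (N0 <= n.+2)%N ->
    normc z1 < 1 - N `^ (- 2^-1 + kappa) ->
    N `^ (- C) <= omega <= N `^ (kappa - eps) ->
    overlap12_integrable n z1 z2 /\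
    exists2 e : R[i],
      normc e <= K * N `^ (- 2 * kappa + eps) &
      cond_expectation_overlap12 n z1 z2 =
        - N%:C * ((1 - z1 * conjc z2) / (omega ^+ 4)%:C)
        * ((1 - (1 + omega ^+ 2) * expR (- omega ^+ 2))
           / (1 - expR (- omega ^+ 2)))%:C
        * (1 + e).
Proof.
have [K [N0 H]] := error_decay hkappa heps hC.
exists K, N0 => n z1 z2 N om nN0 z1N omN.
have [r4 A1 /andP[s0 sA] th1 th2] := H n om nN0 omN.
set A := _ `^ kappa in A1 sA th1 th2.
have z12 : z1 != z2.
  by apply: contraTneq s0 => z12; rewrite /om z12 subrr normc0 mulr0 ltxx.
split; first exact: overlap12_integrableP.
have Npos : 0 < N by rewrite /N ltr0n.
set r := Num.sqrt N in r4 A1.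
have rr : r ^+ 2 = N by rewrite sqr_sqrtr// ltW.
have r0 : 0 < r by lra.
(* With [A = N ^ kappa], the distance of [z1] to the unit circle is [A / r]. *)
have rz1 : r * normc z1 <= r - A.
  have -> : r - A = r * (1 - N `^ (- 2^-1 + kappa)).
    rewrite powRD ?(gt_eqF Npos) ?implybT// powRN powR12_sqrt ?(ltW Npos)// -/r -/A.
    by rewrite mulrBr mulr1 mulrA divff ?mul1r ?gt_eqF.
  by rewrite ler_wpM2l// ltW.
have A0 : 0 <= A by exact: powR_ge0.
(* As [om <= A / 2], [z2] inherits half of the room that [z1] has; this is the radius used in
   [poisson_tails]. *)
have rz2 : r * normc z2 <= r - A / 2.
  have : r * normc z2 <= r * normc z1 + om.
    rewrite /om -mulrDr ler_wpM2l ?(ltW r0)//.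
    by rewrite -[in leLHS](subrK z1 z2) addrC (le_trans (le_normcD _ _))// lerD2l normcB.
  lra.
have rz1' : r * normc z1 <= r - A / 2 by lra.
have [e e8 ->] := cond_expectation_near rz1' rz2
  (mulr_ge0 (ltW Npos) (expR_ge0 _)) (poisson_tails rr r4 A1) s0 th1.
exists e; first exact: le_trans th2.
have N0' : N%:C != 0 :> R[i] by rewrite -normc_gt0 normc_real gtr0_norm.
have -> : r%:C * z1 * conjc (r%:C * z2) = N%:C * (z1 * conjc z2).
  have -> : conjc (r%:C * z2) = r%:C * conjc z2 by rewrite conjcM conjc_real.
  by rewrite -rr expr2 real_complexM; ring.
congr (_ * _).
rewrite -/om (real_complexM _ (1 - expR (- om ^+ 2))^-1).
rewrite (real_complexM (1 - _) (om ^+ 4)^-1) (real_complexV (om ^+ 4)).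
rewrite (real_complexM (1 - _) (1 - expR (- om ^+ 2))^-1).
by move: (_^-1)%:C (_^-1) (1 - _)%:C => X Y Z; ring.
Qed.
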